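(* Let $\mu$ be a probability measure on $\mathbb R^n$ with finite second moment and finite Fisher information $I(\mu\mid\gamma)<\infty$. Then there exist random vectors $Y,W$ on a common probability space, with finite second moments, such that $Y+W$ has law $\mu$, $\mathbb E[\langle Y,W\rangle]=0$, and, writing $\nu$ for the law of $Y$, \[ \delta(\mu)\ge\frac12\mathrm W_2^2(\nu,\gamma). \]
   Context: $\gamma$ is the standard Gaussian measure on $\mathbb R^n$. For $\mu$ with density $f=d\mu/d\gamma$, $\delta(\mu)=\frac12\int|\nabla\log f|^2d\mu-\int\log f\,d\mu$ is the log-Sobolev deficit. $\mathrm W_2(\mu,\nu)=\inf\mathbb E[|X-Y|^2]^{1/2}$ over couplings $(X,Y)$ of $(\mu,\nu)$. *)

(* Defs.v *)
From HB Require Import structures.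
From mathcomp Require Import all_boot all_order all_algebra.
From mathcomp Require Import all_classical all_reals all_analysis.
Set Implicit Arguments.
Unset Strict Implicit.
Unset Printing Implicit Defensive.
Import Order.TTheory GRing.Theory Num.Theory.
Import numFieldNormedType.Exports.
Local Open Scope classical_set_scope.
Local Open Scope ring_scope.

Section rV_measurable.
Context (R : realType) (n : nat).

Definition rV_coord (i : 'I_n) (x : 'rV[R]_n) : R := x ord0 i.

Let rV_set0 : g_sigma_preimage rV_coord set0.
Proof. exact: sigma_algebra0. Qed.

Let rV_setC A : g_sigma_preimage rV_coord A ->
  g_sigma_preimage rV_coord (~` A).
Proof. exact: sigma_algebraC. Qed.

Let rV_bigcup (F : _^nat) : (forall i, g_sigma_preimage rV_coord (F i)) ->
  g_sigma_preimage rV_coord (\bigcup_i (F i)).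
Proof. exact: sigma_algebra_bigcup. Qed.

HB.instance Definition _ :=
  @isMeasurable.Build default_measure_display 'rV[R]_n
    (g_sigma_preimage rV_coord) rV_set0 rV_setC rV_bigcup.

End rV_measurable.

Section defs.
Context (R : realType) (n : nat).
Local Notation V := 'rV[R]_n.

Definition dotv (x y : V) : R := \sum_(i < n) x ord0 i * y ord0 i.
Definition sqnorm (x : V) : R := dotv x x.

Definition gauss_dens (x : V) : R :=
  (Num.sqrt (pi *+ 2))^-1 ^+ n * expR (- (sqnorm x / 2)).

(* gam is the standard Gaussian measure gamma on R^n: the product of n
   standard normal laws (characterised on measurable rectangles, which
   determines it uniquely on the product sigma-algebra). *)
Definition is_std_gaussian (gam : probability V R) : Prop :=
  forall A : 'I_n -> set R, (forall i, measurable (A i)) ->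
    gam [set x : V | forall i, A i (x ord0 i)] =
    (\prod_(i < n) normal_prob 0 1 (A i))%E.

Definition is_density (gam mu : probability V R) (f : V -> R) : Prop :=
  measurable_fun setT f /\ (forall x, 0 <= f x) /\
  forall A, measurable A -> mu A = (\int[gam]_(x in A) (f x)%:E)%E.

Definition iterD (vs : seq V) (psi : V -> R) : V -> R :=
  foldr (fun v h => 'D_v h) psi vs.

Definition test_fun (psi : V -> R) : Prop :=
  (forall (vs : seq V) (x : V), differentiable (iterD vs psi) x) /\
  compact (closure [set x | psi x != 0]).

Definition partial (i : 'I_n) (psi : V -> R) : V -> R :=
  'D_(delta_mx ord0 i) psi.

(* local integrability w.r.t. Lebesgue measure on R^n; Lebesgue integrals
   are written as integrals against gam with the factor 1/gauss_dens,
   i.e. dx = gauss_dens(x)^-1 dgam(x). *)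
Definition loc_integrable (gam : probability V R) (h : V -> R) : Prop :=
  measurable_fun setT h /\
  forall K : set V, compact K ->
    (\int[gam]_(x in K) (`|h x| / gauss_dens x)%:E < +oo)%E.

Definition weak_grad (gam : probability V R) (f : V -> R) (g : V -> V)
  : Prop :=
  loc_integrable gam f /\
  (forall i, loc_integrable gam (fun x => g x ord0 i)) /\
  forall (psi : V -> R), test_fun psi -> forall i : 'I_n,
    (\int[gam]_x (f x * partial i psi x / gauss_dens x)%:E =
     - \int[gam]_x (g x ord0 i * psi x / gauss_dens x)%:E)%E.

(* Fisher information I(mu|gam) = int |grad log f|^2 dmu, with
   grad log f = grad f / f, grad f the weak gradient g *)
Definition fisher_info (mu : probability V R) (f : V -> R) (g : V -> V)
  : \bar R :=
  (\int[mu]_x (sqnorm ((f x)^-1 *: g x))%:E)%E.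

Definition lsi_deficit (mu : probability V R) (f : V -> R) (g : V -> V)
  : \bar R :=
  ((2^-1)%:E * fisher_info mu f g - \int[mu]_x (ln (f x))%:E)%E.

Definition is_coupling (nu1 nu2 : set V -> \bar R)
  (pi : probability (V * V)%type R) : Prop :=
  (forall A, measurable A -> pi (A `*` setT) = nu1 A) /\
  (forall B, measurable B -> pi (setT `*` B) = nu2 B).

Definition W2sq (nu1 nu2 : set V -> \bar R) : \bar R :=
  ereal_inf [set (\int[pi]_z (sqnorm (z.1 - z.2))%:E)%E |
             pi in [set pi | is_coupling nu1 nu2 pi]].

End defs.

(* Main.v *)
(* Let f = dmu/dgam, v = grad f / f, X of law mu, and let T be the Knothe map,
   which transports mu to gam one coordinate at a time.  Integration by parts
   on lines, with ln y <= y - 1 in place of a change of variables, gives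
     E[ln f] <= E[- v.T + X.T - n + |X|^2/2 - |T|^2/2],
   and with E[v.X] = E|X|^2 - n this reads 2 delta >= E|v + T - X|^2, hence
   2 delta >= (M - n)^2 / E|X|^2 with M = E[X.T], by Cauchy-Schwarz against X.
   The Y with E[Y.(X - Y)] = 0 form the L^2 sphere of centre X/2 and radius
   |X/2|.  If M < n, then T lies outside this sphere and its nearest point Y on
   it satisfies E|Y - T|^2 <= (n - M)^2 / E|X|^2.  If M >= n, a mixture of the
   law of (X, T) and of mu x gam couples X to some Y of law gam with
   E[X.Y] = n = E|Y|^2, so that W_2 vanishes. *)

Require Import Defs.
From HB Require Import structures.
From mathcomp Require Import all_boot all_order all_algebra.
From mathcomp Require Import all_classical all_reals all_analysis.
From mathcomp Require Import measurable_realfun ring lra.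
Import Order.TTheory GRing.Theory Num.Theory.
Import numFieldNormedType.Exports.
Local Open Scope classical_set_scope.
Local Open Scope ring_scope.
Set Implicit Arguments.
Unset Strict Implicit.
Unset Printing Implicit Defensive.

(** * Real-valued integrals and densities *)

(** The Knothe map is used rather than the optimal one because its Jacobian is triangular: only
    diagonal derivatives enter, and each belongs to a one-dimensional monotone rearrangement, given
    by an explicit formula. Even such a rearrangement can jump where the density vanishes, so its
    derivative is never formed; the ratio [p / nphi (T)] stands for it, and its mean comes from a
    layer formula.

    Three obstacles shape the rest. Since [g] is only a weak gradient, [f nphi] must first be shown
    to be a primitive on almost every line, for which product test functions and rational endpoints
    suffice. Since [g / f] reads 0 where [f = 0], the Fisher information controls [g] only off the
    zero set; that [g] vanishes on this set has to be proved while [g] is merely locally integrable.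
    Finally, transporting a coordinate given the earlier ones involves marginals of [f], and the
    gradient is carried to them in the integrated line form, which is stable under averaging.

    As [ln f] has no integrability known in advance, an explicit majorant is integrated in its
    place. *)

Notation itg m h := (m.-integrable setT (EFin \o h)).

Section real_integral.
Context d (T : measurableType d) (R : realType).
Variable m : {measure set T -> \bar R}.
Implicit Types h k : T -> R.

(* [filterS] with the filter fixed: unification does not find it for measures on
   [measurableTypeR]. *)
Lemma ae_S (P Q : T -> Prop) : (forall x, P x -> Q x) ->
  (\forall x \ae m, P x) -> \forall x \ae m, Q x.
Proof. exact: filterS. Qed.

Lemma ae_S2 (P Q S : T -> Prop) : (forall x, P x -> Q x -> S x) ->
  (\forall x \ae m, P x) -> (\forall x \ae m, Q x) -> \forall x \ae m, S x.
Proof. exact: filterS2. Qed.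

Lemma ae_S3 (P Q S U : T -> Prop) : (forall x, P x -> Q x -> S x -> U x) ->
  (\forall x \ae m, P x) -> (\forall x \ae m, Q x) -> (\forall x \ae m, S x) ->
  \forall x \ae m, U x.
Proof. exact: filterS3. Qed.

Lemma ae_W (P : T -> Prop) : (forall x, P x) -> \forall x \ae m, P x.
Proof. by move=> ?; exact: nearW. Qed.

Lemma itg_meas h : itg m h -> measurable_fun setT h.
Proof. by move=> /measurable_int /measurable_EFinP. Qed.

Lemma itgP h : measurable_fun setT h ->
  (\int[m]_x (`|h x|)%:E < +oo)%E -> itg m h.
Proof. by move=> mh hoo; apply/integrableP; split => //; exact/measurable_EFinP. Qed.

Lemma itg_lty h : itg m h -> (\int[m]_x (`|h x|)%:E < +oo)%E.
Proof. by move=> /integrableP[]. Qed.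

Lemma itg_le h k : measurable_fun setT h -> itg m k ->
  (forall x, `|h x| <= k x) -> itg m h.
Proof.
move=> mh ik hk; apply: (le_integrable measurableT _ _ ik).
  exact/measurable_EFinP.
by move=> x _ /=; rewrite lee_fin (le_trans (hk x))// ler_norm.
Qed.

Lemma itgD h k : itg m h -> itg m k -> itg m (fun x => h x + k x).
Proof. by move=> ih ik; have := integrableD measurableT ih ik. Qed.

Lemma itgN h : itg m h -> itg m (fun x => - h x).
Proof. by move=> ih; have := integrableN ih. Qed.

Lemma itgB h k : itg m h -> itg m k -> itg m (fun x => h x - k x).
Proof. by move=> ih ik; apply: itgD ih (itgN ik). Qed.

Lemma itgZ c h : itg m h -> itg m (fun x => c * h x).
Proof. by move=> ih; have := integrableZl measurableT c ih. Qed.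

Lemma itg_norm h : itg m h -> itg m (fun x => `|h x|).
Proof. by move=> ih; apply: (integrable_norm ih). Qed.

Lemma itg_bdd h k C : measurable_fun setT h -> itg m k ->
  (forall x, `|h x| <= C) -> itg m (fun x => h x * k x).
Proof.
move=> mh ik hC; apply: (itg_le _ (itgZ C (itg_norm ik))).
  by apply: measurable_funM => //; exact: itg_meas.
by move=> x; rewrite normrM ler_wpM2r.
Qed.

(** The real integral is [fine] of the extended one, hence 0 when that is infinite; this is why
    [itg] side conditions accompany every linear manipulation. *)
Lemma RintD h k : itg m h -> itg m k ->
  \int[m]_x (h x + k x) = \int[m]_x h x + \int[m]_x k x.
Proof. by move=> ih ik; rewrite RintegralD. Qed.

Lemma RintB h k : itg m h -> itg m k ->
  \int[m]_x (h x - k x) = \int[m]_x h x - \int[m]_x k x.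
Proof. by move=> ih ik; rewrite RintegralB. Qed.

Lemma RintZ c h : itg m h -> \int[m]_x (c * h x) = c * \int[m]_x h x.
Proof. by move=> ih; rewrite RintegralZl. Qed.

Lemma RintN h : itg m h -> \int[m]_x (- h x) = - \int[m]_x h x.
Proof.
move=> ih; rewrite -mulN1r -RintZ//.
by apply: eq_Rintegral => x _; rewrite mulN1r.
Qed.

Lemma le_Rint h k : itg m h -> itg m k -> (forall x, h x <= k x) ->
  \int[m]_x h x <= \int[m]_x k x.
Proof. by move=> ih ik hk; apply: le_Rintegral. Qed.

Lemma EFin_Rint h : itg m h -> (\int[m]_x h x)%:E = (\int[m]_x (h x)%:E)%E.
Proof. by move=> ih; rewrite fineK//; exact: integrable_fin_num ih. Qed.

Lemma ae_eq_Rint h k : measurable_fun setT h -> measurable_fun setT k ->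
  (\forall x \ae m, h x = k x) -> \int[m]_x h x = \int[m]_x k x.
Proof.
move=> mh mk hk; congr fine; apply: ae_eq_integral => //.
- exact/measurable_EFinP.
- exact/measurable_EFinP.
- by move: hk; apply: filterS => x -> _.
Qed.

Lemma ae_itg h k : measurable_fun setT h -> itg m k ->
  (\forall x \ae m, h x = k x) -> itg m h.
Proof.
move=> mh ik hk; apply: itgP => //.
rewrite (_ : (\int[m]_x (`|h x|)%:E)%E = (\int[m]_x (`|k x|)%:E)%E).
  exact: itg_lty.
apply: ae_eq_integral => //.
- by apply/measurable_EFinP; exact: measurableT_comp.
- by apply/measurable_EFinP; apply: measurableT_comp => //; exact: itg_meas.
- by move: hk; apply: filterS => x -> _.
Qed.

Lemma Rint_ge0 h : (forall x, 0 <= h x) -> 0 <= \int[m]_x h x.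
Proof. by move=> h0; apply: Rintegral_ge0. Qed.

Lemma itg_ge0P h r : measurable_fun setT h -> (forall x, 0 <= h x) ->
  (\int[m]_x (h x)%:E = r%:E)%E -> itg m h.
Proof.
move=> mh h0 hr; apply: itgP => //.
rewrite (_ : (\int[m]_x (`|h x|)%:E)%E = r%:E) ?ltry//.
by rewrite -hr; apply: eq_integral => x _; rewrite ger0_norm.
Qed.

Lemma Rint_eq0 h : itg m h -> (forall x, 0 <= h x) ->
  \int[m]_x h x = 0 -> \forall x \ae m, h x = 0.
Proof.
move=> ih h0 hr.
have : (\int[m]_x `|(h x)%:E| = 0)%E.
  rewrite -[0%E]/(0%:E) -hr EFin_Rint//; apply: eq_integral => x _ /=.
  by rewrite ger0_norm.
move/(ae_eq_integral_abs m measurableT (measurable_int _ ih)).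
by apply: filterS => x /(_ Logic.I) [].
Qed.

Lemma measurable_b2R (D : set T) (b : T -> bool) : measurable_fun D b ->
  measurable_fun D (fun x => (b x)%:R : R).
Proof.
move=> mb; rewrite (_ : (fun x => _) = (fun x => if b x then 1 else 0 : R)).
  move=> mD; apply: measurable_fun_if => //.
by apply/funext => x; case: (b x).
Qed.

Lemma cvg_Rint (h_ : (T -> R)^nat) h k :
  (forall n, measurable_fun setT (h_ n)) -> measurable_fun setT h ->
  (\forall x \ae m, h_ ^~ x @ \oo --> h x) ->
  itg m k -> (forall n x, `|h_ n x| <= k x) ->
  itg m h /\ (\int[m]_x h_ n x @[n --> \oo] --> \int[m]_x h x).
Proof.
move=> mh_ mh hh ik hk.
have [||||| ih _ cvg] := @dominated_convergence _ _ _ m _ measurableT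
  (fun n x => (h_ n x)%:E) (EFin \o h) (EFin \o k).
- by move=> n; apply/measurable_EFinP.
- exact/measurable_EFinP.
- move: hh; apply: filterS => x hx _ /=.
  by apply: cvg_EFin => //; exact: nearW.
- exact: ik.
- by apply: nearW => x n _; rewrite /= lee_fin.
split => //; move: cvg; rewrite -(EFin_Rint ih) => /fine_cvgP[_].
by [].
Qed.

Lemma measurable_indR (A : set T) : measurable A ->
  measurable_fun setT (fun x => \1_A x : R).
Proof. by move=> mA; exact: measurable_indic. Qed.

End real_integral.

Lemma itg_bool d (T : measurableType d) (R : realType) (m : {measure set T -> \bar R})
    (b : T -> bool) (h : T -> R) :
  measurable_fun setT b -> itg m h -> itg m (fun x => (b x)%:R * h x).
Proof.
move=> mb ih; apply: (@itg_bdd _ _ _ _ _ _ 1) => //; first exact: measurable_b2R.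
by move=> x; case: (b x); rewrite ?normr1 ?normr0.
Qed.

Lemma Rint_ae0 d (T : measurableType d) (R : realType) (m : {measure set T -> \bar R}) (k : T -> R) :
  measurable_fun setT k -> (\forall x \ae m, k x = 0) -> \int[m]_x k x = 0.
Proof.
move=> mk k0; rewrite (ae_eq_Rint (k := fun=> 0) mk)//.
by rewrite /Rintegral integral0.
Qed.

Lemma Rint_ge0_ae d (T : measurableType d) (R : realType) (m : {measure set T -> \bar R})
    (h : T -> R) : itg m h -> (\forall x \ae m, 0 <= h x) -> 0 <= \int[m]_x h x.
Proof.
move=> ih h0; have ih' := itg_norm ih.
rewrite (ae_eq_Rint (itg_meas ih) (itg_meas ih')); first exact: Rint_ge0.
by apply: ae_S h0 => x hx; rewrite ger0_norm.
Qed.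

Lemma le_Rint_ae d (T : measurableType d) (R : realType) (m : {measure set T -> \bar R})
    (h k : T -> R) : itg m h -> itg m k -> (\forall x \ae m, h x <= k x) ->
  \int[m]_x h x <= \int[m]_x k x.
Proof.
move=> ih ik hk; rewrite -subr_ge0 -RintB//; apply: Rint_ge0_ae; first exact: itgB.
by apply: ae_S hk => x; rewrite subr_ge0.
Qed.

Lemma measurable_invr d (T : measurableType d) (R : realType) (h : T -> R) :
  measurable_fun setT h -> measurable_fun setT (fun x => (h x)^-1).
Proof.
(* The real power is the inverse only on nonnegative arguments, so negative ones are reflected; at 0
   both conventions give 0. *)
move=> mh; pose w (r : R) := (0 <= r)%R%:R * (r `^ -1) - (r < 0)%R%:R * ((- r) `^ -1).
have mw : measurable_fun setT w.
  apply: measurable_funB; apply: measurable_funM.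
  - by apply: measurable_b2R; exact: measurable_fun_ler.
  - exact: measurable_powR.
  - by apply: measurable_b2R; exact: measurable_fun_ltr.
  - exact: measurableT_comp (measurable_powR _) _.
rewrite (_ : (fun x => _) = w \o h); first exact: measurableT_comp.
apply/funext => x /=; rewrite /w.
have [h0|h0] := leP 0 (h x); first by rewrite mul1r mul0r subr0 powR_inv1.
by rewrite mul0r mul1r sub0r powR_inv1 ?oppr_ge0 ?(ltW h0)// invrN opprK.
Qed.

(** * Tonelli and Fubini for real-valued functions *)

Section fubini.
Context d1 d2 (T1 : measurableType d1) (T2 : measurableType d2) (R : realType).
Variable m1 : {sigma_finite_measure set T1 -> \bar R}.
Variable m2 : {sigma_finite_measure set T2 -> \bar R}.
Implicit Types h : T1 * T2 -> R.

(** Tonelli applies to the positive and negative parts separately, and their difference remains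
    measurable after [fine], whether or not the line integrals are finite. *)
Lemma measurable_Rint1 h : measurable_fun setT h ->
  measurable_fun setT (fun x => \int[m2]_y h (x, y)).
Proof.
move=> mh; rewrite /Rintegral; apply: measurableT_comp => //.
under eq_fun do rewrite integralE.
have mEh : measurable_fun setT (EFin \o h) by exact/measurable_EFinP.
apply: emeasurable_funB.
- rewrite (_ : (fun x => _) = fubini_F m2 (EFin \o h)^\+%E); last first.
    by apply/funext => x; apply: eq_integral => y _; rewrite !funeposE.
  exact: (measurable_fun_fubini_tonelli_F _ (measurable_funepos mEh)
    (funepos_ge0 _)).
- rewrite (_ : (fun x => _) = fubini_F m2 (EFin \o h)^\-%E); last first.
    by apply/funext => x; apply: eq_integral => y _; rewrite !funenegE.
  exact: (measurable_fun_fubini_tonelli_F _ (measurable_funeneg mEh)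
    (funeneg_ge0 _)).
Qed.

Lemma itg_prod h : measurable_fun setT h ->
  (\int[m1]_x \int[m2]_y (`|h (x, y)|)%:E < +oo)%E -> itg (m1 \x m2)%E h.
Proof. by move=> mh hoo; apply/integrable12ltyP => //; exact/measurable_EFinP. Qed.

Lemma itg_line h : itg (m1 \x m2)%E h ->
  \forall x \ae m1, itg m2 (fun y => h (x, y)).
Proof. exact: ae_integrable1. Qed.

Let Rint_line h : itg (m1 \x m2)%E h ->
  \forall x \ae m1, (\int[m2]_y h (x, y))%:E = (\int[m2]_y (h (x, y))%:E)%E.
Proof. by move=> /itg_line; apply: filterS => x ih; rewrite EFin_Rint. Qed.

Lemma itg_Rint h : itg (m1 \x m2)%E h -> itg m1 (fun x => \int[m2]_y h (x, y)).
Proof.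
move=> ih; have iF := integrable_fubini_F ih.
have mF := measurable_Rint1 (itg_meas ih).
apply: itgP => //; move/integrableP : iF => [miF]; apply: le_lt_trans.
rewrite le_eqVlt; apply/orP; left; apply/eqP.
apply: ae_eq_integral => //.
- by apply/measurable_EFinP; exact: measurableT_comp.
- exact: (measurableT_comp _ miF).
- move: (Rint_line ih); apply: filterS => x xE _.
  by rewrite /fubini_F /= -xE.
Qed.

Lemma Rint_prod h : itg (m1 \x m2)%E h ->
  \int[(m1 \x m2)%E]_z h z = \int[m1]_x \int[m2]_y h (x, y).
Proof.
move=> ih; congr fine; rewrite -(integral12_prod_meas1 ih).
apply: ae_eq_integral => //.
- exact: measurable_int (integrable_fubini_F ih).
- by apply/measurable_EFinP; exact: measurable_Rint1 (itg_meas ih).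
- by move: (Rint_line ih); apply: filterS => x xE _; rewrite /fubini_F /= -xE.
Qed.

End fubini.

(** Tonelli's criterion in the form available later: the lines are controlled only off a null set,
    and through a majorant of their real integrals. *)
Lemma itg_prod_lines d1 d2 (T1 : measurableType d1) (T2 : measurableType d2) (R : realType)
    (m1 : {sigma_finite_measure set T1 -> \bar R}) (m2 : {sigma_finite_measure set T2 -> \bar R})
    (h : T1 * T2 -> R) (r : T1 -> R) :
  measurable_fun setT h -> itg m1 r ->
  (\forall x \ae m1, itg m2 (fun s => h (x, s))) ->
  (\forall x \ae m1, \int[m2]_s `|h (x, s)| <= r x) -> itg (m1 \x m2)%E h.
Proof.
move=> mh ir H1 H2; apply: itg_prod => //.
apply: (@le_lt_trans _ _ (\int[m1]_x (`|r x|)%:E)%E); last exact: itg_lty ir.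
apply: ae_ge0_le_integral => //.
- by move=> x _; apply: integral_ge0.
- apply: (@measurable_fun_fubini_tonelli_F _ _ _ _ R m2 (fun z => (`|h z|)%:E)) => //.
  by apply/measurable_EFinP; exact: measurableT_comp.
- by apply/measurable_EFinP; apply: measurableT_comp => //; exact: itg_meas ir.
apply: ae_S2 H1 H2 => x ix rx _.
rewrite -EFin_Rint; last exact: itg_norm ix.
by rewrite lee_fin (le_trans rx)// ler_norm.
Qed.

Section fubini_swap.
Context d1 d2 (T1 : measurableType d1) (T2 : measurableType d2) (R : realType).
Variable m1 : {sigma_finite_measure set T1 -> \bar R}.
Variable m2 : {sigma_finite_measure set T2 -> \bar R}.
Implicit Types h : T1 * T2 -> R.

Lemma itg_swap h : itg (m1 \x m2)%E h ->
  itg (m2 \x m1)%E (fun z => h (z.2, z.1)).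
Proof.
move=> ih; apply: itg_prod.
  apply: (measurableT_comp (itg_meas ih)).
  by apply/measurable_fun_pairP; split => //=; [exact: measurable_snd|exact: measurable_fst].
by apply/(integrable21ltyP m1 m2 (f := EFin \o h)) => //; exact: measurable_int ih.
Qed.

Lemma Rint_swap h : itg (m1 \x m2)%E h ->
  \int[m1]_x \int[m2]_y h (x, y) = \int[m2]_y \int[m1]_x h (x, y).
Proof.
move=> ih; rewrite -(Rint_prod ih) -(Rint_prod (itg_swap ih)).
congr fine; rewrite -(integral12_prod_meas1 ih) -(integral12_prod_meas1 (itg_swap ih)).
rewrite /fubini_F /=; exact: (Fubini ih).
Qed.

End fubini_swap.

(** * Integration against a measure given by a density *)

Section density.
Context d (T : measurableType d) (R : realType).
Variables m1 m2 : {sigma_finite_measure set T -> \bar R}.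
Variable h : T -> R.
Hypothesis mh : measurable_fun setT h.
Hypothesis h0 : forall x, 0 <= h x.
Hypothesis m1h : forall A, measurable A -> m1 A = (\int[m2]_(x in A) (h x)%:E)%E.
Local Notation lam := (@lebesgue_measure R).

Let w (k : T -> R) (z : T * R) : R := ((0 <= z.2) && (z.2 < k z.1))%:R.

Let layer (k : T -> R) : (forall x, 0 <= k x) -> forall x,
  ((k x)%:E = \int[lam]_r (w k (x, r))%:E)%E.
Proof.
move=> k0 x; rewrite (_ : (\int[lam]_r _ = \int[lam]_r
    (\1_(`[0%R, k x[%classic : set R) r)%:E)%E); last first.
  apply: eq_integral => r _; congr EFin; rewrite indicE /w /=; congr (_%:R).
  congr nat_of_bool; apply/idP/idP; first by move=> h'; apply/mem_set; rewrite /= in_itv.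
  by move/set_mem; rewrite /= in_itv.
rewrite integral_indic//= setIT lebesgue_measure_itv/= lte_fin.
have [kx|] := ltP 0 (k x); first by rewrite oppr0 adde0.
by move=> kx; congr EFin; apply/le_anti; rewrite kx k0.
Qed.

(** Layer cake: [k x] is the length of [[0, k x[], so Tonelli turns both sides into integrals over
    [r] of the mass of the level set [r < k], to which [m1h] applies. *)
Lemma ge0_integral_density (k : T -> R) : measurable_fun setT k ->
  (forall x, 0 <= k x) ->
  (\int[m1]_x (k x)%:E = \int[m2]_x (k x * h x)%:E)%E.
Proof.
move=> mk k0.
have mb : measurable_fun setT (fun z : T * R => (0 <= z.2) && (z.2 < k z.1)).
  apply: measurable_and; first exact: measurable_fun_ler.
  by apply: measurable_fun_ltr => //; exact: measurableT_comp.
have mw : measurable_fun setT (w k) by exact: measurable_b2R.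
have w0 z : 0 <= w k z by rewrite ler0n.
under eq_integral do rewrite (layer k0).
rewrite (@fubini_tonelli _ _ _ _ _ m1 lam (EFin \o w k))//; last first.
  exact/measurable_EFinP.
have mwh : measurable_fun setT (fun z : T * R => w k z * h z.1).
  by apply: measurable_funM => //; exact: measurableT_comp.
transitivity (\int[m2]_x \int[lam]_r (w k (x, r) * h x)%:E)%E; last first.
  apply: eq_integral => x _; under eq_integral do rewrite EFinM.
  rewrite ge0_integralZr//.
  - by rewrite EFinM -(layer k0).
  - by apply/measurable_EFinP; exact: measurableT_comp mw _.
  - by move=> r _; rewrite lee_fin.
  - by rewrite lee_fin.
have mEwh : measurable_fun setT (fun z : T * R => (w k z * h z.1)%:E).
  exact/measurable_EFinP.
have wh0 (z : T * R) : (0 <= (w k z * h z.1)%:E)%E by rewrite lee_fin mulr_ge0.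
apply: etrans (esym (@fubini_tonelli _ _ _ _ _ m2 lam _ mEwh wh0)).
apply: eq_integral => r _ /=.
pose A := [set x | (0 <= r) && (r < k x)].
have mA : measurable A.
  have mbr := measurableT_comp mb (measurable_pair2 r).
  by rewrite -[A]setTI; apply: (mbr measurableT [set true]).
have Aw x : (x \in A) = ((0 <= r) && (r < k x)).
  by apply/idP/idP => [/set_mem//|h']; apply/mem_set.
transitivity (m1 A).
  rewrite -[A in RHS]setIT -integral_indic//; apply: eq_integral => x _.
  by rewrite indicE Aw.
rewrite m1h// integral_mkcond; apply: eq_integral => x _.
rewrite /w patchE Aw /=; case: ifPn => _ /=.
  by rewrite mul1r.
by rewrite mul0r.
Qed.

Lemma itg_density (k : T -> R) : measurable_fun setT k ->
  itg m1 k <-> itg m2 (fun x => k x * h x).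
Proof.
move=> mk; have mkh : measurable_fun setT (fun x => k x * h x).
  exact: measurable_funM.
have mn : measurable_fun setT (fun x => `|k x|) by exact: measurableT_comp.
have E : (\int[m1]_x (`|k x|)%:E = \int[m2]_x (`|k x * h x|)%:E)%E.
  rewrite (ge0_integral_density mn)//; apply: eq_integral => x _.
  by rewrite normrM (ger0_norm (h0 x)).
by split => ik; apply: itgP => //; [rewrite -E|rewrite E]; exact: itg_lty.
Qed.

Lemma Rint_density (k : T -> R) : itg m1 k ->
  \int[m1]_x k x = \int[m2]_x (k x * h x).
Proof.
move=> ik; have mk := itg_meas ik; have ikh := (itg_density mk).1 ik.
have ia := itg_norm ik; have iS := itgD ik ia.
have gP (f : T -> R) : itg m1 f -> (forall x, 0 <= f x) ->
    \int[m1]_x f x = \int[m2]_x (f x * h x).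
  by move=> /itg_meas mf f0; congr fine; rewrite ge0_integral_density.
have s0 x : 0 <= k x + `|k x| by have := ler_norm (- k x); rewrite normrN; lra.
(* Both [k + |k|] and [|k|] are nonnegative, which reduces the claim to the previous case. *)
transitivity (\int[m1]_x (k x + `|k x|) - \int[m1]_x `|k x|).
  by rewrite -RintB//; apply: eq_Rintegral => x _; rewrite addrK.
rewrite !gP// -RintB.
- by apply: eq_Rintegral => x _; rewrite -mulrBl addrK.
- by apply/itg_density => //; exact: itg_meas iS.
- by apply/itg_density => //; exact: itg_meas ia.
Qed.

End density.

(** * Primitives on the line and the layer formula *)

Section line.
Context (R : realType).
Local Notation lam := (@lebesgue_measure R).
Implicit Types (h p q tau : R -> R).

(** The primitive from minus infinity. With an indicator in place of a varying domain, its
    continuity and its limits are instances of dominated convergence. *)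
Definition prim h (y : R) : R := \int[lam]_s ((s <= y)%R%:R * h s).

Lemma itg_le_half h y : itg lam h -> itg lam (fun s => (s <= y)%R%:R * h s).
Proof. by move=> ih; apply: itg_bool => //; exact: measurable_fun_ler. Qed.

Lemma ae_neq (y : R) : \forall s \ae lam, s != y.
Proof.
exists [set y]; split => //; first exact: lebesgue_measure_set1.
by move=> s /= /negP; rewrite negbK => /eqP.
Qed.

Lemma ae_itv_ex (P : R -> Prop) (a b : R) : a < b ->
  (\forall s \ae lam, P s) -> exists s, a < s < b /\ P s.
Proof.
move=> ab [N [mN N0 sub]]; apply: contrapT => H.
have : lam `]a, b[ = 0%E.
  apply/eqP; rewrite eq_le measure_ge0 andbT -N0.
  apply: le_measure; rewrite ?inE//; apply: subset_trans sub => s /=.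
  rewrite in_itv/= => sab Ps; apply: H; by exists s.
rewrite lebesgue_measure_itv/= lte_fin ab -EFinD => -[]; move: ab; lra.
Qed.

Lemma cvg_b2R (b : nat -> bool) b0 (c : R) :
  (\forall n \near \oo, b n = b0) ->
  (b n)%:R * c @[n --> \oo] --> b0%:R * c.
Proof.
by move=> bn; apply: cvg_near_cst; apply: filterS bn => n ->.
Qed.

Lemma norm_b2R_le (b : bool) (c : R) : `|b%:R * c| <= `|c|.
Proof. by case: b; rewrite ?mul1r// mul0r normr0. Qed.

Lemma prim_seq h (u : nat -> R) y : itg lam h ->
  u @ \oo --> y -> prim h (u n) @[n --> \oo] --> prim h y.
Proof.
move=> ih uy.
have [|||||_ //] := @cvg_Rint _ _ _ lam (fun n s => (s <= u n)%R%:R * h s)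
   (fun s => (s <= y)%R%:R * h s) (fun s => `|h s|).
- by move=> n; exact: itg_meas (itg_le_half _ ih).
- exact: itg_meas (itg_le_half _ ih).
- apply: ae_S (ae_neq y) => s sy; apply: cvg_b2R.
  case: (ltgtP s y) sy => // sy _.
    by apply: filterS (cvgr_gt _ uy _ sy) => n /ltW.
  by apply: filterS (cvgr_lt _ uy _ sy) => n un; apply/negbTE; rewrite -ltNge.
- exact: itg_norm.
- by move=> n s; exact: norm_b2R_le.
Qed.

Lemma prim_continuous h : itg lam h -> continuous (prim h).
Proof. by move=> ih y; apply/(@cvg_nbhsP _ R^o) => u; exact: prim_seq. Qed.

Lemma prim_cvgNy h : itg lam h -> prim h (- n%:R) @[n --> \oo] --> 0.
Proof.
move=> ih; have -> : 0 = \int[lam]_s (0 * h s).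
  by rewrite RintZ// mul0r.
have [|||||_ //] := @cvg_Rint _ _ _ lam (fun n s => (s <= - n%:R)%R%:R * h s)
   (fun s => 0 * h s) (fun s => `|h s|).
- by move=> n; exact: itg_meas (itg_le_half _ ih).
- exact: itg_meas (itgZ 0 ih).
- apply: ae_W => s; apply: (@cvg_b2R _ false).
  apply: filterS (nbhs_infty_gtr (- s)) => n sn; apply/negbTE.
  by rewrite -ltNge ltrNl.
- exact: itg_norm.
- by move=> n s; exact: norm_b2R_le.
Qed.

Lemma prim_cvgy h : itg lam h ->
  prim h n%:R @[n --> \oo] --> \int[lam]_s h s.
Proof.
move=> ih; have -> : \int[lam]_s h s = \int[lam]_s (1 * h s).
  by apply: eq_Rintegral => s _; rewrite mul1r.
have [|||||_ //] := @cvg_Rint _ _ _ lam (fun n s => (s <= n%:R)%R%:R * h s)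
   (fun s => 1 * h s) (fun s => `|h s|).
- by move=> n; exact: itg_meas (itg_le_half _ ih).
- exact: itg_meas (itgZ 1 ih).
- apply: ae_W => s; apply: (@cvg_b2R _ true).
  by apply: filterS (nbhs_infty_gtr s) => n /ltW.
- exact: itg_norm.
- by move=> n s; exact: norm_b2R_le.
Qed.

Lemma prim_ge0 h y : (forall s, 0 <= h s) -> 0 <= prim h y.
Proof. by move=> h0; apply: Rint_ge0 => s; rewrite mulr_ge0. Qed.

Lemma prim_le h x y : itg lam h -> (forall s, 0 <= h s) -> x <= y ->
  prim h x <= prim h y.
Proof.
move=> ih h0 xy; apply: le_Rint; [exact: itg_le_half..|].
move=> s; rewrite ler_wpM2r// ler_nat.
by case: (leP s x) => // sx; rewrite (le_trans sx xy).
Qed.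

(** The intermediate value theorem, with [b] the largest point at level [u]: this choice makes the
    sublevel set a half-line even where [prim h] is flat. *)
Lemma prim_level h u : itg lam h -> (forall s, 0 <= h s) ->
  0 < u < \int[lam]_s h s ->
  exists b, (forall y, (prim h y <= u) = (y <= b)) /\ prim h b = u.
Proof.
move=> ih h0 /andP[u0 uh]; pose E := [set y | prim h y <= u].
have [n1 /= /ltW En1] : exists n, prim h (- n%:R) < u.
  have [N _ HN] := cvgr_lt _ (prim_cvgNy ih) _ u0.
  by exists N; exact: (HN N (leqnn N)).
have [n2 /= En2] : exists n, u < prim h n%:R.
  have [N _ HN] := cvgr_gt _ (prim_cvgy ih) _ uh.
  by exists N; exact: (HN N (leqnn N)).
have Eub : ubound E n2%:R.
  move=> y Ey; rewrite leNgt; apply/negP => /ltW ny.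
  by have := prim_le ih h0 ny; rewrite leNgt (le_lt_trans Ey En2).
have supE : has_sup E by split; [exists (- n1%:R)|exists n2%:R].
have cb : prim h y @[y --> sup E] --> prim h (sup E).
  by have := prim_continuous ih; apply.
have ub : prim h (sup E) <= u.
  rewrite leNgt; apply/negP => ub.
  have /nbhs_ballP[e /= e0 eb] : \forall y \near sup E, u < prim h y.
    exact: (cvgr_gt _ cb _ ub).
  have [y Ey yb] := sup_adherent e0 supE.
  have : u < prim h y.
    apply: eb; rewrite /ball/= ger0_norm ?subr_ge0; last exact: sup_upper_bound.
    by move: yb; lra.
  by rewrite ltNge Ey.
have lb : u <= prim h (sup E).
  rewrite leNgt; apply/negP => lb.
  have /nbhs_ballP[e /= e0 eb] : \forall y \near sup E, prim h y < u.
    exact: (cvgr_lt _ cb _ lb).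
  have : prim h (sup E + e / 2) < u.
    by apply: eb; rewrite /ball/= opprD addNKr normrN gtr0_norm; lra.
  move=> /ltW /(sup_upper_bound supE) /=; lra.
exists (sup E); split; last by apply/le_anti; rewrite ub lb.
move=> y; apply/idP/idP => [Ey|yb]; first exact: sup_upper_bound.
exact: le_trans (prim_le ih h0 yb) ub.
Qed.

Lemma Rint_prim_level p u : itg lam p -> (forall s, 0 <= p s) ->
  0 < u < \int[lam]_s p s ->
  \int[lam]_s ((prim p s <= u)%R%:R * p s) = u.
Proof.
move=> ip p0 uc; have [b [bE pb]] := prim_level ip p0 uc; rewrite -[RHS]pb.
by apply: eq_Rintegral => s _; rewrite bE.
Qed.

Lemma measurable_prim h : itg lam h -> measurable_fun setT (prim h).
Proof. by move=> ih; apply: continuous_measurable_fun; exact: prim_continuous. Qed.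

(** The set [prim p <= u] has [p]-mass [u] for every intermediate level. Letting [u] tend to 0, or
    to the total mass [c], shows that no mass sits where [prim p] takes an extreme value, so
    quantiles are evaluated inside their domain. *)
Lemma prim_mass p : itg lam p -> (forall s, 0 <= p s) ->
  \forall s \ae lam, p s != 0 -> 0 < prim p s < \int[lam]_s p s.
Proof.
move=> ip p0; set c := \int[lam]_s p s.
have mp := measurable_prim ip.
have [c0|c0] := leP c 0.
  have /(Rint_eq0 ip p0) : \int[lam]_s p s = 0.
    by apply/le_anti; rewrite c0 Rint_ge0.
  by apply: ae_S => s ->; rewrite eqxx.
have mle (u : R) : measurable_fun setT (fun s => prim p s <= u).
  exact: measurable_fun_ler.
have mge (u : R) : measurable_fun setT (fun s => u <= prim p s).
  exact: measurable_fun_ler.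
have pos (b : R -> bool) s : 0 <= (b s)%:R * p s by rewrite mulr_ge0.
have H1 : \forall s \ae lam, (prim p s <= 0)%R%:R * p s = 0.
  apply: Rint_eq0; [(by apply: itg_bool => //; exact: mle 0)|exact: pos|].
  apply/le_anti; rewrite (Rint_ge0 lam (pos _)) andbT.
  apply/ler_addgt0Pl => e e0; rewrite addr0.
  (* Capping at [c / 2] keeps the level strictly inside the range, however large [e] is. *)
  have uc : 0 < Num.min e (c / 2) < c.
    by rewrite lt_min e0 gt_min; apply/andP; split; [lra|apply/orP; right; lra].
  apply: (@le_trans _ _ (Num.min e (c / 2))); last by rewrite ge_min lexx.
  rewrite -[leRHS](Rint_prim_level ip p0 uc); apply: le_Rint; [(by apply: itg_bool => //; exact: mle)..|].
  move=> s; rewrite ler_wpM2r// ler_nat.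
  by case: (leP (prim p s) 0) => // /le_trans; move/andP: uc => [/ltW uc _] ->.
have H2 : \forall s \ae lam, (c <= prim p s)%R%:R * p s = 0.
  apply: Rint_eq0; [(by apply: itg_bool => //; exact: mge c)|exact: pos|].
  apply/le_anti; rewrite (Rint_ge0 lam (pos _)) andbT.
  apply/ler_addgt0Pl => e e0; rewrite addr0.
  have uc : 0 < Num.max (c - e) (c / 2) < c.
    by rewrite gt_max lt_max; apply/andP; split; [apply/orP; right; lra|lra].
  apply: (@le_trans _ _ (c - Num.max (c - e) (c / 2))); last first.
    by rewrite lerBlDr -lerBlDl le_max lexx.
  rewrite -[in leRHS](Rint_prim_level ip p0 uc) /c -RintB//; last (by apply: itg_bool => //; exact: mle).
  apply: le_Rint; [(by apply: itg_bool => //; exact: mge c)|by apply: itgB => //; (by apply: itg_bool => //; exact: mle)|].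
  move=> s; rewrite -[X in _ <= X - _]mul1r -mulrBl ler_wpM2r//.
  case: (leP (prim p s)) => [pu|_]; last by rewrite subr0 lern1 leq_b1.
  have -> : (c <= prim p s)%R = false.
    by apply/negbTE; rewrite -ltNge (le_lt_trans pu)//; move/andP: uc => [].
  by rewrite subrr.
apply: ae_S2 H1 H2 => s; rewrite !ltNge.
case: (leP (prim p s) 0) => _ /=; first by rewrite mul1r => ->; rewrite eqxx.
by case: leP => //= _ _; rewrite mul1r => ->; rewrite eqxx.
Qed.

(* layer-cake: [- tau = \int_t (1_{tau <= t} - 1_{0 <= t})] *)
Lemma Rint_layer q tau : itg lam q -> measurable_fun setT tau ->
  \int[lam]_s q s = 0 -> itg lam (fun s => q s * tau s) ->
  itg lam (fun t => \int[lam]_s ((tau s <= t)%R%:R * q s)) /\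
  \int[lam]_t \int[lam]_s ((tau s <= t)%R%:R * q s) = - \int[lam]_s (q s * tau s).
Proof.
move=> iq mtau q0 iqtau.
(* Subtracting the step at 0 makes the kernel integrable in [t], with norm [|r|]; the subtracted
   part disappears in the end because [q] has integral 0. *)
pose k (r t : R) : R := (r <= t)%R%:R - (0 <= t)%R%:R.
pose w (z : R * R) := k (tau z.1) z.2 * q z.1.
have mq := itg_meas iq.
have mk : measurable_fun setT (fun z : R * R => k (tau z.1) z.2).
  apply: measurable_funB; apply: measurable_b2R; apply: measurable_fun_ler => //.
  exact: measurableT_comp.
have mw : measurable_fun setT w by apply: measurable_funM => //; exact: measurableT_comp.
have kE r t : 0 <= r -> k r t = - \1_(`[0, r[%classic : set R) t.
  move=> r0; rewrite /k indicE mem_setE in_itv/=.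
  by case: (leP r t) => /= rt; [rewrite (le_trans r0 rt)|rewrite andbT];
     rewrite ?andbF ?subrr ?oppr0 ?sub0r.
have kE' r t : r <= 0 -> k r t = \1_(`[r, 0[%classic : set R) t.
  move=> r0; rewrite /k indicE mem_setE in_itv/=.
  by case: (leP 0 t) => /= rt; [rewrite (le_trans r0 rt) subrr|rewrite subr0 andbT].
have ind_itv (a b : R) : a <= b ->
    (\int[lam]_t (\1_(`[a, b[%classic : set R) t)%:E = (b - a)%:E)%E.
  move=> ab; rewrite integral_indic//= setIT lebesgue_measure_itv/= lte_fin.
  by have [//|ba] := ltP a b; congr EFin; move: ab ba; lra.
have iind (a b : R) : a <= b -> itg lam (\1_(`[a, b[%classic : set R)).
  move=> ab; apply: itg_ge0P (ind_itv a b ab) => //.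
have absk r : (\int[lam]_t (`|k r t|)%:E = `|r|%:E)%E.
  have [r0|/ltW r0] := leP 0 r.
    under eq_integral => t _ do rewrite (kE _ _ r0) normrN ger0_norm//.
    by rewrite ind_itv// subr0 ger0_norm.
  under eq_integral => t _ do rewrite (kE' _ _ r0) ger0_norm//.
  by rewrite ind_itv// sub0r ler0_norm.
have Rk r : itg lam (k r) /\ \int[lam]_t k r t = - r.
  have [r0|/ltW r0] := leP 0 r.
    split; first by rewrite (funext (kE _ ^~ r0)); exact: itgN (iind _ _ r0).
    under eq_Rintegral => t _ do rewrite (kE _ _ r0).
    by rewrite RintN ?iind// /Rintegral ind_itv//= subr0.
  split; first by rewrite (funext (kE' _ ^~ r0)); exact: iind.
  under eq_Rintegral => t _ do rewrite (kE' _ _ r0).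
  by rewrite /Rintegral ind_itv//= sub0r.
have iw : itg (lam \x lam)%E w.
  apply: itg_prod => //.
  rewrite (_ : (\int[lam]_x _)%E = (\int[lam]_x (`|q x * tau x|)%:E)%E).
    exact: itg_lty.
  apply: eq_integral => s _; rewrite /w /=.
  under eq_integral do rewrite normrM EFinM.
  rewrite ge0_integralZr ?absk -?EFinM ?normrM 1?mulrC ?lee_fin//.
  by apply/measurable_EFinP; exact: measurableT_comp (itg_meas (Rk (tau s)).1).
have wE t : \int[lam]_s w (s, t) = \int[lam]_s ((tau s <= t)%R%:R * q s).
  rewrite /w /k/=; under eq_Rintegral do rewrite mulrBl.
  have i1 : itg lam (fun s => (tau s <= t)%R%:R * q s).
    by apply: itg_bool => //; exact: measurable_fun_ler.
  rewrite RintB//; last exact: itgZ.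
  by rewrite RintZ// q0 mulr0 subr0.
split.
  by rewrite -(funext wE); exact: (itg_Rint (itg_swap iw)).
under eq_Rintegral do rewrite -wE.
rewrite -(Rint_swap iw) -RintN//; apply: eq_Rintegral => s _.
rewrite /w/=; have [ik kr] := Rk (tau s).
under eq_Rintegral do rewrite mulrC.
by rewrite RintZ// kr mulrN.
Qed.

End line.

(** * Monotone transport onto the Gaussian *)

Section normal.
Context (R : realType).
Local Notation lam := (@lebesgue_measure R).
Definition nphi : R -> R := normal_pdf 0 1.
Local Notation g1 := (@normal_prob R 0 1).
Implicit Types (h p q tau : R -> R).

Lemma nphiE s : nphi s = normal_peak 1 * expR (- s ^+ 2 / 2).
Proof.
by rewrite /nphi normal_pdfE ?oner_neq0// /normal_fun subr0 expr1n.
Qed.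

Lemma nphi_gt0 s : 0 < nphi s.
Proof. by rewrite nphiE mulr_gt0 ?expR_gt0// normal_peak_gt0// oner_neq0. Qed.

Lemma nphi_ge0 s : 0 <= nphi s. Proof. exact: ltW (nphi_gt0 s). Qed.

Lemma measurable_nphi : measurable_fun setT nphi.
Proof. exact: measurable_normal_pdf. Qed.

Lemma itg_nphi : itg lam nphi.
Proof. exact: integrable_normal_pdf. Qed.

Lemma Rint_nphi : \int[lam]_s nphi s = 1.
Proof. by rewrite /Rintegral integral_normal_pdf. Qed.

Lemma itg_g1 (k : R -> R) : measurable_fun setT k ->
  itg g1 k <-> itg lam (fun s => k s * nphi s).
Proof.
move=> mk.
have := @itg_density _ _ R [the {sigma_finite_measure set _ -> \bar R} of g1]
  [the {sigma_finite_measure set _ -> \bar R} of lam] nphi.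
by apply=> //; [exact: measurable_nphi|exact: nphi_ge0].
Qed.

Lemma Rint_g1 (k : R -> R) : itg g1 k ->
  \int[g1]_s k s = \int[lam]_s (k s * nphi s).
Proof.
move=> ik.
have := @Rint_density _ _ R [the {sigma_finite_measure set _ -> \bar R} of g1]
  [the {sigma_finite_measure set _ -> \bar R} of lam] nphi.
by apply=> //; [exact: measurable_nphi|exact: nphi_ge0].
Qed.

Definition nPhi : R -> R := prim nphi.

Lemma nPhi_lt s t : s < t -> nPhi s < nPhi t.
Proof.
move=> st; rewrite lt_neqAle (prim_le itg_nphi nphi_ge0 (ltW st)) andbT.
apply/eqP => E.
have i1 u := itg_le_half u itg_nphi.
have /(Rint_eq0 _ _) H : \int[lam]_r (((r <= t)%R%:R - (r <= s)%R%:R) * nphi r) = 0.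
  under eq_Rintegral do rewrite mulrBl.
  by rewrite RintB// -/(prim _ _) -/(prim _ _) -/(nPhi _) -/(nPhi _) E subrr.
have {H} : \forall r \ae lam, ((r <= t)%R%:R - (r <= s)%R%:R) * nphi r = 0.
  apply: H.
    by under eq_fun do rewrite mulrBl; exact: itgB.
  move=> r; rewrite mulr_ge0 ?nphi_ge0// subr_ge0 ler_nat.
  by case: (leP r s) => // rs; rewrite (le_trans rs (ltW st)).
move=> /(ae_itv_ex st)[r [/andP[sr rt] /eqP]].
by rewrite (ltW rt) leNgt sr subr0 mul1r gt_eqF// nphi_gt0.
Qed.

Lemma nPhi_le s t : (nPhi s <= nPhi t) = (s <= t).
Proof. by apply: (le_mono (f := nPhi)) => x y; exact: nPhi_lt. Qed.

Lemma nPhi_level u : 0 < u < 1 -> exists b, nPhi b = u.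
Proof.
rewrite -Rint_nphi => /(prim_level itg_nphi nphi_ge0)[b [_ bu]].
by exists b.
Qed.

Lemma nPhi_bound s : 0 < nPhi s < 1.
Proof.
apply/andP; split.
  apply: le_lt_trans (@nPhi_lt (s - 1) s _); last lra.
  exact: prim_ge0 nphi_ge0.
apply: lt_le_trans (@nPhi_lt s (s + 1) _) _; first lra.
rewrite -Rint_nphi; apply: le_Rint; [exact: itg_le_half itg_nphi|exact: itg_nphi|].
by move=> r; rewrite ler_piMl ?nphi_ge0// lern1 leq_b1.
Qed.

(** The Gaussian quantile function. By [prim_mass], the default 0 outside []0, 1[] is met only where
    the transported density vanishes, up to a null set. *)
Definition nPsi (u : R) : R :=
  if 0 < u < 1 then xget 0 [set b | nPhi b = u] else 0.

Lemma nPsiK u : 0 < u < 1 -> nPhi (nPsi u) = u.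
Proof.
move=> u01; rewrite /nPsi u01; have [b bu] := nPhi_level u01.
by case: xgetP => [y _ //|/(_ b)].
Qed.

Lemma nPsi_le u t : 0 < u < 1 -> (nPsi u <= t) = (u <= nPhi t).
Proof. by move=> u01; rewrite -nPhi_le nPsiK. Qed.

Lemma measurable_nPsi : measurable_fun setT nPsi.
Proof.
apply: (measurability _ (RGenOInfty.measurableE R)) => //.
move=> _ [_ [t ->] <-]; rewrite setTI.
rewrite (_ : nPsi @^-1` _ =
    [set u | (0 < u < 1) && (nPhi t < u) || ~~ (0 < u < 1) && (t < 0)]).
  have mb : measurable_fun setT (fun u : R =>
      (0 < u < 1) && (nPhi t < u) || ~~ (0 < u < 1) && (t < 0)).
    have m01 : measurable_fun setT (fun u : R => 0 < u < 1).
      by apply: measurable_and; apply: measurable_fun_ltr.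
    apply: measurable_or; apply: measurable_and => //.
    - exact: measurable_fun_ltr.
    - exact: measurable_neg.
  by have := mb measurableT [set true]; rewrite setTI; apply.
apply/seteqP; split => u /=; rewrite in_itv/= andbT;
  case: (boolP (0 < u < 1)) => u01 /=; rewrite ?orbF ?andbF//.
- by rewrite !ltNge nPsi_le.
- by rewrite /nPsi (negbTE u01).
- by rewrite !ltNge nPsi_le.
- by rewrite /nPsi (negbTE u01).
Qed.

End normal.

(** * Finite measures with a density, and images of measures *)

Section dmeas.
Context d (T : measurableType d) (R : realType).
Variables (m : {measure set T -> \bar R}) (h : T -> R).

(* The two proofs are arguments so that the finite measure structure can be inferred. *)
Definition dmeas (ih : itg m h) (h0 : forall x, 0 <= h x) (A : set T) : \bar R :=
  (\int[m]_(x in A) (h x)%:E)%E.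

Variables (ih : itg m h) (h0 : forall x, 0 <= h x).

Let dmeas0 : dmeas ih h0 set0 = 0%E.
Proof. by rewrite /dmeas integral_set0. Qed.

Let dmeas_ge0 A : (0 <= dmeas ih h0 A)%E.
Proof. by apply: integral_ge0 => x _; rewrite lee_fin. Qed.

Let dmeas_sigma_additive : semi_sigma_additive (dmeas ih h0).
Proof.
move=> /= A mA tA mUA; rewrite /dmeas/= integral_bigcup//=; last first.
  exact: (integrableS _ _ (subsetT _)).
apply: is_cvg_ereal_nneg_natsum_cond => n _ _.
by apply: integral_ge0 => /= x _; rewrite lee_fin.
Qed.

HB.instance Definition _ := isMeasure.Build _ _ _
  (dmeas ih h0) dmeas0 dmeas_ge0 dmeas_sigma_additive.

Let dmeas_fin : fin_num_fun (dmeas ih h0).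
Proof.
move=> A mA; rewrite ge0_fin_numE//.
apply: le_lt_trans (integrable_lty measurableT ih); rewrite /dmeas.
apply: ge0_subset_integral => //; first exact: measurable_int ih.
by move=> x _; rewrite lee_fin.
Qed.

HB.instance Definition _ := Measure_isFinite.Build _ _ _ (dmeas ih h0) dmeas_fin.

End dmeas.

Lemma itg_push d1 d2 (T1 : measurableType d1) (T2 : measurableType d2)
    (R : realType) (m1 : {measure set T1 -> \bar R}) (m2 : {measure set T2 -> \bar R})
    (F : T1 -> T2) (k : T2 -> R) :
  measurable_fun setT F -> (forall A, measurable A -> m1 (F @^-1` A) = m2 A) ->
  measurable_fun setT k -> itg m2 k <-> itg m1 (k \o F).
Proof.
move=> mF FE mk.
have mkF : measurable_fun setT (k \o F) by exact: measurableT_comp.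
have E : (\int[m1]_x (`|k (F x)|)%:E = \int[m2]_x (`|k x|)%:E)%E.
  rewrite [RHS](eq_measure_integral (pushforward m1 F)); last first.
    by move=> A mA _; rewrite -FE.
  rewrite [RHS]ge0_integral_pushforward// ?preimage_setT//.
    by apply/measurable_EFinP; exact: measurableT_comp.
by split => ik; apply: itgP => //; [rewrite /= E|rewrite -E]; exact: itg_lty ik.
Qed.

Lemma Rint_push d1 d2 (T1 : measurableType d1) (T2 : measurableType d2)
    (R : realType) (m1 : {measure set T1 -> \bar R}) (m2 : {measure set T2 -> \bar R})
    (F : T1 -> T2) (k : T2 -> R) :
  measurable_fun setT F -> (forall A, measurable A -> m1 (F @^-1` A) = m2 A) ->
  itg m2 k -> \int[m1]_x k (F x) = \int[m2]_x k x.
Proof.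
move=> mF FE ik; have mk := itg_meas ik.
have ikF := (itg_push mF FE mk).1 ik.
congr fine; rewrite [RHS](eq_measure_integral (pushforward m1 F)); last first.
  by move=> A mA _; rewrite -FE.
rewrite [RHS]integral_pushforward ?preimage_setT//.
exact/measurable_EFinP.
Qed.

Section transport.
Context (R : realType).
Local Notation lam := (@lebesgue_measure R).
Local Notation g1 := (@normal_prob R 0 1).
Variables (p q : R -> R).
Hypotheses (ip : itg lam p) (p0 : forall s, 0 <= p s) (p1 : \int[lam]_s p s = 1).

Definition monoT (s : R) : R := nPsi (prim p s).
Local Notation T := monoT.

Lemma measurable_monoT : measurable_fun setT T.
Proof. exact: measurableT_comp (@measurable_nPsi R) (measurable_prim ip). Qed.

Let good s := 0 < prim p s < 1.

Let T_le s t : good s -> (T s <= t) = (prim p s <= nPhi t).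
Proof. by move=> gs; rewrite /T nPsi_le. Qed.

Let TT_le s r : good s -> good r -> (T s <= T r) = (prim p s <= prim p r).
Proof. by move=> gs gr; rewrite T_le// nPsiK. Qed.

Let mass : \forall s \ae lam, p s != 0 -> good s.
Proof. by have := prim_mass ip p0; rewrite p1. Qed.

Let itgT t : itg lam (fun s => (T s <= t)%R%:R * p s).
Proof.
apply: itg_bool => //; apply: measurable_fun_ler => //; exact: measurable_monoT.
Qed.

(** Where [p] has mass, [T s <= t] amounts to [prim p s <= nPhi t], and [Rint_prim_level] evaluates
    the mass of that set. *)
Lemma Rint_T_le t : \int[lam]_s ((T s <= t)%R%:R * p s) = nPhi t.
Proof.
rewrite -[RHS](Rint_prim_level ip p0); last by rewrite p1; exact: nPhi_bound.
apply: ae_eq_Rint.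
- exact: itg_meas (itgT t).
- apply: itg_meas (itg_bool _ ip) => //.
  by apply: measurable_fun_ler => //; exact: measurable_prim.
apply: ae_S mass => s gs; have [->|ps] := eqVneq (p s) 0; first by rewrite !mulr0.
by rewrite T_le// gs.
Qed.

Lemma push_monoT A : measurable A -> dmeas ip p0 (T @^-1` A) = g1 A.
Proof.
have mT := measurable_monoT.
move=> mA; rewrite -[LHS]/(pushforward (dmeas ip p0) T A).
pose T' : measurableTypeR R -> measurableTypeR R := T.
have mT' : measurable_fun setT T' by exact: mT.
have U := @measure_unique _ R (measurableTypeR R) (@RGenOInfty.G R) (fun k => `](- k%:R), +oo[%classic)
  (RGenOInfty.measurableE R) _ _ _ (pushforward (dmeas ip p0) T') g1.
apply: U => //.
- move=> _ _ [x ->] [y ->]; exists (Num.max x y).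
  apply/seteqP; split => z /=; rewrite !in_itv/= !andbT gt_max.
    by move=> [-> ->].
  by move=> /andP[].
- by move=> k; exists (- k%:R).
- apply/seteqP; split => // x _.
  have [N _ /(_ N (leqnn N)) /= HN] := nbhs_infty_gtr (- x).
  by exists N => //=; rewrite in_itv/= andbT ltrNl.
- move=> _ [t ->].
  have itv A' (B : R -> bool) : (forall s, A' s <-> B s) -> (A' : set R) = [set s | B s].
    by move=> H; apply/seteqP; split => s /H.
  (* The generating half-lines point to the right while [Rint_T_le] concerns those to the left, so
     both measures are compared on complements. *)
  have compl h : itg lam h -> (forall s, 0 <= h s) -> \int[lam]_s h s = 1 ->
      forall b : R -> bool, measurable_fun setT b ->
      (\int[lam]_(s in [set s | ~~ b s]) (h s)%:E =
       (1 - \int[lam]_s ((b s)%:R * h s))%:E)%E.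
    move=> ih h0 h1 b mb.
    have ib : itg lam (fun s => (b s)%:R * h s) by apply: itg_bool.
    rewrite (_ : 1 - _ = \int[lam]_s (h s - (b s)%:R * h s)); last by rewrite RintB// h1.
    rewrite EFin_Rint; last exact: itgB.
    rewrite [LHS]integral_mkcond.
    apply: eq_integral => s _; rewrite patchE.
    case: (boolP (b s)) => bs.
      by rewrite memNset/= ?bs// mul1r subrr.
    by rewrite mem_set//= mul0r subr0.
  have E1 : T' @^-1` `]t, +oo[%classic = [set s | ~~ (T s <= t)].
    by apply: itv => s; rewrite /= in_itv/= andbT ltNge.
  have E2 : `]t, +oo[%classic = [set s : R | ~~ (s <= t)].
    by apply: itv => s; rewrite /= in_itv/= andbT ltNge.
  transitivity (1 - nPhi t)%:E.
    rewrite -Rint_T_le -(compl _ ip p0 p1 (fun s => T s <= t)) -?E1//.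
    by apply: measurable_fun_ler.
  apply/esym; rewrite E2.
  apply: (compl _ (@itg_nphi R) (@nphi_ge0 R) (@Rint_nphi R) (fun s => s <= t)).
  by apply: measurable_fun_ler.
- move=> k; apply: le_lt_trans (ltry 1); rewrite /pushforward.
  rewrite -p1 EFin_Rint// /dmeas; apply: ge0_subset_integral => //.
  + by rewrite -[X in measurable X]setTI; exact: mT.
  + exact: measurable_int ip.
  + by move=> x _; rewrite lee_fin.
Qed.

Lemma itg_monoT (k : R -> R) : measurable_fun setT k ->
  itg lam (fun s => k (T s) * p s) <-> itg g1 k.
Proof.
move=> mk; have mT := measurable_monoT.
have mp := itg_meas ip.
rewrite (itg_push (m1 := [the {measure set (measurableTypeR R) -> \bar R} of dmeas ip p0])
  (T2 := measurableTypeR R) mT push_monoT mk).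
by apply: iff_sym; apply: itg_density => //; exact: measurableT_comp.
Qed.

Lemma Rint_monoT (k : R -> R) : itg g1 k ->
  \int[lam]_s (k (T s) * p s) = \int[g1]_s k s.
Proof.
move=> ik; have mT := measurable_monoT; have mp := itg_meas ip; have mk := itg_meas ik.
rewrite -(Rint_push (m1 := [the {measure set (measurableTypeR R) -> \bar R} of dmeas ip p0])
  (T2 := measurableTypeR R) mT push_monoT ik).
apply/esym/Rint_density => //.
exact: (itg_push (m1 := [the {measure set (measurableTypeR R) -> \bar R} of dmeas ip p0])
  (T2 := measurableTypeR R) mT push_monoT mk).1.
Qed.

Hypotheses (iq : itg lam q) (q0 : \int[lam]_s q s = 0).
Hypothesis pq : \forall s \ae lam, p s = prim q s.
Hypothesis pq0 : \forall s \ae lam, p s = 0 -> q s = 0.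

Let k t := \int[lam]_s ((T s <= t)%R%:R * q s).

(** If [p y != 0], then, up to null sets and points without [p]-mass, [T s <= T y] means [s <= b],
    where [b] is the last point with [prim p b = prim p y]. Between [y] and [b] the density [p],
    hence also [q], vanishes almost everywhere, so [k (T y) = prim q y = p y]. The factor [p s]
    absorbs the zeros of [p]. *)
Let kT : \forall s \ae lam, k (T s) * p s = p s * p s.
Proof.
apply: ae_S2 mass pq => y gy pqy.
have [->|py] := eqVneq (p y) 0; first by rewrite !mulr0.
congr (_ * _); rewrite [RHS]pqy.
have {}gy := gy py.
have mT := measurable_monoT.
have [b [bE pb]] : exists b, (forall z, (prim p z <= prim p y) = (z <= b)) /\ prim p b = prim p y.
  by apply: (prim_level ip p0); rewrite p1.
have yb : y <= b by rewrite -bE.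
have ib u : itg lam (fun s => (s <= u)%R%:R * p s) by exact: itg_le_half.
have /(Rint_eq0 _ _) H : \int[lam]_s (((s <= b)%R%:R - (s <= y)%R%:R) * p s) = 0.
  under eq_Rintegral do rewrite mulrBl.
  by rewrite RintB// -/(prim _ _) -/(prim _ _) pb subrr.
have {}H : \forall s \ae lam, ((s <= b)%R%:R - (s <= y)%R%:R) * p s = 0.
  apply: H.
    by under eq_fun do rewrite mulrBl; exact: itgB.
  move=> s; rewrite mulr_ge0// subr_ge0 ler_nat.
  by case: (leP s y) => // sy; rewrite (le_trans sy yb).
apply: ae_eq_Rint.
- apply: itg_meas (itg_bool _ iq) => //.
  by apply: measurable_fun_ler => //; exact: mT.
- by apply: itg_meas (itg_le_half _ iq).
apply: ae_S3 mass H pq0 => s gs Hs qs.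
have [/qs ->|ps] := eqVneq (p s) 0; first by rewrite !mulr0.
rewrite TT_le ?gs// bE; move/eqP: Hs; rewrite mulf_eq0 (negbTE ps) orbF subr_eq0.
by move=> /eqP ->.
Qed.

(* As q vanishes with p, k t = \int_{T <= t} q satisfies k (T s) = p s; since T
   pushes p to the Gaussian, the layer formula turns - \int q T into \int k. *)
Lemma Rint_transport : itg lam (fun s => q s * T s) ->
  itg lam (fun s => p s * (p s / nphi (T s))) /\
  \int[lam]_s (p s * (p s / nphi (T s))) = - \int[lam]_s (q s * T s).
Proof.
move=> iqT; have mT := measurable_monoT.
have [ik kE] := Rint_layer iq mT q0 iqT.
have mk := itg_meas ik.
have mphi := measurable_nphi (R := R).
pose w t := k t / nphi t.
have wphi t : w t * nphi t = k t.
  by rewrite /w divfK// gt_eqF// nphi_gt0.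
have mw : measurable_fun setT w.
  apply: measurable_funM => //.
  exact: measurable_invr.
have iw : itg g1 w.
  by apply/itg_g1 => //; rewrite (_ : (fun s => _) = k)//; apply/funext.
have iwT := (itg_monoT mw).2 iw.
have mpp : measurable_fun setT (fun s => p s * (p s / nphi (T s))).
  have mp := itg_meas ip.
  do 2 apply: measurable_funM => //.
  by apply: measurable_invr; exact: measurableT_comp.
have ae_wp : \forall s \ae lam, p s * (p s / nphi (T s)) = w (T s) * p s.
  apply: ae_S kT => s ks; rewrite /w mulrA -ks.
  by rewrite mulrAC.
split; first by apply: (ae_itg _ iwT ae_wp).
transitivity (\int[lam]_s (w (T s) * p s)).
  by apply: (ae_eq_Rint _ (itg_meas iwT) ae_wp).
rewrite (Rint_monoT iw) Rint_g1// -kE.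
by apply: eq_Rintegral => t _; rewrite wphi.
Qed.

End transport.

(** * Test functions *)

Section smooth1.
Context (R : realType).
Implicit Types u v : R -> R.

(** Carrying the derivative as an explicit witness makes closure under sums, products and affine
    substitutions a plain induction on the order. *)
Fixpoint sm (n : nat) (u : R -> R) : Prop :=
  if n is n'.+1 then
    exists u', (forall x : R, is_derive x 1 u (u' x)) /\ sm n' u'
  else True.

Lemma sm_ext n u v : u =1 v -> sm n u -> sm n v.
Proof. by move=> /funext ->. Qed.

Lemma sm_pred n u : sm n.+1 u -> sm n u.
Proof.
elim: n u => [//|n IH] u [u' [du su']].
by exists u'; split => //; exact: IH.
Qed.

Lemma smD n u v : sm n u -> sm n v -> sm n (fun x => u x + v x).
Proof.
elim: n u v => [//|n IH] u v [u' [du su]] [v' [dv sv]].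
exists (fun x => u' x + v' x); split; last exact: IH.
by move=> x; apply: is_deriveD.
Qed.

Lemma smZ n c u : sm n u -> sm n (fun x => c * u x).
Proof.
elim: n u => [//|n IH] u [u' [du su]].
exists (fun x => c * u' x); split; last exact: IH.
by move=> x; apply: is_deriveZ.
Qed.

Lemma smM n u v : sm n u -> sm n v -> sm n (fun x => u x * v x).
Proof.
elim: n u v => [//|n IH] u v su sv.
move: (su) (sv) => [u' [du su']] [v' [dv sv']].
exists (fun x => u x * v' x + v x * u' x); split.
  by move=> x; apply: is_deriveM.
by apply: smD; apply: IH => //; exact: sm_pred.
Qed.

Lemma sm_lin n u a b : sm n u -> sm n (fun x => u (a * x + b)).
Proof.
elim: n u => [//|n IH] u [u' [du su]].
exists (fun x => a * u' (a * x + b)); split; last by apply: smZ; exact: IH.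
move=> x; rewrite mulrC.
have dl : is_derive x 1 (fun x : R => a * x + b) a.
  rewrite (_ : (fun x => _) = (a \*: (@id R^o)) + cst b :> (R^o -> R^o))//.
  apply: is_derive_eq.
  by rewrite addr0 /GRing.scale/= mulr1.
exact: (@is_derive1_comp R u (fun x : R => a * x + b) x _ _ (du _) dl).
Qed.

(** The flat functions [t^-m e^(-1/t)], extended by 0. All powers are included because
    differentiation maps the family into its own linear span. *)
Definition hat (m : nat) (t : R) : R :=
  if 0 < t then t^-1 ^+ m * expR (- t^-1) else 0.

Lemma hat_ge0 m t : 0 <= hat m t.
Proof.
rewrite /hat; case: ifPn => // t0.
by rewrite mulr_ge0 ?expR_ge0// exprn_ge0// invr_ge0 ltW.
Qed.

(** From [e^y >= y^(m+2) / (m+2)!] at [y = 1/t]. A bound of order 2 is what makes the difference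
    quotient at 0 tend to 0. *)
Lemma hat_le m t : hat m t <= (m.+2)`!%:R * `|t| ^+ 2.
Proof.
rewrite /hat; case: ifPn => t0; last by rewrite mulr_ge0// exprn_ge0.
rewrite gtr0_norm// expRN -[leLHS]/(_ / _) ler_pdivrMr ?expR_gt0//.
have y0 : 0 <= t^-1 by rewrite invr_ge0 ltW.
have := expR_ge1Dxn m.+1 y0; set y := t^-1 in y0 *; set N := _`!%:R.
have N0 : 0 < N by rewrite ltr0n fact_gt0.
have -> : t = y^-1 by rewrite invrK.
have yp : 0 < y by rewrite invr_gt0.
move=> H; apply: (@le_trans _ _ (N * y^-1 ^+ 2 * (y ^+ m.+2 / N))).
  rewrite le_eqVlt; apply/orP; left; apply/eqP.
  rewrite (exprSr y m.+1) (exprSr y m); set z := y ^+ m.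
  by field; rewrite !gt_eqF.
rewrite ler_wpM2l//; first by rewrite mulr_ge0 ?ltW// exprn_gt0// invr_gt0.
by apply: le_trans H; rewrite lerDr.
Qed.

Lemma is_derive_hat m (t : R) :
  is_derive t 1 (hat m) (- m%:R * hat m.+1 t + hat m.+2 t).
Proof.
have [t0|t0|->] := ltgtP t 0.
- apply: (@near_eq_is_derive _ _ _ (cst 0)).
    near=> s; rewrite /hat ifN// -leNgt ltW//.
    by near: s; exact: lt_nbhsl.
  rewrite /hat !ifN -?leNgt ?ltW// mulr0 addr0.
  exact: is_derive_cst.
- apply: (@near_eq_is_derive R R^o R^o (fun s : R => s^-1 ^+ m * expR (- s^-1))).
    near=> s; rewrite /hat ifT//.
    by near: s; exact: lt_nbhsr.
  have tn0 : t != 0 by rewrite gt_eqF.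
  have dV : is_derive t 1 (fun s : R => s^-1) (- t ^- 2).
    have := is_deriveV (f := id) (x := t) (v := 1) tn0.
    by move=> /(_ _ (is_derive_id t 1)); rewrite /GRing.scale/= mulr1.
  have dX : is_derive t 1 (fun s : R => s^-1 ^+ m) ((m%:R * t^-1 ^+ m.-1) * (- t ^- 2)).
    have := is_deriveX m dV; rewrite (_ : _ ^+ m = (fun s : R => s^-1 ^+ m))//.
    by apply/funext => s; rewrite exprfctE.
  have dN := is_deriveN dV.
  have dE : is_derive t 1 (fun s : R => expR (- s^-1)) (expR (- t^-1) * (- - t ^- 2)).
    exact: (@is_derive1_comp R expR (fun s : R => - s^-1) t _ _ (is_derive_expR _) dN).
  have dM := @is_deriveM R R^o _ _ t 1 _ _ dX dE.
  apply: is_derive_eq.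
  rewrite /hat t0 /GRing.scale/=.
  move: m {dX dM} => [|m]; first by rewrite /=; field.
  by rewrite /= !exprS; field.
- have h0 k : hat k 0 = 0 by rewrite /hat ltxx.
  rewrite !h0 mulr0 addr0.
  have H : h^-1 *: (hat m (h *: 1 + 0) - hat m 0) @[h --> 0^'] --> (0 : R).
    apply/cvgrPdist_le => e e0; near=> h.
    rewrite h0 subr0 addr0 /GRing.scale/= mulr1 sub0r normrN normrM normfV.
    have hn0 : 0 < `|h|.
      by rewrite normr_gt0; near: h; exact: nbhs_dnbhs_neq.
    rewrite mulrC ler_pdivrMr// ger0_norm ?hat_ge0//.
    apply: le_trans (hat_le m h) _.
    rewrite expr2 mulrA ler_wpM2r// mulrC -ler_pdivlMr ?ltr0n ?fact_gt0//.
    near: h; apply: dnbhs0_le; rewrite divr_gt0// ltr0n fact_gt0//.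
  apply: DeriveDef; first by apply/cvg_ex; exists 0.
  exact/cvg_lim.
Unshelve. all: by end_near. Qed.

Lemma sm_hat n m : sm n (hat m).
Proof.
elim: n m => [//|n IH] m.
exists (fun t => - m%:R * hat m.+1 t + hat m.+2 t); split; first exact: is_derive_hat.
by apply: smD => //; exact: smZ.
Qed.

Lemma sm_continuous u : sm 1 u -> continuous u.
Proof.
move=> [u' [du _]] x; apply/differentiable_continuous/derivable1_diffP.
exact: @ex_derive (du x).
Qed.

(** A smooth minorant of the indicator of []a, b[]. The parameter [k] sharpens it: [e^(-1/(k d))]
    tends to 1 for each distance [d > 0] to an endpoint. *)
Definition bump (a b : R) (k : nat) (t : R) : R :=
  hat 0 (k%:R * (t - a)) * hat 0 (k%:R * (b - t)).

Lemma hat0E t : hat 0 t = if 0 < t then expR (- t^-1) else 0.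
Proof. by rewrite /hat expr0 mul1r. Qed.

Lemma hat0_le1 t : hat 0 t <= 1.
Proof.
rewrite hat0E; case: ifPn => // t0.
by rewrite -expR0 ler_expR oppr_le0 invr_ge0 ltW.
Qed.

Lemma sm_bump n a b k : sm n (bump a b k).
Proof.
apply: smM.
  apply: sm_ext (sm_lin k%:R (- k%:R * a) (sm_hat n 0)) => x.
  by congr hat; ring.
apply: sm_ext (sm_lin (- k%:R) (k%:R * b) (sm_hat n 0)) => x.
by congr hat; ring.
Qed.

Lemma bump_ge0 a b k t : 0 <= bump a b k t.
Proof. by rewrite mulr_ge0 ?hat_ge0. Qed.

Lemma bump_gt0 a b k t : (0 < k)%N -> a < t < b -> 0 < bump a b k t.
Proof.
move=> k0 /andP[at_ tb]; rewrite /bump !hat0E.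
have -> : 0 < k%:R * (t - a) by rewrite mulr_gt0 ?ltr0n ?subr_gt0.
have -> : 0 < k%:R * (b - t) by rewrite mulr_gt0 ?ltr0n ?subr_gt0.
by rewrite mulr_gt0 ?expR_gt0.
Qed.

Lemma bump_le a b k t : bump a b k t <= (a < t < b)%R%:R.
Proof.
rewrite /bump; case: (boolP (a < t < b)) => [_|].
  by rewrite -[leRHS]mul1r ler_pM ?hat_ge0 ?hat0_le1.
rewrite negb_and -!leNgt => /orP[ta|bt]; rewrite !hat0E.
  by rewrite ifN ?mul0r// -leNgt mulr_ge0_le0// subr_le0.
by rewrite [X in _ * X]ifN ?mulr0// -leNgt mulr_ge0_le0// subr_le0.
Qed.

Lemma cvg_bump a b t : bump a b k t @[k --> \oo] --> ((a < t < b)%R%:R : R).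
Proof.
case: (boolP (a < t < b)) => tab; last first.
  apply: cvg_near_cst; apply: nearW => k.
  by apply/le_anti; rewrite bump_ge0 andbT; have := bump_le a b k t; rewrite (negbTE tab).
have H (d : R) : 0 < d -> hat 0 (k%:R * d) @[k --> \oo] --> (1 : R).
  move=> d0; rewrite -[X in _ --> X]expR0.
  have E : \forall k \near \oo, expR (- (k%:R^-1 * d^-1)) = hat 0 (k%:R * d).
    near=> k; rewrite hat0E ifT ?invfM// mulr_gt0// ltr0n.
    by near: k; exact: nbhs_infty_gt.
  have /near_eq_cvg/cvg_trans : {near \oo, (fun k : nat => expR (- (k%:R^-1 * d^-1))) =1
    (fun k : nat => hat 0 (k%:R * d))} by exact: E.
  apply.
  apply: continuous_cvg; first exact: continuous_expR.
  rewrite -[X in _ --> X]oppr0 -(mul0r d^-1); apply: cvgN; apply: cvgMl.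
  apply/cvgrPdist_lt => e e0; near=> k.
  rewrite sub0r normrN ger0_norm ?invr_ge0//.
  rewrite -(invrK e) ltf_pV2 ?posrE ?invr_gt0//.
    by near: k; exact: nbhs_infty_gtr.
  rewrite ltr0n; near: k; exact: nbhs_infty_gt.
rewrite -[X in _ --> X]mulr1; move/andP: tab => [at_ tb].
by apply: cvgM; apply: H; rewrite subr_gt0.
Unshelve. all: by end_near. Qed.

End smooth1.

Section smoothV.
Context (R : realType) (n : nat).
Local Notation V := 'rV[R]_n.
Implicit Types psi : V -> R.

Fixpoint dsm (k : nat) (psi : V -> R) : Prop :=
  if k is k'.+1 then
    (forall x, differentiable psi x) /\ (forall v, dsm k' ('D_v psi))
  else True.

Lemma dsm_pred k psi : dsm k.+1 psi -> dsm k psi.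
Proof.
elim: k psi => [//|k IH] psi [dpsi spsi]; split => // v.
by apply: IH; exact: spsi.
Qed.

Lemma dsmD k psi1 psi2 : dsm k psi1 -> dsm k psi2 -> dsm k (psi1 + psi2).
Proof.
elim: k psi1 psi2 => [//|k IH] psi1 psi2 [d1 s1] [d2 s2].
split => [x|v]; first exact: differentiableD.
rewrite (_ : 'D_v _ = 'D_v psi1 + 'D_v psi2); first by apply: IH; [exact: s1|exact: s2].
by apply/funext => x; rewrite deriveD//; exact: diff_derivable.
Qed.

Lemma dsmM k psi1 psi2 : dsm k psi1 -> dsm k psi2 -> dsm k (psi1 * psi2).
Proof.
elim: k psi1 psi2 => [//|k IH] psi1 psi2 s1 s2.
move: (s1) (s2) => [d1 s1'] [d2 s2'].
split => [x|v]; first exact: differentiableM.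
rewrite (_ : 'D_v _ = psi1 * 'D_v psi2 + psi2 * 'D_v psi1).
  by apply: dsmD; apply: IH; [exact: dsm_pred|exact: s2'|exact: dsm_pred|exact: s1'].
by apply/funext => x; rewrite deriveM//; exact: diff_derivable.
Qed.

Lemma dsm_cst k (c : R) : dsm k (cst c).
Proof.
elim: k c => [//|k IH] c; split => [x|v]; first exact: differentiable_cst.
rewrite (_ : 'D_v _ = cst 0); first exact: IH.
by apply/funext => x; rewrite derive_cst.
Qed.

Lemma derive_coord (u : R -> R) (u' : R) i (v x : V) :
  is_derive (x ord0 i) 1 u u' ->
  'D_v (fun x : V => u (x ord0 i)) x = v ord0 i * u'.
Proof.
move=> du.
have du' : differentiable u (x ord0 i) by apply/derivable1_diffP; exact: @ex_derive du.
transitivity ('D_(v ord0 i) u (x ord0 i)).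
  by rewrite /derive /=; under eq_fun do rewrite !mxE.
rewrite deriveE//; have -> : v ord0 i = v ord0 i *: (1 : R) by rewrite /GRing.scale/= mulr1.
by rewrite linearZ -deriveE//= (@derive_val _ _ _ _ _ _ _ du) /GRing.scale/= mulr1.
Qed.

Lemma dsm_coord k (u : R -> R) i : sm k u -> dsm k (fun x : V => u (x ord0 i)).
Proof.
elim: k u => [//|k IH] u [u' [du su]]; split => [x|v].
  apply: (@differentiable_comp _ _ _ _ (fun x : V => x ord0 i) u).
    exact: differentiable_coord.
  by apply/derivable1_diffP; exact: @ex_derive (du _).
rewrite (_ : 'D_v _ = cst (v ord0 i) * (fun x : V => u' (x ord0 i))).
  by apply: dsmM; [exact: dsm_cst|exact: IH].
by apply/funext => x; rewrite (derive_coord _ (du _)).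
Qed.

Definition prodfun (u : 'I_n -> R -> R) (x : V) : R := \prod_j u j (x ord0 j).

Lemma dsm_prodfun k u : (forall j, sm k (u j)) -> dsm k (prodfun u).
Proof.
move=> su; rewrite /prodfun; elim: (index_enum _) => [|j s IH].
  under eq_fun do rewrite big_nil.
  exact: dsm_cst.
under eq_fun do rewrite big_cons.
exact: dsmM (dsm_coord _ (su j)) IH.
Qed.

Lemma dsm_iterD (vs : seq V) psi : (forall k, dsm k psi) ->
  forall x, differentiable (Defs.iterD vs psi) x.
Proof.
(* [foldr] differentiates in the last direction of the list first, so the list is peeled from its
   end. *)
elim/last_ind: vs psi => [|vs v IH] psi spsi x; first exact: (spsi 1%N).1.
rewrite /Defs.iterD foldr_rcons; apply: IH => k.
exact: (spsi k.+1).2.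
Qed.

Lemma test_prodfun u (K : R) : (forall j k, sm k (u j)) ->
  (forall j t, K < `|t| -> u j t = 0) -> test_fun (prodfun u).
Proof.
move=> su uK; split.
  by move=> vs x; apply: dsm_iterD => k; exact: dsm_prodfun.
pose C := [set x : V | forall i, `[- K, K]%classic (x ord0 i)].
have cC : compact C.
  by apply: (@rV_compact _ _ (fun=> `[- K, K]%classic)) => i; exact: segment_compact.
apply: (subclosed_compact _ cC); first exact: closed_closure.
have : closed C by apply: compact_closed => //; exact: norm_hausdorff.
move=> /closure_id ->; apply: closure_subset => x /= px i.
rewrite /= in_itv/= -ler_norml leNgt; apply/negP => Kx.
by move/eqP: px; apply; rewrite /prodfun (bigD1 i)//= uK// mul0r.
Qed.

Lemma partial_prodfun u i (x : V) (u' : R) :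
  is_derive (x ord0 i) 1 (u i) u' ->
  partial i (prodfun u) x = (\prod_(j | j != i) u j (x ord0 j)) * u'.
Proof.
move=> du; rewrite /partial /derive.
set c := \prod_(j | j != i) _.
have E h : h^-1 *: (prodfun u (h *: delta_mx ord0 i + x) - prodfun u x) =
    c * (h^-1 *: (u i (h *: 1 + x ord0 i) - u i (x ord0 i))).
  rewrite /prodfun (bigD1 i)//= [X in _ - X](bigD1 i)//= -/c.
  rewrite (_ : \prod_(j | _) _ = c); last first.
    apply: eq_bigr => j /negbTE ji.
    by rewrite !mxE eqxx ji mulr0 add0r.
  rewrite !mxE !eqxx /GRing.scale/= !mulr1; ring.
under eq_fun do rewrite E.
have [dui <-] := du; apply: cvg_lim => //.
apply: cvgMr; exact: dui.
Qed.

End smoothV.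

(** * Resampling one Gaussian coordinate *)

Section rV.
Context (R : realType) (n : nat).
Local Notation V := 'rV[R]_n.
Local Notation lam := (@lebesgue_measure R).
Local Notation g1 := (@normal_prob R 0 1).

Lemma measurable_coord (i : 'I_n) : measurable_fun setT (fun x : V => x ord0 i).
Proof.
move=> _ Y mY; rewrite setTI; apply: sub_sigma_algebra => /=.
rewrite -bigcup_seq/=; exists i => /=; first by rewrite mem_index_enum.
by exists Y => //; rewrite setTI.
Qed.

Lemma measurable_rVP d (T : measurableType d) (f : T -> V) :
  (forall i, measurable_fun setT (fun x => f x ord0 i)) -> measurable_fun setT f.
Proof.
move=> mf; apply: (@measurability _ _ _ _ _ _
   (\big[setU/set0]_(i < n) preimage_set_system setT (@rV_coord R n i) measurable)) => //.
move=> _ [A + <-]; rewrite -bigcup_seq => -[i /= _ [B mB <-]].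
by rewrite !setTI; have := mf i measurableT B mB; rewrite setTI.
Qed.

Definition box (a b : 'I_n -> R) : set V :=
  [set x | forall i, a i < x ord0 i < b i].

Definition boxes : set (set V) := [set A | exists a b, A = box a b].

Lemma measurable_rect (A : 'I_n -> set R) : (forall i, measurable (A i)) ->
  measurable [set x : V | forall i, A i (x ord0 i)].
Proof.
move=> mA; rewrite (_ : mkset _ = \bigcap_(i in [set: 'I_n])
   ((fun x : V => x ord0 i) @^-1` A i)); last first.
  by apply/seteqP; split => [x Ax i _|x Ax i]; [exact: Ax|exact: (Ax i)].
apply: fin_bigcap_measurable => [|i _]; first exact: finite_finset.
by have := measurable_coord i measurableT (mA i); rewrite setTI.
Qed.

Lemma boxE a b : box a b = [set x : V | forall i, `]a i, b i[%classic (x ord0 i)].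
Proof. by apply/seteqP; split => x bx i /=; have := bx i; rewrite /= in_itv. Qed.

Lemma measurable_box a b : measurable (box a b).
Proof. by rewrite boxE; apply: (@measurable_rect (fun i => `]a i, b i[%classic)). Qed.

Lemma boxes_gen : @measurable _ V = <<s boxes >>.
Proof.
apply/seteqP; split; last first.
  apply: smallest_sub; first exact: sigma_algebra_measurable.
  by move=> _ [a [b ->]]; exact: measurable_box.
apply: smallest_sub; first exact: smallest_sigma_algebra.
rewrite -bigcup_seq => A [i /= _ [B mB <-]]; rewrite setTI.
pose VB := g_sigma_algebraType boxes.
suff mc : measurable_fun setT ((fun x => x ord0 i) : VB -> R).
  by have := mc measurableT _ mB; rewrite setTI.
apply: (measurability _ (RGenOInfty.measurableE R)) => //.
move=> _ [_ [t ->] <-]; rewrite setTI.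
(* Every point has all its coordinates bounded by some integer, so a half-space is a countable union
   of boxes. *)
rewrite (_ : _ @^-1` _ = \bigcup_k (box (fun j => if j == i then t else - k%:R)
    (fun=> k%:R) : set VB)).
  apply: bigcup_measurable => k _; apply: sub_sigma_algebra.
  by eexists; eexists.
apply/seteqP; split => x /=; rewrite in_itv/= andbT.
  move=> tx.
  have [k Hk] : exists k : nat, forall j, `|x ord0 j| < k%:R.
    exists (Num.bound (\sum_j `|x ord0 j|)) => j.
    apply: le_lt_trans (archi_boundP _); last by rewrite sumr_ge0.
    by rewrite (bigD1 j)//= lerDl sumr_ge0.
  exists k => // j; have := Hk j; rewrite ltr_norml => /andP[kx ->]; rewrite andbT.
  by case: eqP => [->|].
by move=> [k _ /(_ i)]; rewrite eqxx => /andP[].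
Qed.

Lemma boxesI : setI_closed boxes.
Proof.
move=> _ _ [a [b ->]] [a' [b' ->]].
exists (fun i => Num.max (a i) (a' i)), (fun i => Num.min (b i) (b' i)).
apply/seteqP; split => x /=.
  move=> [h h'] i; rewrite gt_max lt_min.
  by move: (h i) (h' i) => /andP[h1 h2] /andP[h3 h4]; rewrite h1 h2 h3 h4.
by move=> h; split => i; have := h i; rewrite gt_max lt_min => /andP[/andP[h1 h2] /andP[h3 h4]]; rewrite ?h1 ?h2 ?h3 ?h4.
Qed.

Definition cube (k : nat) := box (fun=> - k%:R) (fun=> k%:R).

Lemma cube_cover : \bigcup_k cube k = setT.
Proof.
apply/seteqP; split => // x _.
exists (Num.bound (\sum_j `|x ord0 j|)) => // j; rewrite -ltr_norml.
apply: le_lt_trans (archi_boundP _); last by rewrite sumr_ge0.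
by rewrite (bigD1 j)//= lerDl sumr_ge0.
Qed.

Lemma rV_measure_unique (m1 m2 : {measure set V -> \bar R}) :
  (forall a b, m1 (box a b) = m2 (box a b)) ->
  (forall k, (m1 (cube k) < +oo)%E) ->
  forall A, measurable A -> m1 A = m2 A.
Proof.
move=> m12 m1oo; apply: (measure_unique boxes cube boxes_gen boxesI) => //.
- by move=> k; eexists; eexists.
- exact: cube_cover.
- by move=> _ [a [b ->]].
Qed.

(** Lines in direction [i] are parametrised by overwriting a coordinate instead of factoring the
    space: all functions keep one domain, and [push_upd] provides the Fubini theorem for these
    lines. *)
Definition upd (i : 'I_n) (z : V * R) : V :=
  \row_j (if j == i then z.2 else z.1 ord0 j).

Lemma updE i (x : V) (s : R) j : upd i (x, s) ord0 j = if j == i then s else x ord0 j.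
Proof. by rewrite mxE. Qed.

Lemma upd_upd i (x : V) (s t : R) : upd i (upd i (x, s), t) = upd i (x, t).
Proof. by apply/rowP => j; rewrite !updE; case: eqP. Qed.

Lemma upd_comm i j (x : V) (s t : R) : i != j ->
  upd i (upd j (x, s), t) = upd j (upd i (x, t), s).
Proof.
move=> ij; apply/rowP => k; rewrite !updE.
by case: (eqVneq k i) => [->|//]; rewrite (negbTE ij).
Qed.

Lemma measurable_upd i : measurable_fun setT (upd i : V * measurableTypeR R -> V).
Proof.
apply: measurable_rVP => j; under eq_fun do rewrite mxE.
case: (j == i); first exact: measurable_snd.
by apply: (measurableT_comp (measurable_coord j)); exact: measurable_fst.
Qed.

Variable gam : probability V R.
Hypothesis gamP : is_std_gaussian gam.

Lemma push_upd i A : measurable A ->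
  (gam \x g1)%E (upd i @^-1` A) = gam A.
Proof.
pose u : V * measurableTypeR R -> V := upd i.
have mu_ : measurable_fun setT u by exact: measurable_upd.
move=> mA; rewrite -[LHS]/(pushforward (gam \x g1)%E u A); apply/esym.
apply: (@rV_measure_unique gam (pushforward (gam \x g1)%E u)) => //; last first.
  move=> k; apply: le_lt_trans (ltry 1).
  by apply: probability_le1; exact: measurable_box.
move=> a b; rewrite /pushforward boxE.
transitivity (\prod_(j < n) g1 `]a j, b j[%classic)%E.
  by apply: (gamP (A := fun j => `]a j, b j[%classic)).
(* The old coordinate [i] is left free, and the newly drawn one supplies the corresponding
   factor. *)
pose B j := if j == i then [set: R] else `]a j, b j[%classic.
pose D := [set x : V | forall j, B j (x ord0 j)] `*` `]a i, b i[%classic.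
have DE : D = u @^-1` [set x | forall j, `]a j, b j[%classic (x ord0 j)].
  apply/seteqP; split => [[x s] /= [H1 H2] j|[x s] /= H].
    rewrite updE; case: eqP => [->//|/eqP/negbTE ji].
    by have := H1 j; rewrite /B ji.
  split => [j|]; last by have := H i; rewrite updE eqxx.
  rewrite /B; case: ifP => // ji.
  by have := H j; rewrite updE ji.
transitivity ((gam \x g1)%E D); last by rewrite DE.
have mB j : measurable (B j) by rewrite /B; case: ifP.
rewrite product_measure1E//; last exact: measurable_rect.
rewrite [X in (X * _)%E](gamP mB) (bigD1 i)//= [in RHS](bigD1 i)//= {1}/B eqxx.
rewrite probability_setT mul1e muleC.
by congr (_ * _)%E; apply: eq_bigr => j /negbTE ji; rewrite /B ji.
Qed.

Lemma itg_upd i (h : V -> R) : measurable_fun setT h ->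
  itg gam h <-> itg (gam \x g1)%E (fun z => h (upd i z)).
Proof.
move=> mh; exact: (itg_push (T1 := (V * measurableTypeR R)%type) (measurable_upd i) (push_upd i) mh).
Qed.

Lemma Rint_upd i (h : V -> R) : itg gam h ->
  \int[gam]_x h x = \int[gam]_x \int[g1]_s h (upd i (x, s)).
Proof.
move=> ih; have mh := itg_meas ih.
rewrite -(Rint_push (T1 := (V * measurableTypeR R)%type) (measurable_upd i) (push_upd i) ih).
have ihu := (itg_upd i mh).1 ih.
by rewrite (Rint_prod ihu).
Qed.

Lemma ae_upd i (P : V -> Prop) : (\forall x \ae gam, P x) ->
  \forall x \ae gam, \forall s \ae g1, P (upd i (x, s)).
Proof.
move=> [N [mN N0 sub]].
pose h (z : V * measurableTypeR R) : R := \1_N (upd i z).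
have mh : measurable_fun setT h.
  exact: measurableT_comp (measurable_indR mN) (measurable_upd i).
have iN : itg gam (\1_N : V -> R).
  apply: (@itg_ge0P _ _ _ _ _ 0) => //.
  rewrite integral_indic// setIT; exact: N0.
have ih : itg (gam \x g1)%E h by apply/(itg_upd i (itg_meas iN)).
have : \int[gam]_x \int[g1]_s h (x, s) = 0.
  rewrite -(Rint_upd i iN) /Rintegral integral_indic// setIT.
  by rewrite [X in fine X](_ : _ = 0%E).
move/(Rint_eq0 (itg_Rint ih)); move=> /(_ (fun x => Rint_ge0 _ _)) H.
have {}H : \forall x \ae gam, \int[g1]_s h (x, s) = 0.
  by apply: H => x s; rewrite /h indicE.
apply: ae_S2 H (itg_line ih) => x hx ihx.
have : \forall s \ae g1, h (x, s) = 0.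
  by apply: Rint_eq0 => // s; rewrite /h indicE.
apply: ae_S => s; rewrite /h indicE => hs.
apply: contrapT => nP; have : N (upd i (x, s)) by apply: sub.
by move/mem_set => E; move: hs; rewrite E => /eqP; rewrite oner_eq0.
Qed.

End rV.

(** * Distributional derivatives on the line *)

Section acl_line.
Context (R : realType).
Local Notation lam := (@lebesgue_measure R).
Implicit Types (p q e : R -> R).

Lemma prim_itvE q y : prim q y = \int[lam]_(s in `]-oo, y]) q s.
Proof.
rewrite Rintegral_mkcond; apply: eq_Rintegral => s _.
rewrite patchE mem_setE in_itv/=; case: (s <= y); first by rewrite mul1r.
by rewrite mul0r.
Qed.

Lemma is_derive_prim q : itg lam q ->
  \forall s \ae lam, is_derive (s : R) 1 (prim q) (q s).
Proof.
move=> iq.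
have /FTC1Ny : forall y : R, lam.-integrable `]-oo, y] (EFin \o q).
  by move=> y; exact: (integrableS measurableT).
move=> /(_ (open_integrable_locally openT iq)).
apply: ae_S => s [ds qs]; rewrite (funext (prim_itvE q)).
by apply: DeriveDef; [exact: ds|rewrite -derive1E; exact: qs].
Qed.

(** Continuity extends the hypothesis to all reals, and Lebesgue differentiation concludes. Rational
    points are what later allows a single null set for all test intervals. *)
Lemma prim_eq0 e : itg lam e -> (forall y : rat, prim e (ratr y) = 0) ->
  \forall s \ae lam, e s = 0.
Proof.
move=> ie e0.
have {}e0 y : prim e y = 0.
  apply/eqP; apply: contrapT => /negP ey.
  have cy : prim e z @[z --> y] --> prim e y by have := prim_continuous ie; apply.
  have ey0 : 0 < `|prim e y| by rewrite normr_gt0.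
  move/cvgrPdist_lt : cy => /(_ _ ey0) /nbhs_ballP[d /= d0 yd].
  have [r] := @rat_in_itvoo R y (y + d) ltac:(by rewrite ltrDl).
  rewrite in_itv/= => /andP[yr ry].
  have := yd (ratr r); rewrite /= e0 subr0 ltxx => H; apply: notF; apply: H.
  by rewrite /ball/= ltr0_norm ?subr_lt0// opprB ltrBlDl.
apply: ae_S (is_derive_prim ie) => s [_ <-].
have -> : prim e = cst 0 by apply/funext.
by rewrite derive_cst.
Qed.

(* The correction on ]0, 1[ gives total mass 0, hence a primitive of compact support. *)
Definition tent (a b s : R) : R := (a < s < b)%R%:R - (b - a) * (0 < s < 1)%R%:R.

Lemma tent_le (a b s : R) : a < b -> `|tent a b s| <= 1 + (b - a).
Proof.
move=> ab; rewrite /tent; apply: le_trans (ler_normB _ _) _.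
apply: lerD; first by case: (a < s < b); rewrite ?normr1 ?normr0.
by case: (0 < s < 1); rewrite ?mulr1 ?mulr0 ?normr0 ?ger0_norm//; move: ab; lra.
Qed.

Lemma ind_itv (a b : R) : a <= b ->
  itg lam (fun s => (a < s < b)%R%:R) /\ \int[lam]_s (a < s < b)%R%:R = b - a.
Proof.
move=> ab.
have E : (fun s => (a < s < b)%R%:R) = (\1_(`]a, b[%classic : set R) : R -> R).
  by apply/funext => s; rewrite indicE mem_setE in_itv.
have H : (\int[lam]_s (\1_(`]a, b[%classic : set R) s)%:E = (b - a)%:E)%E.
  rewrite integral_indic//= setIT lebesgue_measure_itv/= lte_fin.
  by have [//|ba] := ltP a b; congr EFin; move: ab ba; lra.
split; first by rewrite E; apply: itg_ge0P H => //.
by rewrite /Rintegral -[RHS]/(fine (b - a)%:E) -H; congr fine; apply: eq_integral => s _; rewrite -[in RHS]E.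
Qed.

Lemma measurable_itvb d (T : measurableType d) (h : T -> R) (a b : R) :
  measurable_fun setT h -> measurable_fun setT (fun s => a < h s < b).
Proof. by move=> mh; apply: measurable_and; apply: measurable_fun_ltr. Qed.

Lemma itg_tent a b : a <= b -> itg lam (tent a b).
Proof.
move=> ab; apply: itgB; first exact: (ind_itv ab).1.
by apply: itgZ; exact: (ind_itv ler01).1.
Qed.

Lemma Rint_tent a b : a <= b -> \int[lam]_s tent a b s = 0.
Proof.
move=> ab; have [i1 E1] := ind_itv ab; have [i0 E0] := ind_itv (@ler01 R).
rewrite /tent RintB//; last exact: itgZ.
by rewrite RintZ// E1 E0 subr0 mulr1 subrr.
Qed.

Lemma prim_abs q y : itg lam q -> `|prim q y| <= prim (fun s => `|q s|) y.
Proof.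
move=> iq; apply: le_trans (le_normr_Rintegral measurableT (itg_le_half y iq)) _.
apply: le_Rint; [exact: (itg_norm (itg_le_half y iq))|exact/itg_le_half/itg_norm|].
by move=> s; rewrite normrM normr_nat.
Qed.

Lemma prim_abs_le q y : itg lam q -> `|prim q y| <= \int[lam]_s `|q s|.
Proof.
move=> iq; apply: le_trans (prim_abs y iq) _.
apply: le_Rint; [exact/itg_le_half/itg_norm|exact: itg_norm|].
by move=> s; rewrite ler_piMl// lern1 leq_b1.
Qed.

(** Fubini on the triangle [t <= s]: the integral of [q] beyond [t] is that over the line minus
    [prim q t], and the constant cancels because [m] has integral 0. *)
Lemma Rint_prim_swap m q : itg lam m -> itg lam q -> \int[lam]_s m s = 0 ->
  \int[lam]_s (q s * prim m s) = - \int[lam]_s (m s * prim q s).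
Proof.
move=> im iq m0.
have mm := itg_meas im; have mq := itg_meas iq.
pose w (z : R * R) := (z.2 <= z.1)%R%:R * (q z.1 * m z.2).
have mb : measurable_fun setT (fun z : R * R => z.2 <= z.1) by apply: measurable_fun_ler.
have iw0 : itg (lam \x lam)%E (fun z : R * R => q z.1 * m z.2).
  apply: (@itg_prod_lines _ _ _ _ R lam lam _ (fun x => (\int[lam]_s `|m s|) * `|q x|)).
  - by apply: measurable_funM; exact: measurableT_comp.
  - by apply: itgZ; exact: itg_norm.
  - by apply: ae_W => x /=; exact: itgZ.
  apply: ae_W => x /=; rewrite mulrC -RintZ; last exact: itg_norm.
  by under [leLHS]eq_Rintegral do rewrite normrM.
have iw : itg (lam \x lam)%E w by apply: itg_bool.
have := Rint_swap iw; rewrite /w/=.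
under eq_Rintegral => s _.
  rewrite (_ : \int[lam]_y _ = q s * prim m s); last first.
    rewrite /prim -RintZ; last exact: itg_le_half.
    by apply: eq_Rintegral => t _; rewrite mulrCA.
  over.
move=> ->.
have iqm : itg lam (fun s => m s * prim q s).
  under eq_fun do rewrite mulrC.
  apply: (itg_bdd (C := \int[lam]_s `|q s|)) => //.
    exact: measurable_prim.
  by move=> s; exact: prim_abs_le.
rewrite -RintN//.
transitivity (\int[lam]_t ((\int[lam]_s q s) * m t - m t * prim q t)); last first.
  rewrite RintB ?RintZ// ?m0 ?mulr0 ?sub0r ?RintN//; exact: itgZ.
apply: eq_Rintegral => t _.
rewrite [(_ * m t)%R]mulrC -mulrBr /prim -RintB//; last exact: itg_le_half.
rewrite -RintZ; last by apply: itgB => //; exact: itg_le_half.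
apply: ae_eq_Rint.
- apply: measurable_funM; first by apply: measurable_b2R; exact: measurable_fun_ler.
  exact: measurable_funM.
- apply: measurable_funM => //; apply: measurable_funB => //.
  exact: itg_meas (itg_le_half _ iq).
apply: ae_S (ae_neq t) => s st.
by case: (ltgtP t s) st => //; rewrite /= ?mul1r ?mul0r ?subr0 ?subrr ?mulr0 // mulrC.
Qed.

(** The du Bois-Reymond lemma. After [Rint_prim_swap], the hypothesis says that [p - prim q] has
    integral [(b - a) C] over each rational []a, b[], where [C] is its integral over []0, 1[]; hence
    it equals [C] almost everywhere. *)
Lemma acl_line p q (N : nat) : (0 < N)%N -> itg lam p -> itg lam q ->
  (forall a b : rat, - N%:R <= ratr a :> R -> a < b -> ratr b <= N%:R :> R ->
    \int[lam]_s (p s * tent (ratr a) (ratr b) s +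
       q s * prim (tent (ratr a) (ratr b)) s) = 0) ->
  exists C, \forall s \ae lam, - N%:R < s < N%:R -> p s = C + prim q s.
Proof.
move=> N0 ip iq H.
have N1 : 1 <= N%:R :> R by rewrite ler1n.
pose D s := p s - prim q s.
have mpq := measurable_prim iq; have mp := itg_meas ip.
have mD : measurable_fun setT D by exact: measurable_funB.
have iD a b : itg lam (fun s => (a < s < b)%R%:R * D s).
  case: (leP a b) => [ab|ba]; last first.
    rewrite (_ : (fun s => _) = fun s => 0 * p s); first exact: itgZ.
    apply/funext => s; case: andP => [[as_ sb]|]; last by rewrite !mul0r.
    by have := lt_trans as_ sb; rewrite ltNge (ltW ba).
  under eq_fun do rewrite mulrBr.
  apply: itgB.
    by apply: itg_bool => //; exact: measurable_itvb.
  under eq_fun do rewrite mulrC.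
  apply: (itg_bdd (C := \int[lam]_s `|q s|)) => //.
    exact: (ind_itv ab).1.
  by move=> s; exact: prim_abs_le.
pose C := \int[lam]_s ((0 < s < 1)%R%:R * D s).
have HD (a b : rat) : - N%:R <= ratr a :> R -> a < b -> ratr b <= N%:R :> R ->
    \int[lam]_s ((ratr a < s < ratr b)%R%:R * D s) = (ratr b - ratr a) * C.
  move=> Na ab bN; have := H a b Na ab bN.
  have ab' : ratr a <= ratr b :> R by rewrite ler_rat ltW.
  set A : R := ratr a in ab' *; set B : R := ratr b in ab' *.
  have it := itg_tent ab'.
  have ipt : itg lam (fun s => p s * tent A B s).
    under eq_fun do rewrite mulrC.
    apply: (itg_bdd (C := 1 + (B - A))) => //; first exact: itg_meas it.
    by move=> s; apply: tent_le; rewrite ltr_rat.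
  have iqt : itg lam (fun s => q s * prim (tent A B) s).
    under eq_fun do rewrite mulrC.
    apply: (itg_bdd (C := \int[lam]_s `|tent A B s|)) => //.
      exact: measurable_prim.
    by move=> s; exact: prim_abs_le.
  have itq : itg lam (fun s => tent A B s * prim q s).
    under eq_fun do rewrite mulrC.
    apply: (itg_bdd (C := \int[lam]_s `|q s|)) => //.
    by move=> s; exact: prim_abs_le.
  rewrite RintD// (Rint_prim_swap it iq (Rint_tent ab')) -RintB//.
  under eq_Rintegral.
    move=> s _; rewrite (_ : _ - _ = (A < s < B)%R%:R * D s - (B - A) * ((0 < s < 1)%R%:R * D s)).
      over.
    by rewrite /tent /D; ring.
  rewrite RintB//; last exact: itgZ.
  by rewrite RintZ// => /eqP; rewrite subr_eq0 => /eqP.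
exists C.
pose e s := (- N%:R < s < N%:R)%R%:R * (D s - C).
have NN : - N%:R <= N%:R :> R by lra.
have ie : itg lam e.
  rewrite /e; under eq_fun do rewrite mulrBr.
  apply: itgB => //; under eq_fun do rewrite mulrC.
  by apply: itgZ; exact: (ind_itv NN).1.
have : \forall s \ae lam, e s = 0.
  apply: prim_eq0 => // y.
  (* The hypothesis reaches only intervals inside [[-N, N]], beyond which [e] vanishes, so the
     endpoint is truncated there. *)
  set Y : R := ratr y; pose M := Num.min Y N%:R.
  have [YN|NY] := leP Y (- N%:R).
    rewrite /prim (_ : 0 = \int[lam]_s (0 * e s)); last by rewrite RintZ// mul0r.
    apply: eq_Rintegral => s _; rewrite /e mul0r.
    case: (leP s Y) => sY; last by rewrite mul0r.
    by rewrite mul1r ltNge (le_trans sY YN)/= mul0r.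
  have [z zE] : exists z : rat, ratr z = M.
    rewrite /M; case: (leP Y N%:R) => _; first by exists y.
    by exists N%:R; rewrite ratr_nat.
  have NM : - N%:R < M by rewrite /M lt_min NY/=; lra.
  have MN : M <= N%:R by rewrite /M ge_min lexx orbT.
  have lamN : ratr (- N%:R) = - N%:R :> R by rewrite rmorphN/= ratr_nat.
  have zN : - N%:R < z by rewrite -(ltr_rat R) lamN zE.
  have := HD (- N%:R) z; rewrite lamN zE => /(_ (lexx _) zN MN) HM.
  have iNM := ind_itv (ltW NM).
  transitivity (\int[lam]_s ((- N%:R < s < M)%R%:R * D s - C * (- N%:R < s < M)%R%:R)).
    apply: ae_eq_Rint.
    - exact: itg_meas (itg_le_half _ ie).
    - apply: measurable_funB; first exact: itg_meas (iD _ _).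
      by apply: measurable_funM => //; exact: itg_meas iNM.1.
    apply: ae_S (ae_neq M) => s sM.
    rewrite /e; have -> : (- N%:R < s < M) = (s <= Y) && (- N%:R < s < N%:R).
      move: sM; rewrite /M lt_min; case: (leP Y N%:R) => YN sM.
        by rewrite [s <= Y]le_eqVlt (negbTE sM)/=; case: (s < Y); case: (- N%:R < s); case: (s < N%:R).
      case: (ltP s N%:R) => [sN|]; last by rewrite !andbF.
      by rewrite (ltW (lt_trans sN YN)) (lt_trans sN YN) !andbT.
    by case: (s <= Y); case: andP; rewrite /= ?mul1r ?mul0r ?mulr0 ?mulr1 ?subr0.
  rewrite RintB//; last exact: itgZ iNM.1.
  by rewrite RintZ ?iNM.2 ?HM//; [rewrite mulrC subrr|exact: iNM.1].
apply: ae_S => s; rewrite /e => es sN.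
move: es; rewrite sN mul1r /D => /eqP; rewrite subr_eq0 => /eqP.
lra.
Qed.

(* At a zero of p the nonnegative function C + prim q is minimal, so its derivative is 0. *)
Lemma stampacchia p q (C : R) (N : nat) : itg lam q -> (forall s, 0 <= p s) ->
  (\forall s \ae lam, - N%:R < s < N%:R -> p s = C + prim q s) ->
  \forall s \ae lam, - N%:R < s < N%:R -> p s = 0 -> q s = 0.
Proof.
move=> iq p0 pE.
have pos t : - N%:R < t < N%:R -> 0 <= C + prim q t.
  move=> tN; rewrite leNgt; apply/negP => ct.
  have cq : prim q z @[z --> t] --> prim q t by have := prim_continuous iq; apply.
  have /nbhs_ballP[d /= d0 td] : \forall z \near t, prim q z < - C.
    by apply: (cvgr_lt _ cq); move: ct; lra.
  have [] := @ae_itv_ex _ _ (Num.max (t - d) (- N%:R)) t _ pE.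
    rewrite gt_max; move/andP: tN => [-> _]; rewrite andbT; lra.
  move=> s [/andP[]]; rewrite gt_max => /andP[ds Ns] st.
  have sN : - N%:R < s < N%:R by rewrite Ns (lt_trans st)//; move/andP: tN => [].
  move=> /(_ sN) ps; have := p0 s; rewrite ps.
  have : prim q s < - C.
    by apply: td; rewrite /ball/= gtr0_norm; lra.
  lra.
apply: ae_S2 pE (is_derive_prim iq) => s ps ds sN ps0.
have {}ps : C + prim q s = 0 by rewrite -ps.
have [/cvg_ex[l lim] Dq] := ds.
have lE : l = q s by rewrite -Dq; apply/esym/cvg_lim.
rewrite {l}lE in lim.
have quot h : - N%:R < h + s < N%:R -> 0 <= prim q (h *: 1 + s) - prim q s.
  by rewrite /GRing.scale/= mulr1 => /pos; lra.
pose d0 := Num.min (s + N%:R) (N%:R - s).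
have d0p : 0 < d0 by rewrite /d0 lt_min; move/andP: sN => [? ?]; apply/andP; split; lra.
have win h : `|h| < d0 -> - N%:R < h + s < N%:R.
  rewrite /d0 lt_min ltr_norml => /andP[/andP[h1 h2]].
  by rewrite ltr_norml => /andP[h3 h4]; apply/andP; split; lra.
(* The quotient is sampled at a small increment of either sign. As the numerator is nonnegative, the
   limit can be neither positive (negative increment) nor negative (positive increment). *)
have pick (P : R -> Prop) (sg : R) : `|sg| = 1 ->
    (\forall h \near 0^', P h) -> exists h, P (sg * h) /\ 0 < h /\ `|sg * h| < d0.
  move=> sg1 /nbhs_ballP[d /= dp dP].
  exists (Num.min d d0 / 2).
  have m0 : 0 < Num.min d d0 by rewrite lt_min dp.
  have nm : `|sg * (Num.min d d0 / 2)| = Num.min d d0 / 2.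
    by rewrite normrM sg1 mul1r gtr0_norm// divr_gt0.
  have md : Num.min d d0 <= d by rewrite ge_min lexx.
  have md0 : Num.min d d0 <= d0 by rewrite ge_min lexx orbT.
  split; [|split; [lra|rewrite nm; lra]].
  apply: dP; first by rewrite /ball/= sub0r normrN nm; lra.
  by rewrite -normr_gt0 nm; lra.
apply/eqP; rewrite eq_le; apply/andP; split; rewrite leNgt; apply/negP => qs.
- have [h [+ [h0 hd]]] := pick _ (-1) ltac:(by rewrite normrN1) (cvgr_gt _ lim _ qs).
  have := quot _ (win _ hd); rewrite /GRing.scale/= => Q.
  rewrite ltNge nmulr_rle0 ?Q//.
  by rewrite invr_lt0 mulN1r oppr_lt0.
- have [h [+ [h0 hd]]] := pick _ 1 (normr1 _) (cvgr_lt _ lim _ qs).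
  have := quot _ (win _ hd); rewrite /GRing.scale/= => Q.
  rewrite ltNge pmulr_rge0 ?Q//.
  by rewrite invr_gt0 mul1r.
Qed.

End acl_line.

Section acl_global.
Context (R : realType).
Local Notation lam := (@lebesgue_measure R).
Implicit Types (p q e : R -> R).

Lemma prim_abs_cvgy q : itg lam q ->
  \int[lam]_s `|q s| - prim (fun s => `|q s|) n%:R @[n --> \oo] --> (0 : R).
Proof.
move=> iq; rewrite -[X in _ --> X](subrr (\int[lam]_s `|q s|)).
by apply: cvgB; [exact: cvg_cst|exact: prim_cvgy (itg_norm iq)].
Qed.

Lemma prim_tail q x y : itg lam q -> x <= y ->
  `|\int[lam]_s q s - prim q y| <= \int[lam]_s `|q s| - prim (fun s => `|q s|) x.
Proof.
move=> iq xy; have ia := itg_norm iq.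
rewrite -!RintB//; [|exact: itg_le_half..].
have i1 : itg lam (fun s => q s - (s <= y)%R%:R * q s).
  by apply: itgB => //; exact: itg_le_half.
apply: le_trans (le_normr_Rintegral measurableT i1) _.
apply: le_Rint; [exact: itg_norm i1|by apply: itgB => //; exact: itg_le_half|].
move=> s; case: (leP s y) => sy; first by rewrite mul1r subrr normr0 subr_ge0 ler_piMl// lern1 leq_b1.
by rewrite [s <= x]leNgt (le_lt_trans xy sy)/= !mul0r !subr0.
Qed.

Lemma prim_head q x y : itg lam q -> y <= x ->
  `|prim q y| <= prim (fun s => `|q s|) x.
Proof.
move=> iq yx; apply: le_trans (prim_abs y iq) _.
by apply: prim_le => //; exact: itg_norm.
Qed.

(** On the unit window starting at [a n] the function [p] is within [eps n] of [L], while its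
    integral over that window tends to 0. *)
Lemma itg_limit_eq0 p (L : R) (a eps : nat -> R) : itg lam p ->
  eps @ \oo --> 0 ->
  prim p (a n + 1) - prim p (a n) @[n --> \oo] --> 0 ->
  (forall n, \forall s \ae lam, a n < s < a n + 1 -> `|p s - L| <= eps n) ->
  L = 0.
Proof.
move=> ip eps0 pa HL.
have H n : `|(prim p (a n + 1) - prim p (a n)) - L| <= eps n.
  have an1 : a n <= a n + 1 by rewrite lerDl.
  have [ii Ei] := ind_itv an1.
  rewrite addrAC subrr add0r in Ei.
  have iip : itg lam (fun s => (a n < s < a n + 1)%R%:R * p s).
    by apply: itg_bool => //; exact: measurable_itvb.
  have iiL : itg lam (fun s => (a n < s < a n + 1)%R%:R * (p s - L)).
    under eq_fun do rewrite mulrBr; apply: itgB => //.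
    by under eq_fun do rewrite mulrC; exact: itgZ.
  have -> : prim p (a n + 1) - prim p (a n) - L =
      \int[lam]_s ((a n < s < a n + 1)%R%:R * (p s - L)).
    transitivity (\int[lam]_s ((a n < s < a n + 1)%R%:R * p s - L * (a n < s < a n + 1)%R%:R)).
      rewrite RintB ?RintZ ?Ei ?mulr1//; last exact: itgZ.
      congr (_ - _); rewrite /prim -RintB; [|exact: itg_le_half..].
      apply: ae_eq_Rint.
      - by apply: measurable_funB; exact: itg_meas (itg_le_half _ ip).
      - exact: itg_meas iip.
      apply: ae_S (ae_neq (a n + 1)) => s sn.
      rewrite -mulrBl; congr (_ * _).
      rewrite [s <= a n + 1]le_eqVlt (negbTE sn)/=.
      case: (leP s (a n)) => san; last by rewrite subr0.
      by rewrite (le_lt_trans san) ?ltrDl// subrr.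
    by apply: eq_Rintegral => s _; ring.
  apply: le_trans (le_normr_Rintegral measurableT iiL) _.
  have E1 : eps n = \int[lam]_s (eps n * (a n < s < a n + 1)%R%:R).
    by rewrite RintZ// Ei mulr1.
  rewrite E1.
  apply: le_Rint_ae; [exact: itg_norm iiL|exact: itgZ|].
  apply: ae_S (HL n) => s Hs.
  case: (boolP (a n < s < _)) => [/Hs Hs'|_]; last by rewrite mul0r mulr0 normr0.
  by rewrite mul1r mulr1.
have : `|(prim p (a n + 1) - prim p (a n)) - L| @[n --> \oo] --> `|0 - L|.
  by apply: cvg_norm; apply: cvgB => //; exact: cvg_cst.
move=> cL.
have : `|0 - L| <= 0 by apply: (ler_cvg_to cL eps0); apply: nearW.
by rewrite sub0r normrN normr_le0 => /eqP.
Qed.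

(* Integrability of p forces the limits of C + prim q at both infinities to be 0. *)
Lemma acl_global p q : itg lam p -> itg lam q ->
  (forall N, (0 < N)%N ->
     exists C, \forall s \ae lam, - N%:R < s < N%:R -> p s = C + prim q s) ->
  (\forall s \ae lam, p s = prim q s) /\ \int[lam]_s q s = 0.
Proof.
move=> ip iq H.
have [C HC] := H 1%N isT.
(* The constants found for different [N] coincide, since each can be compared with that of [N = 1]
   on []-1, 1[]. *)
have {}H N : (0 < N)%N -> \forall s \ae lam, - N%:R < s < N%:R -> p s = C + prim q s.
  move=> N0; have [C' HC'] := H N N0.
  have N1 : 1 <= N%:R :> R by rewrite ler1n.
  suff -> : C = C' by [].
  have [] := @ae_itv_ex _ _ (-1) 1 _ (ae_S2 (fun s h h' => conj h h') HC HC'); first lra.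
  move=> s [/andP[s1 s2] [h1 h2]].
  have := h1 ltac:(by rewrite s1 s2); rewrite h2; last by apply/andP; split; lra.
  lra.
have {HC}H : \forall s \ae lam, p s = C + prim q s.
  have H' n : \forall s \ae lam, - n.+1%:R < s < n.+1%:R -> p s = C + prim q s by exact: H.
  have : \forall s \ae lam, forall n, - n.+1%:R < s < n.+1%:R -> p s = C + prim q s.
    exact/ae_foralln.
  apply: ae_S => s Hs.
  apply: (Hs (Num.bound `|s|)); rewrite -ltr_norml.
  apply: lt_trans (archi_boundP _) _ => //.
  by rewrite ltr_nat.
have cnt (a : nat -> R) (l : R) : prim p (a n) @[n --> \oo] --> l -> prim p (a n + 1) @[n --> \oo] --> l ->
    prim p (a n + 1) - prim p (a n) @[n --> \oo] --> (0 : R).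
  by move=> h1 h2; rewrite -[X in _ --> X](subrr l); exact: cvgB.
have C0 : C = 0.
  apply: (@itg_limit_eq0 p C (fun n => - n.+1%:R) (fun n => prim (fun s => `|q s|) (- n%:R))) => //.
  - exact: prim_cvgNy (itg_norm iq).
  - apply: (cnt _ 0).
      by have := prim_cvgNy ip; rewrite -(cvg_shiftS (fun n => prim p (- n%:R))).
    rewrite (_ : (fun n => _) = fun n => prim p (- n%:R)); first exact: prim_cvgNy.
    by apply/funext => n; congr prim; rewrite -natr1; ring.
  - move=> n; apply: ae_S H => s -> /andP[s1 s2].
    rewrite addrAC subrr add0r; apply: prim_head => //.
    by move: s2; rewrite -natr1; lra.
have {}H : \forall s \ae lam, p s = prim q s.
  by apply: ae_S H => s ->; rewrite C0 add0r.
split => //.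
apply: (@itg_limit_eq0 p _ (fun n => n%:R) (fun n => \int[lam]_s `|q s| - prim (fun s => `|q s|) n%:R)) => //.
- exact: prim_abs_cvgy.
- apply: (cnt _ (\int[lam]_s p s)); first exact: prim_cvgy.
  have := prim_cvgy ip; rewrite -(cvg_shiftS (fun n => prim p n%:R)).
  by under eq_fun do rewrite -natr1.
- move=> n; apply: ae_S H => s -> /andP[s1 s2].
  by rewrite distrC; apply: prim_tail => //; exact: ltW.
Qed.

End acl_global.

(** * Restriction of weak gradients to lines *)

Section approx.
Context (R : realType).
Local Notation lam := (@lebesgue_measure R).

Lemma sm_cst n (c : R) : sm n (fun=> c).
Proof.
elim: n c => [//|n IH] c; exists (fun=> 0); split; last exact: IH.
by move=> x; exact: is_derive_cst.
Qed.

Lemma sm_id n : sm n (fun t : R => t).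
Proof.
case: n => [//|n]; exists (fun=> 1); split; last exact: sm_cst.
by move=> x; exact: is_derive_id.
Qed.

Lemma is_derive_nphi (t : R) : is_derive t 1 (@nphi R) (- t * nphi t).
Proof.
rewrite (_ : @nphi R = fun s => normal_peak 1 * expR (- s ^+ 2 / 2)); last first.
  by apply/funext => s; rewrite nphiE.
have dX : is_derive t 1 (fun s : R => - s ^+ 2 / 2) (- t).
  rewrite (_ : (fun s => _) = (- 2^-1) \*: ((@id R^o) ^+ 2) :> (R^o -> R^o)); last first.
    by apply/funext => s /=; rewrite exprfctE /GRing.scale/= mulrC mulNr mulrN.
  apply: is_derive_eq; rewrite /GRing.scale/= expr1 mulr1 mulNr; congr (- _).
  by rewrite mulrA mulVf ?mul1r.
have dE := @is_derive1_comp R expR (fun s : R => - s ^+ 2 / 2) t _ _ (is_derive_expR _) dX.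
have dZ := @is_deriveZ R R^o R^o _ (normal_peak 1) t 1 _ dE.
rewrite (_ : - t * _ = normal_peak 1 *: (expR (- t ^+ 2 / 2) * - t)); first exact: dZ.
by rewrite /GRing.scale/=; ring.
Qed.

Lemma sm_nphi n : sm n (@nphi R).
Proof.
elim: n => [//|n IH]; exists (fun t => - t * nphi t); split; first exact: is_derive_nphi.
apply: smM => //; apply: sm_ext (smZ (-1) (sm_id n)) => x.
by rewrite mulN1r.
Qed.

Lemma is_derive_prim_cont (q : R -> R) x : itg lam q -> {for x, continuous q} ->
  is_derive x 1 (prim q) (q x).
Proof.
move=> iq cq.
have := @continuous_FTC1 R q -oo%O x (x + 1) ltac:(by rewrite ltrDl).
have iq' : lam.-integrable `]-oo, x + 1] (EFin \o q) by exact: (integrableS measurableT).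
move=> /(_ iq' (ltNyr _) cq)[dx qx].
rewrite (funext (prim_itvE q)).
by apply: DeriveDef; [exact: dx|rewrite -derive1E; exact: qx].
Qed.

Lemma sm_prim n (u : R -> R) : itg lam u -> (forall n, sm n u) -> sm n (prim u).
Proof.
move=> iu su; case: n => [//|n]; exists u; split => // x.
apply: is_derive_prim_cont => //; exact: sm_continuous (su 1%N) x.
Qed.

Lemma itg_bump (a b : R) k : a <= b -> itg lam (bump a b k).
Proof.
move=> ab; apply: itg_le (ind_itv ab).1 _.
  apply: continuous_measurable_fun; exact: sm_continuous (sm_bump 1 a b k).
by move=> s; rewrite ger0_norm ?bump_ge0 ?bump_le.
Qed.

Lemma Rint_bump_gt0 (a b : R) k : a < b -> 0 < \int[lam]_s bump a b k.+1 s.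
Proof.
move=> ab; rewrite lt_neqAle eq_sym; apply/andP; split; last first.
  by apply: Rint_ge0 => s; exact: bump_ge0.
apply/eqP => H.
have := Rint_eq0 (itg_bump k.+1 (ltW ab)) (bump_ge0 a b k.+1) H.
by move=> /(ae_itv_ex ab)[s [sab /eqP]]; rewrite gt_eqF// bump_gt0.
Qed.

Lemma cvg_Rint_bump (a b : R) : a <= b ->
  \int[lam]_s bump a b k.+1 s @[k --> \oo] --> b - a.
Proof.
move=> ab; have [iab Eab] := ind_itv ab; rewrite -Eab.
have [|||||_ //] := @cvg_Rint _ _ _ lam (fun k => bump a b k.+1)
   (fun s => (a < s < b)%R%:R) (fun s => (a < s < b)%R%:R).
- by move=> k; exact: itg_meas (itg_bump _ ab).
- exact: itg_meas iab.
- apply: ae_W => s; have := @cvg_bump R a b s.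
  by rewrite -(cvg_shiftS (fun k => bump a b k s)).
- exact: iab.
- by move=> k s; rewrite ger0_norm ?bump_ge0 ?bump_le.
Qed.

Variables (a b : R).
Hypothesis ab : a < b.

(* [mk] is a smooth approximation of [tent], [lamk] being adjusted to keep the mass 0. *)
Definition lamk k := \int[lam]_s bump a b k.+1 s / \int[lam]_s bump 0 1 k.+1 s.
Definition mk k (s : R) := bump a b k.+1 s - lamk k * bump 0 1 k.+1 s.

Let ab' := ltW ab.
Let i0 k := itg_bump k (@ler01 R).
Let p0 k := Rint_bump_gt0 k (@ltr01 R).

Lemma cvg_lamk : lamk k @[k --> \oo] --> b - a.
Proof.
rewrite -[X in _ --> X]mulr1 -[X in _ * X]invr1; apply: cvgM.
  exact: cvg_Rint_bump.
apply: cvgV; first exact: oner_neq0.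
by have := cvg_Rint_bump (@ler01 R); rewrite subr0.
Qed.

Lemma lamk_ge0 k : 0 <= lamk k.
Proof. by rewrite divr_ge0//; apply: Rint_ge0 => s; exact: bump_ge0. Qed.

Lemma itg_mk k : itg lam (mk k).
Proof. by apply: itgB; [exact: itg_bump|apply: itgZ; exact: i0]. Qed.

Lemma Rint_mk k : \int[lam]_s mk k s = 0.
Proof.
rewrite /mk RintB ?RintZ; [|exact: i0|exact: itg_bump|by apply: itgZ; exact: i0].
by rewrite /lamk divfK ?subrr// gt_eqF.
Qed.

Lemma sm_mk n k : sm n (mk k).
Proof.
apply: sm_ext (smD (sm_bump n a b k.+1) (smZ (- lamk k) (sm_bump n 0 1 k.+1))) => x.
by rewrite /mk mulNr.
Qed.

Lemma sm_prim_mk n k : sm n (prim (mk k)).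
Proof. by apply: sm_prim; [exact: itg_mk|move=> ?; exact: sm_mk]. Qed.

Lemma is_derive_prim_mk k (t : R) : is_derive t 1 (prim (mk k)) (mk k t).
Proof.
apply: is_derive_prim_cont; first exact: itg_mk.
exact: sm_continuous (sm_mk 1 k) t.
Qed.

Lemma bump_eq0 (c d : R) k t : ~~ (c < t < d) -> bump c d k t = 0.
Proof.
move=> /negbTE H; apply/le_anti; rewrite bump_ge0 andbT.
by have := bump_le c d k t; rewrite H.
Qed.

Variable M : R.
Hypotheses (Ma : - M <= a) (bM : b <= M) (M1 : 1 <= M).

Lemma mk_supp k t : M < `|t| -> mk k t = 0.
Proof.
move=> Mt; rewrite /mk !bump_eq0 ?mulr0 ?subr0//; apply/negP => /andP[h1 h2];
  by move: Mt; rewrite ltNge ler_norml => /negP; apply; apply/andP; split;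
     move: Ma bM M1 ab' h1 h2; lra.
Qed.

Lemma prim_supp (m : R -> R) t : itg lam m -> \int[lam]_s m s = 0 ->
  (forall t, M < `|t| -> m t = 0) -> M < `|t| -> prim m t = 0.
Proof.
move=> im m0 ms.
have z (h : R -> R) : (forall s, h s = 0 * m s) -> \int[lam]_s h s = 0.
  by move=> hm; rewrite (_ : h = fun s => 0 * m s) ?RintZ ?mul0r//; exact/funext.
rewrite lter_normr => /orP[Mt|Mt].
  rewrite -m0 /prim; apply: eq_Rintegral => s _.
  case: (leP s t) => st; rewrite ?mul1r// mul0r ms//.
  by rewrite lter_normr (lt_trans Mt st).
apply: z => s; rewrite mul0r; case: (leP s t) => st; rewrite ?mul0r// mul1r ms//.
by rewrite lter_normr; apply/orP; right; lra.
Qed.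

Lemma tent_supp t : M < `|t| -> tent a b t = 0.
Proof.
move=> Mt; rewrite /tent.
have -> : (a < t < b) = false.
  apply/negP => /andP[h1 h2]; move: Mt; rewrite ltNge ler_norml => /negP; apply.
  by apply/andP; split; move: Ma bM h1 h2; lra.
have -> : (0 < t < 1) = false.
  apply/negP => /andP[h1 h2]; move: Mt; rewrite ltNge ler_norml => /negP; apply.
  by apply/andP; split; move: M1 h1 h2; lra.
by rewrite mulr0 subr0.
Qed.

Lemma cvg_mk t : mk k t @[k --> \oo] --> tent a b t.
Proof.
have cb c d : bump c d k.+1 t @[k --> \oo] --> ((c < t < d)%R%:R : R).
  by have := @cvg_bump R c d t; rewrite -(cvg_shiftS (fun k => bump c d k t)).
by apply: cvgB => //; apply: cvgM => //; exact: cvg_lamk.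
Qed.

Lemma mk_bounded : exists L, forall k t, `|mk k t| <= L.
Proof.
have [L HL] : exists L, forall k, lamk k <= L.
  have cl : cvgn lamk by apply/cvg_ex; exists (b - a); exact: cvg_lamk.
  have [L [_ HL]] := cvg_seq_bounded cl.
  exists (L + 1) => k; apply: le_trans (ler_norm _) _.
  by apply: (HL (L + 1)) => //; rewrite ltrDl.
exists (1 + L) => k t; apply: le_trans (ler_normB _ _) _; apply: lerD.
  by rewrite ger0_norm ?bump_ge0//; apply: le_trans (bump_le _ _ _ _) _; rewrite lern1 leq_b1.
rewrite normrM !ger0_norm ?bump_ge0 ?lamk_ge0//.
rewrite -[leRHS]mulr1; apply: ler_pM; rewrite ?bump_ge0 ?lamk_ge0//.
by apply: le_trans (bump_le _ _ _ _) _; rewrite lern1 leq_b1.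
Qed.

Lemma prim_mk_bounded : exists L, forall k t, `|prim (mk k) t| <= L.
Proof.
have [L HL] := mk_bounded.
have L0 : 0 <= L by apply: le_trans (HL 0%N 0).
have MM : - (M + 1) <= M + 1 by move: M1; lra.
have [iM EM] := ind_itv MM.
exists (L * (2 * (M + 1))) => k t.
apply: le_trans (prim_abs_le t (itg_mk k)) _.
rewrite (_ : L * _ = \int[lam]_s (L * (- (M + 1) < s < M + 1)%R%:R)); last first.
  by rewrite RintZ// EM; ring.
apply: le_Rint; [exact: itg_norm (itg_mk k)|exact: itgZ|move=> s].
case: (boolP (- (M + 1) < s < M + 1)) => H; first by rewrite mulr1.
rewrite mk_supp ?normr0 ?mulr0//.
move: H; rewrite -ltr_norml -leNgt; lra.
Qed.

Lemma cvg_prim_mk t : prim (mk k) t @[k --> \oo] --> prim (tent a b) t.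
Proof.
have [L HL] := mk_bounded.
have MM : - (M + 1) <= M + 1 by move: M1; lra.
have [iM EM] := ind_itv MM.
have [|||||_ //] := @cvg_Rint _ _ _ lam (fun k s => (s <= t)%R%:R * mk k s)
   (fun s => (s <= t)%R%:R * tent a b s) (fun s => L * (- (M + 1) < s < M + 1)%R%:R).
- by move=> k; exact: itg_meas (itg_le_half _ (itg_mk k)).
- exact: itg_meas (itg_le_half _ (itg_tent ab')).
- by apply: ae_W => s; apply: cvgM; [exact: cvg_cst|exact: cvg_mk].
- exact: itgZ.
- move=> k s; apply: le_trans (norm_b2R_le _ _) _.
  case: (boolP (- (M + 1) < s < M + 1)) => H; first by rewrite mulr1.
  rewrite mk_supp ?normr0 ?mulr0//.
  by move: H; rewrite -ltr_norml -leNgt; apply: lt_le_trans; rewrite ltrDl.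
Qed.

End approx.

Section transfer.
Context (R : realType).
Local Notation lam := (@lebesgue_measure R).
Local Notation g1 := (@normal_prob R 0 1).

Lemma ae_lam_g1 (P : R -> Prop) : (\forall s \ae lam, P s) -> \forall s \ae g1, P s.
Proof.
move=> [N [mN N0 sub]]; exists N; split => //.
rewrite /normal_prob; apply: null_set_integral => //.
by apply/measurable_EFinP; apply: measurable_funTS; exact: measurable_normal_pdf.
Qed.

Lemma ae_g1_lam (P : R -> Prop) : (\forall s \ae g1, P s) -> \forall s \ae lam, P s.
Proof.
move=> [N [mN N0 sub]].
have iN : itg lam (fun s => \1_N s * nphi s).
  apply: (itg_bdd (C := 1)) => //; first exact: itg_nphi.
  by move=> s; rewrite indicE; case: (s \in N); rewrite ?normr1 ?normr0.
have : \int[lam]_s (\1_N s * nphi s) = 0.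
  transitivity (fine (g1 N)); last by rewrite [X in fine X](_ : _ = 0%E).
  congr fine; rewrite /normal_prob [RHS]integral_mkcond; apply: eq_integral => s _.
  by rewrite patchE indicE; case: (s \in N); rewrite ?mul1r ?mul0r.
move/(Rint_eq0 iN) => H.
have {H} : \forall s \ae lam, \1_N s * nphi s = 0.
  by apply: H => s; rewrite mulr_ge0 ?nphi_ge0// indicE.
apply: ae_S => s /eqP; rewrite mulf_eq0 (gt_eqF (nphi_gt0 s)) orbF indicE => sN.
apply: contrapT => nP; have /mem_set E : N s by apply: sub.
by rewrite E oner_eq0 in sN.
Qed.

End transfer.

Section rV_transfer.
Context (R : realType) (n : nat).
Local Notation V := 'rV[R]_n.
Local Notation lam := (@lebesgue_measure R).
Local Notation g1 := (@normal_prob R 0 1).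
Variable gam : probability V R.
Hypothesis gamP : is_std_gaussian gam.

Lemma itg_indic d (T : measurableType d) (m : {measure set T -> \bar R}) (A : set T) (k : T -> R) :
  measurable A -> itg m k -> itg m (fun x => \1_A x * k x).
Proof.
move=> mA ik; apply: (itg_bdd (C := 1)) => //.
by move=> s; rewrite indicE; case: (s \in A); rewrite ?normr1 ?normr0.
Qed.

Lemma Rint_dmeas d (T : measurableType d) (m : {measure set T -> \bar R}) (h : T -> R)
    (ih : itg m h) (h0 : forall x, 0 <= h x) (A : set T) : measurable A ->
  dmeas ih h0 A = (\int[m]_x (\1_A x * h x))%:E.
Proof.
move=> mA; rewrite EFin_Rint; last exact: itg_indic.
rewrite /dmeas integral_mkcond; apply: eq_integral => s _.
by rewrite patchE indicE; case: (s \in A); rewrite ?mul1r ?mul0r.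
Qed.

(** The finite measures with densities [k + |k|] and [|k|] agree on boxes, hence on all measurable
    sets. So [k] has integral 0 over the set [0 < k] and over its complement, and therefore [|k|]
    has integral 0. *)
Lemma box_eq0 (k : V -> R) : itg gam k ->
  (forall a b, \int[gam]_x (\1_(box a b) x * k x) = 0) ->
  \forall x \ae gam, k x = 0.
Proof.
move=> ik k0; have mk := itg_meas ik.
have ia := itg_norm ik; have iS := itgD ik ia.
have S0 x : 0 <= k x + `|k x| by have := ler_norm (- k x); rewrite normrN; lra.
have a0 x : 0 <= `|k x| by [].
have cancel A : measurable A -> \int[gam]_x (\1_A x * (k x + `|k x|)) =
    \int[gam]_x (\1_A x * k x) + \int[gam]_x (\1_A x * `|k x|).
  move=> mA; rewrite -RintD; [|exact: itg_indic..].
  by apply: eq_Rintegral => x _; rewrite mulrDr.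
have E A : measurable A -> \int[gam]_x (\1_A x * k x) = 0.
  move=> mA; have : dmeas iS S0 A = dmeas ia a0 A.
    apply: (rV_measure_unique (m1 := [the {measure set V -> \bar R} of dmeas iS S0])
      (m2 := [the {measure set V -> \bar R} of dmeas ia a0])) => //.
      move=> a b; have mb := @measurable_box R n a b.
      transitivity (\int[gam]_x (\1_(box a b) x * (k x + `|k x|)))%:E; first exact: Rint_dmeas.
      rewrite cancel// k0 add0r; apply/esym; exact: Rint_dmeas.
    move=> j; have -> : [the {measure set V -> \bar R} of dmeas iS S0] (cube j) =
        (\int[gam]_x (\1_(cube j) x * (k x + `|k x|)))%:E.
      by apply: Rint_dmeas; exact: measurable_box.
    exact: ltry.
  by rewrite !Rint_dmeas// => -[]; rewrite cancel//; lra.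
have mA : measurable [set x | 0 < k x].
  have mb : measurable_fun setT (fun x => 0 < k x) by exact: measurable_fun_ltr.
  by have := mb measurableT [set true]; rewrite setTI; apply.
have mC := measurableC mA.
have /(Rint_eq0 ia a0) : \int[gam]_x `|k x| = 0.
  rewrite (_ : 0 = \int[gam]_x (\1_[set x | 0 < k x] x * k x) -
    \int[gam]_x (\1_(~` [set x | 0 < k x]) x * k x)); last by rewrite !E// subrr.
  rewrite -RintB; [|exact: itg_indic..].
  apply: eq_Rintegral => x _; rewrite -mulrBl !indicE in_setC.
  case: (boolP (x \in _)) => [/set_mem /= kx|/negP kx]; first by rewrite subr0 mul1r gtr0_norm.
  rewrite sub0r mulN1r ler0_norm// leNgt; apply/negP => kx'; exact/kx/mem_set.
by apply: ae_S => x /normr0_eq0.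
Qed.

Lemma boxI (a b a' b' : 'I_n -> R) : exists c d, box a b `&` box a' b' = box c d.
Proof.
have H : boxes (box a b `&` box a' b') by apply: boxesI; eexists; eexists.
exact: H.
Qed.

(** Restriction to a cube reduces to [box_eq0], boxes being stable under intersection; countably
    many cubes cover the space. *)
Lemma box_ae0 (k : V -> R) :
  (forall a b, itg gam (fun x => \1_(box a b) x * k x)) ->
  (forall a b, \int[gam]_x (\1_(box a b) x * k x) = 0) ->
  \forall x \ae gam, k x = 0.
Proof.
move=> ik k0.
have : \forall x \ae gam, forall j, \1_(@cube R n j) x * k x = 0.
  apply/ae_foralln => j; apply: box_eq0 => [|a b]; first exact: ik.
  have [c [d E]] := boxI a b (fun=> - j%:R) (fun=> j%:R).
  rewrite -[RHS](k0 c d) -E; apply: eq_Rintegral => x _.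
  by rewrite mulrA; congr (_ * _); rewrite indicI.
apply: ae_S => x Hx.
have : (\bigcup_k @cube R n k) x by rewrite cube_cover.
move=> [j _ xj]; have := Hx j.
by rewrite indicE mem_set// mul1r.
Qed.

Lemma itg_upd_line i (h : V -> R) : itg gam h ->
  \forall x \ae gam, itg g1 (fun s => h (upd i (x, s))).
Proof. by move=> ih; exact: (itg_line ((itg_upd gamP i (itg_meas ih)).1 ih)). Qed.

Lemma itg_upd_Rint i (h : V -> R) : itg gam h ->
  itg gam (fun x => \int[g1]_s h (upd i (x, s))).
Proof. by move=> ih; exact: (itg_Rint ((itg_upd gamP i (itg_meas ih)).1 ih)). Qed.

Lemma Rint_upd_eq0 i (h : V -> R) : itg gam h ->
  (\forall x \ae gam, \forall s \ae g1, h (upd i (x, s)) = 0) ->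
  \int[gam]_x h x = 0.
Proof.
move=> ih H; rewrite (Rint_upd gamP i ih).
apply: Rint_ae0; first exact: itg_meas (itg_upd_Rint i ih).
apply: ae_S2 H (itg_upd_line i ih) => x Hx ix.
by apply: Rint_ae0 => //; exact: itg_meas ix.
Qed.

(** Converse of [ae_upd]. The predicate is a measurable boolean so that the mass of its exceptional
    set can be computed along lines. *)
Lemma ae_upd_inv i (b : V -> bool) : measurable_fun setT b ->
  (\forall x \ae gam, \forall s \ae g1, b (upd i (x, s))) -> \forall x \ae gam, b x.
Proof.
move=> mb H.
have mh : measurable_fun setT (fun x => (~~ b x)%:R : R).
  by apply: measurable_b2R; exact: measurable_neg.
have ih : itg gam (fun x => (~~ b x)%:R : R).
  have i1 : itg gam (fun=> 1 : R) by exact: finite_measure_integrable_cst.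
  by apply: (itg_le mh i1) => x; rewrite ger0_norm// lern1 leq_b1.
have /(Rint_eq0 ih) H' : \int[gam]_x (~~ b x)%:R = 0 :> R.
  apply: (Rint_upd_eq0 (i := i) ih); apply: ae_S H => x.
  by apply: ae_S => s /= ->.
have {H'} : \forall x \ae gam, (~~ b x)%:R = 0 :> R by apply: H' => x.
apply: ae_S => x; case: (b x) => //= /eqP.
by rewrite oner_eq0.
Qed.

End rV_transfer.

Lemma measurable_prodR d (T : measurableType d) (R : realType) (I : finType)
    (P : pred I) (h : I -> T -> R) : (forall j, measurable_fun setT (h j)) ->
  measurable_fun setT (fun x => \prod_(j | P j) h j x).
Proof.
move=> mh; elim: (index_enum I) => [|j s IH].
  by under eq_fun do rewrite big_nil; exact: measurable_cst.
under eq_fun do rewrite big_cons.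
by case: (P j) => //; exact: measurable_funM.
Qed.

(** * The weak formulation against product test functions *)

Section weak.
Context (R : realType) (n : nat).
Local Notation V := 'rV[R]_n.
Local Notation lam := (@lebesgue_measure R).
Local Notation g1 := (@normal_prob R 0 1).
Variable gam : probability V R.
Hypothesis gamP : is_std_gaussian gam.
Variables (f : V -> R) (g : V -> V).
Hypothesis wg : weak_grad gam f g.
Variable i : 'I_n.

Local Notation gd := (@gauss_dens R n).

Lemma gauss_densE x : gd x = \prod_j nphi (x ord0 j).
Proof.
rewrite /gauss_dens; under eq_bigr do rewrite nphiE.
rewrite big_split/= prodr_const card_ord; congr (_ ^+ _ * _).
  by rewrite /normal_peak expr1n mul1r.
rewrite -expR_sum /sqnorm /dotv; congr expR.
rewrite mulr_suml -sumrN; apply: eq_bigr => j _.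
by rewrite -expr2 mulNr.
Qed.

Lemma gauss_dens_gt0 x : 0 < gd x.
Proof. by rewrite gauss_densE; apply: prodr_gt0 => j _; exact: nphi_gt0. Qed.

Let c0 : R := normal_peak 1.
Let nphi_le x : nphi x <= c0.
Proof. exact: normal_pdf_ub (oner_neq0 R). Qed.

Let mcoord j := @measurable_coord R n j.

Lemma measurable_gauss_dens : measurable_fun setT gd.
Proof.
rewrite (funext gauss_densE); apply: measurable_prodR => j.
exact: measurableT_comp (@measurable_nphi R) (mcoord j).
Qed.

Let mf : measurable_fun setT f. Proof. by case: wg => -[]. Qed.
Let mg : measurable_fun setT (fun x => g x ord0 i).
Proof. by case: wg => _ [/(_ i)[]]. Qed.

(* Along coordinate i, the Lebesgue density of f and the derivative it should have:
   (f phi)' = (g_i - x_i f) phi. *)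
Definition wP (x : V) := f x * nphi (x ord0 i).
Definition wQ (x : V) := (g x ord0 i - x ord0 i * f x) * nphi (x ord0 i).

Let mnphi : measurable_fun setT (fun x : V => nphi (x ord0 i)).
Proof. exact: measurableT_comp (@measurable_nphi R) (mcoord i). Qed.

Lemma measurable_wP : measurable_fun setT wP.
Proof. exact: measurable_funM. Qed.

Lemma measurable_wQ : measurable_fun setT wQ.
Proof.
by apply: measurable_funM => //; apply: measurable_funB => //; exact: measurable_funM.
Qed.

Definition ccube (M : R) := [set x : V | forall j, `[- M, M]%classic (x ord0 j)].

Let mK M : measurable (ccube M).
Proof. by apply: (@measurable_rect R n (fun=> `[- M, M]%classic)). Qed.

Let loc (h : V -> R) M : loc_integrable gam h ->
  itg gam (fun x => \1_(ccube M) x * (h x / gd x)).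
Proof.
move=> [mh /(_ (ccube M)) H].
have cK : compact (ccube M).
  by apply: (@rV_compact _ _ (fun=> `[- M, M]%classic)) => j; exact: segment_compact.
apply: itgP.
  apply: measurable_funM; first exact: measurable_indic.
  by apply: measurable_funM => //; exact: measurable_invr measurable_gauss_dens.
apply: le_lt_trans (H cK).
rewrite [leRHS]integral_mkcond le_eqVlt; apply/orP; left; apply/eqP.
apply: eq_integral => x _; rewrite patchE indicE.
case: (x \in _); last by rewrite mul0r normr0.
by rewrite mul1r normrM [X in _ * X]gtr0_norm// invr_gt0 gauss_dens_gt0.
Qed.

Lemma itg_locf M : itg gam (fun x => \1_(ccube M) x * (f x / gd x)).
Proof. by apply: loc; case: wg. Qed.

Lemma itg_locg M : itg gam (fun x => \1_(ccube M) x * (g x ord0 i / gd x)).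
Proof. by apply: (loc (h := fun x => g x ord0 i)); case: wg => _ []. Qed.

Lemma itg_locP M : itg gam (fun x => \1_(ccube M) x * (wP x / gd x)).
Proof.
rewrite (_ : (fun x => _) = fun x : V => nphi (x ord0 i) * (\1_(ccube M) x * (f x / gd x))).
  apply: (itg_bdd (C := c0)) => //; first exact: itg_locf.
  by move=> x; rewrite ger0_norm ?nphi_ge0.
by apply/funext => x; rewrite /wP; ring.
Qed.

Lemma itg_locQ M : itg gam (fun x => \1_(ccube M) x * (wQ x / gd x)).
Proof.
rewrite (_ : (fun x => _) = fun x : V => nphi (x ord0 i) * (\1_(ccube M) x * (g x ord0 i / gd x))
   - (\1_(ccube M) x * x ord0 i * nphi (x ord0 i)) * (\1_(ccube M) x * (f x / gd x))).
  apply: itgB.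
    apply: (itg_bdd (C := c0)) => //; first exact: itg_locg.
    by move=> x; rewrite ger0_norm ?nphi_ge0.
  apply: (itg_bdd (C := `|M| * c0)) => //; last 2 first.
  - exact: itg_locf.
  - move=> x; rewrite indicE; case: (boolP (x \in _)) => [/set_mem/(_ i)|_].
      rewrite /= in_itv/= -ler_norml => xM; rewrite mul1r normrM.
      by rewrite ler_pM// ?(le_trans xM) ?ler_norm// ger0_norm ?nphi_ge0.
    by rewrite !mul0r normr0 mulr_ge0// (le_trans (nphi_ge0 0)).
  do 2 apply: measurable_funM => //; exact: measurable_indic.
apply/funext => x; rewrite /wQ indicE; case: (x \in _); rewrite ?mul1r ?mul0r; ring.
Qed.

Section test.
Variables (a b : 'I_n -> R) (al be M : R).
Hypotheses (albe : al < be) (Mal : - M <= al) (beM : be <= M) (M1 : 1 <= M).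
Hypothesis abM : forall j, - M <= a j /\ b j <= M.

Definition cutoff (x : V) : R := \prod_(j | j != i) (a j < x ord0 j < b j)%R%:R.
(* Limit of the integrand of [weak_grad] for the test functions
   \prod_(j != i) bump(x_j) * prim mk(x_i) * nphi(x_i). *)
Definition testlim (x : V) : R :=
  cutoff x * (wP x * tent al be (x ord0 i) + wQ x * prim (tent al be) (x ord0 i)) / gd x.

Let bmp k (x : V) : R := \prod_(j | j != i) bump (a j) (b j) k (x ord0 j).
Let m := mk al be.

(** The factor [nphi] in slot [i] creates the Gaussian weight of [wP] and [wQ]; its own derivative
    [- t * nphi t] supplies the term [- x_i f] of [wQ]. *)
Let u k (j : 'I_n) : R -> R :=
  if j == i then (fun t => prim (m k) t * nphi t) else bump (a j) (b j) k.

Let albe' := ltW albe.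

Let uE k (x : V) : \prod_(j | j != i) u k j (x ord0 j) = bmp k x.
Proof. by apply: eq_bigr => j /negbTE ji; rewrite /u ji. Qed.

Let psiE k (x : V) : prodfun (u k) x = bmp k x * (prim (m k) (x ord0 i) * nphi (x ord0 i)).
Proof. by rewrite /prodfun (bigD1 i)//= uE {1}/u eqxx mulrC. Qed.

Let prim_m0 k t : M < `|t| -> prim (m k) t = 0.
Proof.
apply: prim_supp; [exact: itg_mk|exact: Rint_mk|].
exact: mk_supp.
Qed.

Let test_u k : test_fun (prodfun (u k)).
Proof.
apply: (@test_prodfun R n (u k) M).
  move=> j l; rewrite /u; case: ifP => _; last exact: sm_bump.
  by apply: smM; [exact: sm_prim_mk|exact: sm_nphi].
move=> j t Mt; rewrite /u; case: ifP => _.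
  by rewrite prim_m0// mul0r.
rewrite bump_eq0//; apply/negP => /andP[h1 h2].
have [h3 h4] := abM j.
by move: Mt; rewrite ltNge ler_norml => /negP; apply; apply/andP; split; lra.
Qed.

Let partial_u k (x : V) : partial i (prodfun (u k)) x =
  bmp k x * (prim (m k) (x ord0 i) * (- x ord0 i * nphi (x ord0 i)) +
             nphi (x ord0 i) * m k (x ord0 i)).
Proof.
have d1 := is_derive_prim_mk albe k (x ord0 i).
have d2 := is_derive_nphi (x ord0 i).
have du : is_derive (x ord0 i) 1 (u k i) (prim (m k) (x ord0 i) *: (- x ord0 i * nphi (x ord0 i)) +
    nphi (x ord0 i) *: m k (x ord0 i)).
  by rewrite /u eqxx; exact: (@is_deriveM R R^o (prim (m k)) (@nphi R) _ _ _ _ d1 d2).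
by rewrite (partial_prodfun du) uE.
Qed.

Let bmp_bd k (x : V) : 0 <= bmp k x <= 1.
Proof.
apply/andP; split; first by apply: prodr_ge0 => j _; exact: bump_ge0.
apply: prodr_ile1 => j _; rewrite bump_ge0/=.
by apply: le_trans (bump_le _ _ _ _) _; rewrite lern1 leq_b1.
Qed.

Let hk k (x : V) : R :=
  bmp k x * (wP x * m k (x ord0 i) + wQ x * prim (m k) (x ord0 i)) / gd x.

Let FP x := \1_(ccube M) x * (wP x / gd x).
Let FQ x := \1_(ccube M) x * (wQ x / gd x).
Let Fg x := \1_(ccube M) x * (g x ord0 i / gd x).

Let bmp0 k (x : V) : x \notin ccube M -> `|x ord0 i| <= M -> bmp k x = 0.
Proof.
move=> xK xi; have [j jM] : exists j, M < `|x ord0 j|.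
  apply: contrapT => H; move/negP: xK; apply; apply/mem_set => j /=.
  rewrite in_itv/= -ler_norml leNgt; apply/negP => jM; apply: H; by exists j.
have ji : j != i by apply/eqP => ji; move: jM; rewrite ji ltNge xi.
rewrite /bmp (bigD1 j)//= bump_eq0 ?mul0r//; apply/negP => /andP[h1 h2].
have [h3 h4] := abM j.
by move: jM; rewrite ltNge ler_norml => /negP; apply; apply/andP; split; lra.
Qed.

(** Outside the cube some factor of the test function vanishes, so the indicators hidden in [FP] and
    [FQ] cost nothing. They turn local integrability into a fixed integrable bound for all [k]. *)
Let hkE k (x : V) : hk k x = (bmp k x * m k (x ord0 i)) * FP x +
                       (bmp k x * prim (m k) (x ord0 i)) * FQ x.
Proof.
rewrite /hk /FP /FQ indicE; case: (boolP (x \in ccube M)) => xK.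
  by rewrite /= !mul1r; ring.
have [xi|xi] := leP `|x ord0 i| M; first by rewrite bmp0// !mul0r addr0.
by rewrite prim_m0// /m (mk_supp albe Mal beM M1 _ xi) !(mulr0, mul0r, addr0).
Qed.

Let gpsiE k (x : V) : g x ord0 i * prodfun (u k) x / gd x =
  (bmp k x * prim (m k) (x ord0 i) * nphi (x ord0 i)) * Fg x.
Proof.
rewrite psiE /Fg indicE; case: (boolP (x \in ccube M)) => xK.
  by rewrite /= !mul1r; ring.
have [xi|xi] := leP `|x ord0 i| M; first by rewrite bmp0// !mul0r mulr0 mul0r.
by rewrite prim_m0// !(mulr0, mul0r).
Qed.

Let mbmp k : measurable_fun setT (bmp k).
Proof.
apply: measurable_prodR => j; apply: measurableT_comp (mcoord j).
by apply: continuous_measurable_fun; exact: sm_continuous (sm_bump 1 _ _ k).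
Qed.

Let mm k : measurable_fun setT (fun x : V => m k (x ord0 i)).
Proof. by apply: measurableT_comp (mcoord i); exact: itg_meas (itg_mk albe k). Qed.

Let mpm k : measurable_fun setT (fun x : V => prim (m k) (x ord0 i)).
Proof. by apply: measurableT_comp (mcoord i); exact: measurable_prim (itg_mk albe k). Qed.

Let bd (c : R) k (x : V) (y : R) : `|y| <= c -> `|bmp k x * y| <= c.
Proof.
move=> yc; have /andP[b0 b1] := bmp_bd k x.
by rewrite normrM ger0_norm// (le_trans _ yc)// ler_piMl.
Qed.

Let itg_hk k : itg gam (hk k).
Proof.
have [L1 H1] := mk_bounded albe.
have [L2 H2] := prim_mk_bounded albe Mal beM M1.
rewrite (funext (hkE k)); apply: itgD.
  apply: (itg_bdd (C := L1)); [exact: measurable_funM|exact: itg_locP|].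
  by move=> x; exact: bd.
apply: (itg_bdd (C := L2)); [exact: measurable_funM|exact: itg_locQ|].
by move=> x; exact: bd.
Qed.

Let Rint_hk k : \int[gam]_x hk k x = 0.
Proof.
have [L2 H2] := prim_mk_bounded albe Mal beM M1.
have ig : itg gam (fun x => g x ord0 i * prodfun (u k) x / gd x).
  rewrite (funext (gpsiE k)); apply: (itg_bdd (C := L2 * c0)).
  - by apply: measurable_funM => //; exact: measurable_funM.
  - exact: itg_locg.
  - move=> x; rewrite normrM ler_pM//; first exact: bd.
    by rewrite ger0_norm ?nphi_ge0.
have E x : hk k x = f x * partial i (prodfun (u k)) x / gd x +
    g x ord0 i * prodfun (u k) x / gd x.
  by rewrite partial_u psiE /hk /wP /wQ; ring.
have iF : itg gam (fun x => f x * partial i (prodfun (u k)) x / gd x).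
  rewrite (_ : (fun x => _) = fun x => hk k x - g x ord0 i * prodfun (u k) x / gd x).
    exact: itgB.
  by apply/funext => x; rewrite E addrK.
rewrite (funext E) RintD//.
have [_ [_ H]] := wg; have := H _ (test_u k) i.
rewrite -!EFin_Rint// -EFinN => -[] ->.
by rewrite addNr.
Qed.

(** Dominated convergence in the weak formulation. The limit has sharp indicators in the other
    coordinates, the form in which [box_ae0] can separate the lines. *)
Lemma testlim_int : itg gam testlim /\ \int[gam]_x testlim x = 0.
Proof.
have [L1 H1] := mk_bounded albe.
have [L2 H2] := prim_mk_bounded albe Mal beM M1.
have cb k x : `|hk k x| <= L1 * `|FP x| + L2 * `|FQ x|.
  rewrite hkE; apply: le_trans (ler_normD _ _) _.
  by apply: lerD; rewrite normrM ler_wpM2r//; exact: bd.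
have idom : itg gam (fun x => L1 * `|FP x| + L2 * `|FQ x|).
  by apply: itgD; apply: itgZ; apply: itg_norm; [exact: itg_locP|exact: itg_locQ].
have mlim : measurable_fun setT testlim.
  apply: measurable_funM; last exact: measurable_invr measurable_gauss_dens.
  apply: measurable_funM.
    apply: measurable_prodR => j; apply: measurable_b2R.
    exact: measurable_itvb.
  apply: measurable_funD; apply: measurable_funM.
  - exact: measurable_wP.
  - by apply: measurableT_comp (mcoord i); exact: itg_meas (itg_tent albe').
  - exact: measurable_wQ.
  - by apply: measurableT_comp (mcoord i); exact: measurable_prim (itg_tent albe').
have [||ih cv] := @cvg_Rint _ _ _ gam hk testlim _ _ mlim _ idom cb.
- by move=> k; exact: itg_meas (itg_hk k).
- apply: ae_W => x; apply: cvgM; last exact: cvg_cst.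
  apply: cvgM.
    rewrite /bmp /cutoff; elim: (index_enum _) => [|j s IH].
      by under eq_fun do rewrite big_nil; rewrite big_nil; exact: cvg_cst.
    under eq_fun do rewrite big_cons.
    rewrite big_cons; case: (j != i) => //.
    by apply: cvgM => //; exact: cvg_bump.
  apply: cvgD; apply: cvgM; try exact: cvg_cst.
    exact: cvg_mk.
  exact: cvg_prim_mk Mal beM M1 _.
split => //.
rewrite -(cvg_lim (@Rhausdorff R) cv).
apply: cvg_lim; first exact: Rhausdorff.
by under eq_fun do rewrite Rint_hk; exact: cvg_cst.
Qed.

End test.

End weak.

(** * Absolute continuity on almost every line *)

Section line_gen.
Context (R : realType) (n : nat).
Local Notation V := 'rV[R]_n.
Local Notation lam := (@lebesgue_measure R).
Local Notation g1 := (@normal_prob R 0 1).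
Variable gam : probability V R.
Hypothesis gamP : is_std_gaussian gam.
Variables (f : V -> R) (g : V -> V).
Variable i : 'I_n.
Local Notation P := (wP f i).
Local Notation Q := (wQ f g i).

(* Vanishes for all al < be exactly when [wP] is a primitive of [wQ] on the line. *)
Definition lineint (al be : R) (x : V) : R :=
  \int[lam]_s (P (upd i (x, s)) * tent al be s + Q (upd i (x, s)) * prim (tent al be) s).

Lemma wP_upd (x : V) (s : R) : P (upd i (x, s)) = f (upd i (x, s)) * nphi s.
Proof. by rewrite /wP updE eqxx. Qed.

Lemma wQ_upd (x : V) (s : R) : Q (upd i (x, s)) =
  (g (upd i (x, s)) ord0 i - upd i (x, s) ord0 i * f (upd i (x, s))) * nphi s.
Proof. by rewrite /wQ !updE eqxx. Qed.

Hypothesis itf : itg gam f.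

Lemma lineP : \forall x \ae gam, itg lam (fun s => P (upd i (x, s))).
Proof.
apply: ae_S (itg_upd_line gamP i itf) => x ix.
by under eq_fun do rewrite wP_upd; apply/itg_g1 => //; exact: itg_meas ix.
Qed.

Hypothesis lineint0 : forall al be, al < be -> \forall x \ae gam, lineint al be x = 0.

(** Each pair of endpoints comes with its own null set. Only countably many can be united, so
    rational pairs are enumerated through [unpickle]. *)
Lemma lineZ : \forall x \ae gam, forall al be : rat, al < be -> lineint (ratr al) (ratr be) x = 0.
Proof.
have : \forall x \ae gam, forall k, forall z : rat * rat, unpickle k = Some z ->
    z.1 < z.2 -> lineint (ratr z.1) (ratr z.2) x = 0.
  apply/ae_foralln => k; case: (unpickle k) => [[al be]|]; last exact: ae_W.
  have [ab|ab] := boolP (al < be).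
    have ab' : ratr al < ratr be :> R by rewrite ltr_rat.
    by apply: ae_S (lineint0 ab') => x H z [<-].
  by apply: ae_W => x z [<-]; rewrite (negbTE ab).
apply: ae_S => x H al be ab.
exact: (H (pickle (al, be)) (al, be) (pickleK _) ab).
Qed.

Hypothesis itgi : itg gam (fun x => g x ord0 i).
Hypothesis itxf : itg gam (fun x : V => x ord0 i * f x).

(** The description of Sobolev functions by absolute continuity on lines. The last two clauses
    together say that [wP] decays at both ends, so later integrations by parts on the line have no
    boundary term. *)
Lemma weak_line : \forall x \ae gam,
  [/\ itg lam (fun s => P (upd i (x, s))),
      itg lam (fun s => Q (upd i (x, s))),
      \forall s \ae lam, P (upd i (x, s)) = prim (fun s => Q (upd i (x, s))) s &
      \int[lam]_s Q (upd i (x, s)) = 0].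
Proof.
have iQ : \forall x \ae gam, itg lam (fun s => Q (upd i (x, s))).
  apply: ae_S (itg_upd_line gamP i (itgB itgi itxf)) => x ix.
  under eq_fun do rewrite wQ_upd.
  by apply/itg_g1 => //; exact: itg_meas ix.
apply: ae_S3 (lineP) iQ lineZ => x ip iq z0.
have [|h1 h2] := @acl_global R _ _ ip iq; last by split.
move=> N N0; apply: acl_line => // al be Nal ab beN.
exact: z0.
Qed.

End line_gen.

Section lines.
Context (R : realType) (n : nat).
Local Notation V := 'rV[R]_n.
Local Notation lam := (@lebesgue_measure R).
Local Notation g1 := (@normal_prob R 0 1).
Variable gam : probability V R.
Hypothesis gamP : is_std_gaussian gam.
Variables (f : V -> R) (g : V -> V).
Hypothesis wg : weak_grad gam f g.
Variable i : 'I_n.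
Local Notation gd := (@gauss_dens R n).
Local Notation P := (wP f i).
Local Notation Q := (wQ f g i).

Let W (x : V) : R := \prod_(j | j != i) nphi (x ord0 j).

Let W_gt0 x : 0 < W x.
Proof. by apply: prodr_gt0 => j _; exact: nphi_gt0. Qed.

Let gd_upd (x : V) (s : R) : gd (upd i (x, s)) = nphi s * W x.
Proof.
rewrite gauss_densE (bigD1 i)//= updE eqxx; congr (_ * _).
by apply: eq_bigr => j /negbTE ji; rewrite updE ji.
Qed.

Let cutoff_upd a b (x : V) (s : R) : cutoff i a b (upd i (x, s)) = cutoff i a b x.
Proof. by apply: eq_bigr => j /negbTE ji; rewrite updE ji. Qed.

Let mpair : measurable_fun setT (fun z : V * measurableTypeR R => upd i (z.1, z.2)).
Proof.
have := @measurable_upd R n i; rewrite (_ : (fun z : V * measurableTypeR R => _) = upd i)//.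
Qed.

Let mP := measurable_wP wg i.
Let mQ := measurable_wQ wg i.

Let measurable_lineint (al be : R) : al <= be -> measurable_fun setT (lineint f g i al be).
Proof.
move=> ab; apply: (@measurable_Rint1 _ _ _ _ R lam
  (fun z => P (upd i (z.1, z.2)) * tent al be z.2 + Q (upd i (z.1, z.2)) * prim (tent al be) z.2)).
apply: measurable_funD; apply: measurable_funM.
- exact: measurableT_comp mP mpair.
- exact: measurableT_comp (itg_meas (itg_tent ab)) measurable_snd.
- exact: measurableT_comp mQ mpair.
- exact: measurableT_comp (measurable_prim (itg_tent ab)) measurable_snd.
Qed.

Let mW : measurable_fun setT W.
Proof.
apply: measurable_prodR => j.
exact: measurableT_comp (@measurable_nphi R) (@measurable_coord R n j).
Qed.

Let testlim_line a b (al be : R) (x : V) : itg g1 (fun s => testlim f g i a b al be (upd i (x, s))) ->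
  \int[g1]_s testlim f g i a b al be (upd i (x, s)) = cutoff i a b x * (lineint f g i al be x / W x).
Proof.
move=> it; have mt := itg_meas it.
rewrite Rint_g1//; have {}it := (itg_g1 mt).1 it.
have E s : testlim f g i a b al be (upd i (x, s)) * nphi s = cutoff i a b x / W x *
    (P (upd i (x, s)) * tent al be s + Q (upd i (x, s)) * prim (tent al be) s).
  rewrite /testlim cutoff_upd gd_upd updE eqxx; field.
  by rewrite !gt_eqF ?W_gt0 ?nphi_gt0.
under eq_Rintegral do rewrite E.
have [c0|c0] := eqVneq (cutoff i a b x) 0.
  rewrite c0 !mul0r; under eq_Rintegral do rewrite mul0r.
  by rewrite /Rintegral integral0.
rewrite RintZ; first by rewrite /lineint; ring.
have := itgZ ((cutoff i a b x / W x)^-1) it.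
under eq_fun do rewrite E mulKf ?mulf_neq0 ?invr_eq0 ?(gt_eqF (W_gt0 x))//.
by [].
Qed.

Let boxE' a b (x : V) : \1_(box a b) x = (a i < x ord0 i < b i)%R%:R * cutoff i a b x :> R.
Proof.
rewrite indicE /cutoff -natr_prod -natrM; congr (_%:R).
transitivity (nat_of_bool ((a i < x ord0 i < b i) && [forall (j | j != i), a j < x ord0 j < b j])).
  congr nat_of_bool; apply/idP/idP => [/set_mem H|/andP[h1 /forall_inP h2]].
    by rewrite H; apply/forall_inP => j _; exact: H.
  by apply/mem_set => j; have [->//|ji] := eqVneq j i; exact: h2.
case: (a i < x ord0 i < b i) => /=; last by rewrite mul0n.
rewrite mul1n; case: forall_inP => [H|H].
  by rewrite big1// => j ji; rewrite H.
have [j ji Hj] : exists2 j, j != i & ~~ (a j < x ord0 j < b j).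
  by apply: contrapT => H'; apply: H => j ji; apply: contrapT => /negP ?; apply: H'; exists j.
by rewrite (bigD1 j)//= (negbTE Hj) mul0n.
Qed.

(** Integrating [testlim] along direction [i] leaves [lineint / W] times the indicator of a box in
    the other coordinates. The missing side of the box only multiplies the integral by a constant,
    because nothing else depends on [x_i]; then [box_ae0] applies. *)
Lemma lineint_eq0 (al be : R) : al < be -> \forall x \ae gam, lineint f g i al be x = 0.
Proof.
move=> albe; have albe' := ltW albe.
have mk : measurable_fun setT (fun x : V => lineint f g i al be x / W x).
  by apply: measurable_funM; [exact: measurable_lineint|exact: measurable_invr].
have key a b : itg gam (fun x : V => \1_(box a b) x * (lineint f g i al be x / W x)) /\
    \int[gam]_x (\1_(box a b) x * (lineint f g i al be x / W x)) = 0.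
  pose S := \sum_j (`|a j| + `|b j|); pose M := 1 + `|al| + `|be| + S.
  have S0 : 0 <= S by apply: sumr_ge0 => j _; rewrite addr_ge0.
  have Sj j : `|a j| + `|b j| <= S.
    by rewrite /S (bigD1 j)//= lerDl; apply: sumr_ge0 => k _; rewrite addr_ge0.
  have nal := normr_ge0 al; have nbe := normr_ge0 be.
  have Mal : - M <= al by have := ler_norm (- al); rewrite normrN /M; lra.
  have beM : be <= M by have := ler_norm be; rewrite /M; lra.
  have M1 : 1 <= M by rewrite /M; lra.
  have abM j : - M <= a j /\ b j <= M.
    have := Sj j; have := ler_norm (- a j); have := ler_norm (b j).
    have := normr_ge0 (a j); have := normr_ge0 (b j).
    by rewrite normrN /M; split; lra.
  have [it t0] := testlim_int wg i albe Mal beM M1 abM.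
  have iZ := itg_upd_Rint gamP i it.
  have iline := itg_upd_line gamP i it.
  set Z1 := (fun x : V => \int[g1]_s _) in iZ.
  have aeE : \forall x \ae gam, \1_(box a b) x * (lineint f g i al be x / W x) =
      (a i < x ord0 i < b i)%R%:R * Z1 x.
    by apply: ae_S iline => x ix; rewrite /Z1 (testlim_line ix) boxE' -!mulrA.
  have mb : measurable_fun setT (fun x : V => a i < x ord0 i < b i).
    by apply: measurable_itvb; exact: measurable_coord.
  have ibZ : itg gam (fun x : V => (a i < x ord0 i < b i)%R%:R * Z1 x) by apply: itg_bool.
  have mbk : measurable_fun setT (fun x : V => \1_(box a b) x * (lineint f g i al be x / W x)).
    by apply: measurable_funM => //; apply: measurable_indic; exact: measurable_box.
  split; first exact: ae_itg mbk ibZ aeE.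
  rewrite (ae_eq_Rint mbk (itg_meas ibZ) aeE) (Rint_upd gamP i ibZ).
  have ig1 : itg g1 (fun s => (a i < s < b i)%R%:R).
    have i1 : itg g1 (fun=> 1 : R) by exact: finite_measure_integrable_cst.
    apply: (itg_le _ i1); first by apply: measurable_b2R; exact: measurable_itvb.
    by move=> s; rewrite ger0_norm// lern1 leq_b1.
  transitivity (\int[gam]_x ((\int[g1]_s (a i < s < b i)%R%:R) * Z1 x)).
    apply: eq_Rintegral => x _.
    under eq_Rintegral => s _.
      rewrite updE eqxx (_ : Z1 (upd i (x, s)) = Z1 x); last first.
        by rewrite /Z1; apply: eq_Rintegral => t _; rewrite upd_upd.
      rewrite mulrC; over.
    by rewrite RintZ// mulrC.
  rewrite RintZ// (_ : \int[gam]_x Z1 x = 0) ?mulr0//.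
  by rewrite /Z1 -(Rint_upd gamP i it).
have := box_ae0 (fun a b => (key a b).1) (fun a b => (key a b).2).
apply: ae_S => x /eqP; rewrite mulf_eq0 invr_eq0 (gt_eqF (W_gt0 x)) orbF.
by move/eqP.
Qed.

Hypothesis itf : itg gam f.
Hypothesis f0 : forall x, 0 <= f x.

Let mupd (x : V) : measurable_fun setT (fun s : measurableTypeR R => upd i (x, s)).
Proof. exact: measurableT_comp (@measurable_upd R n i) (measurable_pair1 x). Qed.

Let lineQ : \forall x \ae gam, forall N : nat,
  itg lam (fun s => (- N%:R <= s <= N%:R)%R%:R * Q (upd i (x, s))).
Proof.
have : \forall x \ae gam, forall N : nat,
    itg g1 (fun s => \1_(ccube N%:R) (upd i (x, s)) * (Q (upd i (x, s)) / gd (upd i (x, s)))).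
  by apply/ae_foralln => N; exact: (itg_upd_line gamP i (itg_locQ wg i N%:R)).
apply: ae_S => x Hx N.
(* The cube must contain the whole segment [[-N, N]] of the line, so it has to exceed the fixed
   coordinates of [x] too. *)
pose N' := maxn N (Num.bound (\sum_j `|x ord0 j|)).
have NN' : N%:R <= N'%:R :> R by rewrite ler_nat leq_maxl.
have xN j : `|x ord0 j| <= N'%:R.
  apply: (@le_trans _ _ (\sum_j `|x ord0 j|)).
    by rewrite (bigD1 j)//= lerDl sumr_ge0.
  apply: le_trans (ltW (archi_boundP _)) _; first by rewrite sumr_ge0.
  by rewrite ler_nat leq_maxr.
have ix := Hx N'; have mx := itg_meas ix.
have {}ix := itgZ (W x) ((itg_g1 mx).1 ix).
have mb : measurable_fun setT (fun s : R => - N%:R <= s <= N%:R).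
  by apply: measurable_and; exact: measurable_fun_ler.
have : itg lam (fun s => (- N%:R <= s <= N%:R)%R%:R * (W x * (\1_(ccube N'%:R) (upd i (x, s)) *
    (Q (upd i (x, s)) / gd (upd i (x, s))) * nphi s))).
  by apply: itg_bool.
rewrite (_ : (fun s => _ * (W x * _)) = (fun s => (- N%:R <= s <= N%:R)%R%:R * Q (upd i (x, s))))//.
apply/funext => s; case: (boolP (- N%:R <= s <= N%:R)) => sN; last by rewrite !mul0r.
rewrite indicE mem_set ?gd_upd.
  by rewrite !mul1r; field; rewrite !gt_eqF ?W_gt0 ?nphi_gt0.
move=> j /=; rewrite in_itv/= -ler_norml updE; case: ifP => // _.
by apply: le_trans NN'; rewrite ler_norml.
Qed.

(** On lines this is [stampacchia]. The global integrability of [g] is itself deduced from this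
    lemma, so only local integrability may be used here; hence the truncations of [wQ] to
    [[-N, N]]. *)
Lemma weak_zero_set : \forall x \ae gam, f x = 0 -> g x ord0 i = 0.
Proof.
have [[mf _] [/(_ i)[mg _] _]] := wg.
have H : \forall x \ae gam, (f x == 0) ==> (g x ord0 i == 0).
  apply: (ae_upd_inv gamP (i := i)).
    rewrite (_ : (fun x => _) = fun x => (f x != 0) || (g x ord0 i == 0)); last first.
      by apply/funext => x; rewrite implybE.
    apply: measurable_or; first by apply: measurable_neg; exact: measurable_fun_eqr.
    exact: measurable_fun_eqr.
  apply: ae_S3 (lineP gamP i itf) lineQ (lineZ lineint_eq0) => x ip iq z0.
  have HN (N : nat) : \forall s \ae lam, - N.+1%:R < s < N.+1%:R -> P (upd i (x, s)) = 0 ->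
      (- N.+1%:R <= s <= N.+1%:R)%R%:R * Q (upd i (x, s)) = 0.
    have [C HC] : exists C, \forall s \ae lam, - N.+1%:R < s < N.+1%:R ->
        P (upd i (x, s)) = C + prim (fun s => (- N.+1%:R <= s <= N.+1%:R)%R%:R * Q (upd i (x, s))) s.
      apply: acl_line => // al be Nal ab beN.
      rewrite -[RHS](z0 _ _ ab); apply: eq_Rintegral => s _; congr (_ + _).
      case: (boolP (- N.+1%:R <= s <= N.+1%:R)) => sN; first by rewrite mul1r.
      have ab' : ratr al <= ratr be :> R by rewrite ler_rat ltW.
      rewrite (@prim_supp R N.+1%:R) ?mulr0//; first exact: itg_tent.
      - exact: Rint_tent.
      - by move=> t; apply: tent_supp => //; rewrite ler1n.
      - by rewrite ltNge ler_norml.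
    apply: stampacchia HC => //.
    by move=> s; rewrite wP_upd mulr_ge0 ?nphi_ge0.
  have {}HN : \forall s \ae lam, forall N, - N.+1%:R < s < N.+1%:R -> P (upd i (x, s)) = 0 ->
      (- N.+1%:R <= s <= N.+1%:R)%R%:R * Q (upd i (x, s)) = 0.
    exact/ae_foralln.
  apply: ae_lam_g1; apply: ae_S HN => s Hs; apply/implyP => /eqP fs.
  have sN : `|s| < (Num.bound `|s|).+1%:R.
    by apply: lt_trans (archi_boundP _) _ => //; rewrite ltr_nat.
  have := Hs (Num.bound `|s|); rewrite -ltr_norml -ler_norml sN (ltW sN).
  rewrite wP_upd fs mul0r mul1r => /(_ isT erefl) /eqP.
  by rewrite /wQ fs mulr0 subr0 mulf_eq0 updE eqxx (gt_eqF (nphi_gt0 s)) orbF.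
by apply: ae_S H => x /implyP H /eqP /H /eqP.
Qed.

End lines.

(** * Averaging out one coordinate *)

Lemma itg_le_ae d (T : measurableType d) (R : realType) (m : {measure set T -> \bar R})
    (h k : T -> R) : measurable_fun setT h -> itg m k ->
  (\forall x \ae m, `|h x| <= k x) -> itg m h.
Proof.
move=> mh ik hk.
have mn : measurable_fun setT (fun x => `|h x|) by exact: measurableT_comp.
have mb : measurable_fun setT (fun x => `|h x| <= k x).
  by apply: measurable_fun_ler => //; exact: itg_meas ik.
apply: (ae_itg (k := fun x => (`|h x| <= k x)%R%:R * h x)) => //.
  apply: (itg_le _ (itg_norm ik)).
    by apply: measurable_funM => //; exact: measurable_b2R.
  move=> x; case: (boolP (`|h x| <= k x)) => [h1|_] /=; last by rewrite mul0r normr0.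
  by rewrite mul1r (le_trans h1)// ler_norm.
by apply: ae_S hk => x ->; rewrite mul1r.
Qed.

Section avg.
Context (R : realType) (n : nat).
Local Notation V := 'rV[R]_n.
Local Notation lam := (@lebesgue_measure R).
Local Notation g1 := (@normal_prob R 0 1).
Implicit Types (h k r : V -> R) (i j : 'I_n).

(** The conditional expectation under [gam] given the other coordinates, kept as a function on the
    full space. *)
Definition avg i h (x : V) : R := \int[g1]_s h (upd i (x, s)).

Definition indep i h := forall (x : V) (s : R), h (upd i (x, s)) = h x.

Lemma avg_upd i h : indep i (avg i h).
Proof. by move=> x s; apply: eq_Rintegral => t _; rewrite upd_upd. Qed.

Lemma avg_indep i j h : indep j h -> indep j (avg i h).
Proof.
have [->|ij] := eqVneq i j; first by move=> _; exact: avg_upd.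
by move=> hj x s; apply: eq_Rintegral => t _; rewrite upd_comm// hj.
Qed.

Lemma indep_coord i j : i != j -> indep j (fun x : V => x ord0 i).
Proof. by move=> ij x s; rewrite updE (negbTE ij). Qed.

Lemma measurable_line h i (x : V) : measurable_fun setT h ->
  measurable_fun setT (fun s : measurableTypeR R => h (upd i (x, s))).
Proof.
move=> mh; apply: (measurableT_comp mh).
exact: measurableT_comp (@measurable_upd R n i) (measurable_pair1 x).
Qed.

Lemma measurable_pairupd i h : measurable_fun setT h ->
  measurable_fun setT (fun z : V * measurableTypeR R => h (upd i (z.1, z.2))).
Proof.
move=> mh; apply: (measurableT_comp mh).
have := @measurable_upd R n i.
by rewrite (_ : (fun z : V * measurableTypeR R => upd i (z.1, z.2)) = upd i).
Qed.

Lemma measurable_avg i h : measurable_fun setT h -> measurable_fun setT (avg i h).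
Proof.
move=> mh; apply: (@measurable_Rint1 _ _ V (measurableTypeR R) R g1
  (fun z => h (upd i (z.1, z.2)))).
exact: measurable_pairupd.
Qed.

Variable gam : probability V R.
Hypothesis gamP : is_std_gaussian gam.

Lemma itg_avg i h : itg gam h -> itg gam (avg i h).
Proof. exact: itg_upd_Rint. Qed.

Lemma Rint_avg i h : itg gam h -> \int[gam]_x avg i h x = \int[gam]_x h x.
Proof. by move=> ih; rewrite (Rint_upd gamP i ih). Qed.

Lemma itg_upd_lines i h r : measurable_fun setT h -> itg gam r ->
  (\forall x \ae gam, itg g1 (fun s => h (upd i (x, s)))) ->
  (\forall x \ae gam, \int[g1]_s `|h (upd i (x, s))| <= r x) -> itg gam h.
Proof.
move=> mh ir H1 H2; apply/(itg_upd gamP i mh).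
apply: (@itg_prod_lines _ _ V (measurableTypeR R) R gam g1 _ r) => //.
by apply: (measurableT_comp mh); exact: measurable_upd.
Qed.

Lemma avg_mul i h k : itg gam h -> itg gam (fun x => h x * k x) ->
  measurable_fun setT k -> indep i k ->
  itg gam (fun x => avg i h x * k x) /\
  \int[gam]_x (avg i h x * k x) = \int[gam]_x (h x * k x).
Proof.
move=> ih ihk mk ik.
have m1 : measurable_fun setT (fun x => avg i h x * k x).
  by apply: measurable_funM => //; exact: itg_meas (itg_avg i ih).
have E : \forall x \ae gam, avg i h x * k x = avg i (fun x => h x * k x) x.
  apply: ae_S (itg_upd_line gamP i ih) => x hx.
  rewrite /avg; under [RHS]eq_Rintegral do rewrite ik mulrC.
  by rewrite RintZ// mulrC.
split; first exact: ae_itg m1 (itg_avg i ihk) E.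
rewrite (ae_eq_Rint m1 (itg_meas (itg_avg i ihk)) E).
exact: Rint_avg.
Qed.

(** Prepares the exchange, in [lineint_avg], of the average over coordinate [l] with the line
    integral over coordinate [i]. *)
Lemma itg_plane i l h : i != l -> itg gam h ->
  \forall x \ae gam, itg (g1 \x lam)%E
    (fun z : measurableTypeR R * measurableTypeR R => h (upd i (upd l (x, z.1), z.2)) * nphi z.2).
Proof.
move=> ik ih; have mh := itg_meas ih.
have mp := measurable_pairupd i mh.
have H0 := itg_upd_line gamP i ih.
have H1 := ae_upd gamP l H0.
have H2 := itg_upd_line gamP l (itg_avg i (itg_norm ih)).
apply: ae_S2 H1 H2 => x Hx ix.
apply: (@itg_prod_lines _ _ (measurableTypeR R) (measurableTypeR R) R g1 lam
   _ (fun u => avg i (fun y => `|h y|) (upd l (x, u)))) => //.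
- apply: measurable_funM; last exact: measurableT_comp (@measurable_nphi R) measurable_snd.
  have mux : measurable_fun setT (fun u : measurableTypeR R => upd l (x, u)).
    exact: measurableT_comp (@measurable_upd R n l) (measurable_pair1 x).
  have mz : measurable_fun setT (fun z : measurableTypeR R * measurableTypeR R => (upd l (x, z.1), z.2)).
    apply/measurable_fun_pairP; split => /=; last exact: measurable_snd.
    exact: measurableT_comp mux measurable_fst.
  exact: measurableT_comp mp mz.
- by apply: ae_S Hx => u iu; apply/itg_g1 => //; exact: itg_meas iu.
- apply: ae_S Hx => u iu; rewrite /avg Rint_g1; last exact: itg_norm iu.
  rewrite le_eqVlt; apply/orP; left; apply/eqP; apply: eq_Rintegral => s _ /=.
  by rewrite normrM [X in _ * X]ger0_norm ?nphi_ge0.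
Qed.

End avg.

Section lineint_avg.
Context (R : realType) (n : nat).
Local Notation V := 'rV[R]_n.
Local Notation lam := (@lebesgue_measure R).
Local Notation g1 := (@normal_prob R 0 1).
Local Notation MR := (measurableTypeR R).
Variable gam : probability V R.
Hypothesis gamP : is_std_gaussian gam.

Definition avgv (l : 'I_n) (g : V -> V) (x : V) : V :=
  \row_j avg l (fun y => g y ord0 j) x.

Let unscale (a : MR -> R) (c : R) : 0 < c -> itg g1 (fun u => a u * c) ->
  itg g1 a /\ \int[g1]_u (a u * c) = (\int[g1]_u a u) * c.
Proof.
move=> c0 iac; have ia : itg g1 a.
  have := itgZ c^-1 iac; congr (itg _ _).
  by apply/funext => u; rewrite mulrC mulfK// gt_eqF.
split => //; rewrite mulrC -RintZ//; apply: eq_Rintegral => u _; exact: mulrC.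
Qed.

(** [lineint] is linear in the pair [(f, g)], so Fubini in the plane of [l] and [i] makes it commute
    with the average over [l]. *)
Lemma lineint_avg (i l : 'I_n) (f : V -> R) (g : V -> V) (al be : R) : i != l ->
  itg gam f -> itg gam (fun x => g x ord0 i) -> itg gam (fun x : V => x ord0 i * f x) ->
  al < be -> (\forall x \ae gam, lineint f g i al be x = 0) ->
  \forall x \ae gam, lineint (avg l f) (avgv l g) i al be x = 0.
Proof.
move=> il itf itgi itxf albe L0; have albe' := ltW albe.
have itt := itg_tent albe'; have mt := itg_meas itt; have mpt := measurable_prim itt.
apply: ae_S3 (ae_upd gamP l L0) (itg_plane gamP il itf)
  (ae_S2 (fun x h1 h2 => conj h1 h2) (itg_plane gamP il itgi) (itg_plane gamP il itxf)).
move=> x {}L0 iA [iB iC].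
pose A (z : MR * MR) := f (upd i (upd l (x, z.1), z.2)) * nphi z.2.
pose B (z : MR * MR) := g (upd i (upd l (x, z.1), z.2)) ord0 i * nphi z.2.
have {}iC : itg (g1 \x lam)%E (fun z => z.2 * A z).
  move: iC; congr (itg _ _); apply/funext => z.
  by rewrite /A updE eqxx mulrA.
have iD : itg (g1 \x lam)%E (fun z => B z - z.2 * A z) by exact: itgB.
pose h2 (z : MR * MR) := tent al be z.2 * A z + prim (tent al be) z.2 * (B z - z.2 * A z).
have ih : itg (g1 \x lam)%E h2.
  apply: itgD.
    apply: (itg_bdd (C := 1 + (be - al))) => //; last by move=> z; exact: tent_le.
    exact: measurableT_comp mt measurable_snd.
  apply: (itg_bdd (C := \int[lam]_s `|tent al be s|)) => //; last by move=> z; exact: prim_abs_le.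
  exact: measurableT_comp mpt measurable_snd.
have S := Rint_swap ih.
have Z : \int[g1]_u \int[lam]_s h2 (u, s) = 0.
  apply: Rint_ae0; first exact: itg_meas (itg_Rint ih).
  apply: ae_S L0 => u <-; apply: eq_Rintegral => s _.
  by rewrite wP_upd wQ_upd updE eqxx /h2 /A /B /=; ring.
rewrite Z in S; rewrite [RHS]S; apply: ae_eq_Rint.
- apply: measurable_funD; apply: measurable_funM => //.
    under eq_fun do rewrite wP_upd.
    apply: measurable_funM; last exact: measurable_nphi.
    by apply: (@measurable_line R n (avg l f) i x); apply: measurable_avg; exact: itg_meas itf.
  under eq_fun do rewrite wQ_upd.
  apply: measurable_funM; last exact: measurable_nphi.
  have mav : measurable_fun setT (avg l f) by apply: measurable_avg; exact: itg_meas itf.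
  have mag : measurable_fun setT (fun y : V => avgv l g y ord0 i).
    under eq_fun do rewrite mxE; by apply: measurable_avg; exact: itg_meas itgi.
  apply: (@measurable_line R n (fun y : V => avgv l g y ord0 i - y ord0 i * avg l f y)).
  apply: measurable_funB => //; apply: measurable_funM => //; exact: measurable_coord.
- exact: itg_meas (itg_Rint (itg_swap ih)).
apply: ae_S2 (itg_line (itg_swap iA)) (itg_line (itg_swap iB)) => s lA lB.
rewrite /= in lA lB.
have [lf EA] := unscale (nphi_gt0 s) lA.
have [lg EB] := unscale (nphi_gt0 s) lB.
have Ef : avg l f (upd i (x, s)) = \int[g1]_u f (upd i (upd l (x, u), s)).
  by apply: eq_Rintegral => u _; rewrite (upd_comm _ _ _ il).
have Eg : avgv l g (upd i (x, s)) ord0 i = \int[g1]_u g (upd i (upd l (x, u), s)) ord0 i.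
  by rewrite mxE; apply: eq_Rintegral => u _; rewrite (upd_comm _ _ _ il).
rewrite /h2 /= RintD; last 2 first.
- by apply: itgZ.
- by apply: itgZ; apply: itgB => //; exact: itgZ.
rewrite RintZ// RintZ; last by apply: itgB => //; exact: itgZ.
rewrite RintB//; last exact: itgZ.
rewrite RintZ// EA EB -Ef -Eg wP_upd wQ_upd updE eqxx; ring.
Qed.

End lineint_avg.

(** Joint convexity of [b^2 / a]: with [A] and [B] the integrals of [a] and [b], integrate
    [(b - (B / A) a)^2 / a >= 0]. If [A = 0], the left side is 0 by the convention on inverses. *)
Lemma fisher_jensen d (T : measurableType d) (R : realType) (m : {measure set T -> \bar R})
    (a b : T -> R) : itg m a -> itg m b -> itg m (fun x => b x ^+ 2 / a x) ->
  (forall x, 0 <= a x) -> (\forall x \ae m, a x = 0 -> b x = 0) ->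
  (\int[m]_x b x) ^+ 2 / \int[m]_x a x <= \int[m]_x (b x ^+ 2 / a x).
Proof.
move=> ia ib ij a0 ab.
set A := \int[m]_x a x; set B := \int[m]_x b x; set J := \int[m]_x _.
have [A0|A0] := eqVneq A 0.
  rewrite A0 invr0 mulr0; apply: Rint_ge0 => x.
  by rewrite mulr_ge0 ?sqr_ge0 ?invr_ge0.
have : 0 <= \int[m]_x (b x ^+ 2 / a x - 2 * (B / A) * b x + (B / A) ^+ 2 * a x).
  apply: Rint_ge0_ae.
    by apply: itgD; [apply: itgB => //|]; exact: itgZ.
  apply: ae_S ab => x abx; have [ax|ax] := eqVneq (a x) 0.
    by rewrite abx// ax invr0 !mulr0 subr0 addr0.
  have ax0 : 0 < a x by rewrite lt_neqAle eq_sym ax a0.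
  rewrite (_ : _ + _ = (b x - B / A * a x) ^+ 2 / a x); last by field; rewrite ax A0.
  by rewrite mulr_ge0 ?sqr_ge0 ?invr_ge0.
rewrite RintD; [|by apply: itgB => //; exact: itgZ|exact: itgZ].
rewrite RintB ?RintZ//; last exact: itgZ.
rewrite -/A -/B -/J => H; rewrite -subr_ge0 (le_trans H)//.
rewrite le_eqVlt; apply/orP; left; apply/eqP; by field; rewrite A0.
Qed.

(** * Marginal densities *)

Section good.
Context (R : realType) (n : nat).
Local Notation V := 'rV[R]_n.
Local Notation g1 := (@normal_prob R 0 1).
Variable gam : probability V R.
Hypothesis gamP : is_std_gaussian gam.

(* f is a density of the first m coordinates; its weak gradient survives the averaging
   only in the integrated form [good_line]. *)
Record good (m : nat) (f : V -> R) (g : V -> V) : Prop := Good {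
  good_ge0 : forall x, 0 <= f x;
  good_itg : itg gam f;
  good_int : \int[gam]_x f x = 1;
  good_indep : forall j : 'I_n, (m <= j)%N -> indep j f;
  good_itgg : forall i : 'I_n, (i < m)%N -> itg gam (fun x => g x ord0 i);
  good_itgx2 : forall i : 'I_n, (i < m)%N -> itg gam (fun x : V => x ord0 i ^+ 2 * f x);
  good_line : forall i : 'I_n, (i < m)%N -> forall al be : R, al < be ->
    \forall x \ae gam, lineint f g i al be x = 0;
  good_zero : forall i : 'I_n, (i < m)%N -> \forall x \ae gam, f x = 0 -> g x ord0 i = 0;
  good_fisher : forall i : 'I_n, (i < m)%N -> itg gam (fun x => g x ord0 i ^+ 2 / f x) }.

Lemma good_itgx m f g (i : 'I_n) : good m f g -> (i < m)%N ->
  itg gam (fun x : V => x ord0 i * f x).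
Proof.
move=> H im; have f0 := good_ge0 H.
apply: (itg_le _ (itgD (good_itgx2 H im) (good_itg H))).
  by apply: measurable_funM; [exact: measurable_coord|exact: itg_meas (good_itg H)].
move=> x; rewrite normrM [X in _ * X]ger0_norm//.
rewrite -{3}[f x]mul1r -mulrDl ler_wpM2r//.
rewrite ler_norml; apply/andP; split; nra.
Qed.

(** Fisher information decreases by [fisher_jensen] on each line. For the zero set: if the average
    of [f >= 0] vanishes, then [f], and with it [g_i], vanishes almost everywhere on the line, so
    the average of [g_i] is 0. *)
Lemma good_avg (l : 'I_n) f g : good l.+1 f g -> good l (avg l f) (avgv l g).
Proof.
move=> H; have f0 := good_ge0 H; have itf := good_itg H; have mf := itg_meas itf.
have lt i : (i < l)%N -> (i < l.+1)%N by exact: ltnW.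
have ne (i : 'I_n) : (i < l)%N -> i != l by move=> il; apply/eqP => E; rewrite E ltnn in il.
split.
- by move=> x; apply: Rint_ge0.
- exact: itg_avg.
- by rewrite Rint_avg// (good_int H).
- move=> j; rewrite leq_eqVlt => /orP[/eqP/val_inj <-|lj]; first exact: avg_upd.
  by apply: avg_indep; exact: good_indep H _ lj.
- move=> i il; under eq_fun do rewrite mxE.
  by apply: itg_avg => //; exact: (good_itgg H (lt _ il)).
- move=> i il; under eq_fun do rewrite mulrC.
  have [//|||//] := avg_mul gamP (i := l) (k := fun x : V => x ord0 i ^+ 2) itf.
  + by under eq_fun do rewrite mulrC; exact: (good_itgx2 H (lt _ il)).
  + by apply: measurable_funX; exact: measurable_coord.
  + by move=> x s; rewrite (indep_coord (ne _ il)).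
- move=> i il al be albe; apply: lineint_avg => //.
  + exact: ne.
  + exact: (good_itgg H (lt _ il)).
  + exact: (good_itgx H (lt _ il)).
  + exact: (good_line H (lt _ il) albe).
- move=> i il; have iil := lt _ il.
  apply: ae_S3 (ae_upd gamP l (good_zero H iil)) (itg_upd_line gamP l itf)
    (itg_upd_line gamP l (good_itgg H iil)) => x z0 lf lg a0.
  rewrite mxE /avg; apply: Rint_ae0; first exact: itg_meas lg.
  by apply: ae_S2 z0 (Rint_eq0 lf (fun=> f0 _) a0) => s; exact.
- move=> i il; have iil := lt _ il.
  apply: (itg_le_ae _ (itg_avg gamP l (good_fisher H iil))).
    apply: measurable_funM.
      apply: measurable_funX; under eq_fun do rewrite mxE.
      by apply: measurable_avg; exact: itg_meas (good_itgg H iil).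
    by apply: measurable_invr; exact: measurable_avg.
  apply: ae_S3 (ae_upd gamP l (good_zero H iil)) (itg_upd_line gamP l itf)
    (ae_S2 (fun x h1 h2 => conj h1 h2) (itg_upd_line gamP l (good_itgg H iil))
       (itg_upd_line gamP l (good_fisher H iil))) => x z0 lf [lg lj].
  rewrite ger0_norm; last by rewrite mulr_ge0 ?sqr_ge0 ?invr_ge0//; apply: Rint_ge0.
  rewrite mxE; exact: (fisher_jensen lf lg lj (fun=> f0 _) z0).
Qed.

End good.

(** * Conditional transport in one coordinate *)

Section normal_moment.
Context (R : realType).
Local Notation lam := (@lebesgue_measure R).
Local Notation g1 := (@normal_prob R 0 1).

(** For [t > 0] the factor [t] cancels the [1/t] of the normalisation: the peak is that of [nphi]
    for all [t], and the total mass is [t]. *)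
Let pdf (t : R) : R -> R := fun s => t * normal_pdf 0 t s.

Let ipdf t : itg lam (pdf t).
Proof. by apply: itgZ; exact: integrable_normal_pdf. Qed.

Let Epdf t : \int[lam]_s pdf t s = t.
Proof.
rewrite RintZ; last exact: integrable_normal_pdf.
by rewrite /Rintegral integral_normal_pdf mulr1.
Qed.

Let pdfE t s : 0 < t -> pdf t s = normal_peak 1 * expR (- s ^+ 2 / (t ^+ 2 *+ 2)).
Proof.
move=> t0; rewrite /pdf normal_pdfE ?gt_eqF// /normal_fun subr0 mulrA; congr (_ * _).
rewrite /normal_peak expr1n mul1r -mulrnAr sqrtrM ?sqr_ge0// sqrtr_sqr gtr0_norm//.
by rewrite invfM mulrA divff ?mul1r// gt_eqF.
Qed.

Let i2 : itg lam (fun s => s ^+ 2 * nphi s).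
Proof.
(* With variance 2 the bound [s^2 e^(-s^2/4) <= 4] makes [4 * pdf t] a majorant. *)
pose t : R := Num.sqrt 2.
have t0 : 0 < t by rewrite sqrtr_gt0.
apply: (itg_le _ (itgZ 4 (ipdf t))).
  by apply: measurable_funM; [exact: measurable_funX|exact: measurable_nphi].
move=> s; rewrite ger0_norm; last by rewrite mulr_ge0 ?sqr_ge0 ?nphi_ge0.
rewrite nphiE pdfE// sqr_sqrtr// mulrCA [leRHS]mulrCA.
apply: ler_wpM2l; first exact: normal_peak_ge0.
have -> : - s ^+ 2 / 2 = - s ^+ 2 / (2 *+ 2) + - (s ^+ 2 / 4) :> R by field.
rewrite expRD mulrCA [leRHS]mulrC ler_wpM2l ?expR_ge0//.
rewrite expRN ler_pdivrMr ?expR_gt0//.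
by have := expR_ge1Dx (s ^+ 2 / 4); lra.
Qed.

Lemma itg_g1_sqr : itg g1 (fun s => s ^+ 2).
Proof. by apply/itg_g1 => //; exact: measurable_funX. Qed.

(* Differentiating the total mass of the N(0, t^2) densities at t = 1, with the
   convexity of exp in place of the derivative. *)
Lemma Rint_g1_sqr : \int[g1]_s s ^+ 2 = 1.
Proof.
rewrite Rint_g1; last exact: itg_g1_sqr.
set m := \int[lam]_s _.
have key t : 0 < t -> 0 <= (t - 1) * (t ^+ 2 - m / 2 * (t + 1)).
  move=> t0.
  have : \int[lam]_s (nphi s - (t ^- 2 - 1) / 2 * (s ^+ 2 * nphi s)) <= \int[lam]_s pdf t s.
    apply: le_Rint => //; first by apply: itgB; [exact: itg_nphi|exact: itgZ].
    move=> s; rewrite nphiE pdfE//.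
    have -> : - s ^+ 2 / (t ^+ 2 *+ 2) = - s ^+ 2 / 2 + - ((t ^- 2 - 1) / 2 * s ^+ 2) :> R.
      by field; rewrite gt_eqF.
    rewrite expRD.
    set a := (t ^- 2 - 1) / 2 * s ^+ 2; set e := expR (- _ / 2).
    have -> : normal_peak 1 * e - (t ^- 2 - 1) / 2 * (s ^+ 2 * (normal_peak 1 * e)) =
       normal_peak 1 * (e * (1 + - a)) by rewrite /a; ring.
    apply: ler_wpM2l; first exact: normal_peak_ge0.
    by apply: ler_wpM2l; [exact: expR_ge0|exact: expR_ge1Dx].
  rewrite RintB; [|exact: itg_nphi|exact: itgZ].
  rewrite RintZ// Rint_nphi Epdf -/m => H.
  have -> : (t - 1) * (t ^+ 2 - m / 2 * (t + 1)) = t ^+ 2 * (t - (1 - (t ^- 2 - 1) / 2 * m)).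
    by field; rewrite gt_eqF.
  by rewrite mulr_ge0 ?sqr_ge0// subr_ge0.
have m0 : 0 <= m by apply: Rint_ge0 => s; rewrite mulr_ge0 ?sqr_ge0 ?nphi_ge0.
(* If [m] were different from 1, [key] would fail at a suitable [t] strictly between 1 and [m]. *)
apply/eqP; rewrite eq_le; apply/andP; split; rewrite leNgt; apply/negP => m1.
  have := key (1 + (m - 1) / (m + 3)).
  have d0 : 0 < (m - 1) / (m + 3) by rewrite divr_gt0//; lra.
  have d1 : (m - 1) / (m + 3) * (m + 3) = m - 1 by rewrite divfK// gt_eqF//; lra.
  move: d0 d1; set d := (m - 1) / (m + 3) => d0 d1 /(_ _).
  have -> : 1 + d - 1 = d by ring.
  rewrite pmulr_rge0//; nra.
have := key ((1 + m) / 2).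
have h0 : 0 < (1 + m) / 2 by lra.
move=> /(_ h0); rewrite nmulr_rge0; last by lra.
nra.
Qed.

End normal_moment.

Section cond_map.
Context (R : realType) (n : nat).
Local Notation V := 'rV[R]_n.
Local Notation lam := (@lebesgue_measure R).
Local Notation g1 := (@normal_prob R 0 1).
Local Notation MR := (measurableTypeR R).
Variables (l : 'I_n) (f : V -> R).

(* Distribution function of coordinate l given the others, under f dgam. *)
Definition cond_cdf (x : V) : R :=
  (\int[lam]_s ((s <= x ord0 l)%R%:R * wP f l (upd l (x, s)))) / avg l f x.

Definition cond_map (x : V) : R := nPsi (cond_cdf x).
Local Notation T := cond_map.

(* Where [cond_map] is differentiable in x_l, this is its derivative. *)
Definition cond_ratio (y : V) := f y * nphi (y ord0 l) / (avg l f y * nphi (T y)).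

Hypothesis mf : measurable_fun setT f.
Hypothesis f0 : forall x, 0 <= f x.

Let mcoord := @measurable_coord R n l.

Let mP : measurable_fun setT (wP f l).
Proof.
apply: measurable_funM => //.
exact: measurableT_comp (@measurable_nphi R) mcoord.
Qed.

Lemma measurable_cond_map : measurable_fun setT T.
Proof.
apply: (measurableT_comp (@measurable_nPsi R)); apply: measurable_funM; last first.
  by apply: measurable_invr; exact: measurable_avg.
apply: (@measurable_Rint1 _ _ V MR R lam
  (fun z => (z.2 <= z.1 ord0 l)%R%:R * wP f l (upd l (z.1, z.2)))).
apply: measurable_funM; last exact: measurable_pairupd.
apply: measurable_b2R; apply: measurable_fun_ler; first exact: measurable_snd.
exact: measurableT_comp mcoord measurable_fst.
Qed.

Lemma measurable_cond_ratio : measurable_fun setT cond_ratio.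
Proof.
apply: measurable_funM; first exact: mP.
apply: measurable_invr; apply: measurable_funM; first exact: measurable_avg.
exact: measurableT_comp (@measurable_nphi R) measurable_cond_map.
Qed.

Lemma indep_cond_map j : j != l -> indep j f -> indep j T.
Proof.
move=> jl fj x s; have lj : l != j by rewrite eq_sym.
rewrite /cond_map; congr (nPsi _); rewrite /cond_cdf (avg_indep l fj) updE (negbTE lj).
suff E t : wP f l (upd l (upd j (x, s), t)) = wP f l (upd l (x, t)).
  by under eq_Rintegral do rewrite E.
by rewrite !wP_upd (upd_comm _ _ _ lj) fj.
Qed.

Section line.
Variable x : V.
Hypothesis lf : itg g1 (fun s => f (upd l (x, s))).
Let c := avg l f x.
Let p (s : R) := c^-1 * wP f l (upd l (x, s)).

Let iP : itg lam (fun s => wP f l (upd l (x, s))).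
Proof. by under eq_fun do rewrite wP_upd; apply/itg_g1 => //; exact: itg_meas lf. Qed.

Let ip : itg lam p. Proof. exact: itgZ. Qed.

Let c0 : 0 <= c. Proof. exact: Rint_ge0. Qed.

Let p0 s : 0 <= p s.
Proof. by rewrite mulr_ge0 ?invr_ge0// wP_upd mulr_ge0 ?nphi_ge0. Qed.

Let cE : \int[lam]_s wP f l (upd l (x, s)) = c.
Proof. by under eq_Rintegral do rewrite wP_upd; rewrite -(Rint_g1 lf). Qed.

Let T_line s : T (upd l (x, s)) = monoT p s.
Proof.
rewrite /T /cond_cdf /monoT avg_upd -/c; congr nPsi.
rewrite mulrC -RintZ; last first.
  by under eq_fun do rewrite updE eqxx upd_upd; exact: itg_le_half.
apply: eq_Rintegral => t _; rewrite updE eqxx upd_upd /p; ring.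
Qed.

Let m_line (h : V -> R) : measurable_fun setT h ->
  measurable_fun setT (fun s : MR => h (upd l (x, s))).
Proof. by move=> mh; exact: measurable_line. Qed.

Let mT := measurable_cond_map.

(** On a line [cond_map] is [monoT] for the density normalised by [c]. If [c = 0], then [f] vanishes
    almost everywhere on the line and both sides are 0. *)
Lemma cond_map_push (k : R -> R) : itg g1 k ->
  itg g1 (fun s => f (upd l (x, s)) * k (T (upd l (x, s)))) /\
  \int[g1]_s (f (upd l (x, s)) * k (T (upd l (x, s)))) = c * \int[g1]_s k s.
Proof.
move=> ik; have mk := itg_meas ik.
have mfk : measurable_fun setT (fun s : MR => f (upd l (x, s)) * k (T (upd l (x, s)))).
  apply: (@m_line (fun y => f y * k (T y))).
  by apply: measurable_funM => //; exact: measurableT_comp mk mT.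
have [cx|cx] := eqVneq c 0.
  have H := Rint_eq0 lf (fun s => f0 _) cx.
  have E : \forall s \ae g1, f (upd l (x, s)) * k (T (upd l (x, s))) = 0 * k s.
    by apply: ae_S H => s ->; rewrite !mul0r.
  split; first by apply: ae_itg E => //; exact: itgZ.
  transitivity (\int[g1]_s (0 * k s)); last by rewrite RintZ// cx.
  by apply: ae_eq_Rint => //; exact: itg_meas (itgZ 0 ik).
have p1 : \int[lam]_s p s = 1 by rewrite RintZ// cE mulVf.
have ikp := (itg_monoT ip p0 p1 mk).2 ik.
have E s : f (upd l (x, s)) * k (T (upd l (x, s))) * nphi s = c * (k (monoT p s) * p s).
  by rewrite T_line /p wP_upd; field.
have ifk : itg g1 (fun s => f (upd l (x, s)) * k (T (upd l (x, s)))).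
  by apply/itg_g1 => //; under eq_fun do rewrite E; exact: itgZ.
split => //; rewrite Rint_g1//; under eq_Rintegral do rewrite E.
by rewrite RintZ// (Rint_monoT ip p0 p1).
Qed.

Variable g : V -> V.
Hypothesis mgl : measurable_fun setT (fun y => g y ord0 l).
Hypothesis iQ : itg lam (fun s => wQ f g l (upd l (x, s))).
Hypothesis PQ : \forall s \ae lam, wP f l (upd l (x, s)) =
  prim (fun s => wQ f g l (upd l (x, s))) s.
Hypothesis Q0 : \int[lam]_s wQ f g l (upd l (x, s)) = 0.
Hypothesis z0 : \forall s \ae g1, f (upd l (x, s)) = 0 -> g (upd l (x, s)) ord0 l = 0.

(** [Rint_transport] on the line for [wP / c] and [wQ / c], rescaled by [c]. When [c = 0], [z0]
    ensures that [wQ] vanishes together with [f]. *)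
Lemma cond_transport :
  itg g1 (fun s => (g (upd l (x, s)) ord0 l - upd l (x, s) ord0 l * f (upd l (x, s))) *
                   T (upd l (x, s))) ->
  itg g1 (fun s => f (upd l (x, s)) * cond_ratio (upd l (x, s))) /\
  \int[g1]_s (f (upd l (x, s)) * cond_ratio (upd l (x, s))) =
  - \int[g1]_s ((g (upd l (x, s)) ord0 l - upd l (x, s) ord0 l * f (upd l (x, s))) *
                   T (upd l (x, s))).
Proof.
move=> iqT.
have mr : measurable_fun setT (fun y => f y * cond_ratio y).
  by apply: measurable_funM => //; exact: measurable_cond_ratio.
have mfr := m_line mr.
have E2 s : (g (upd l (x, s)) ord0 l - upd l (x, s) ord0 l * f (upd l (x, s))) *
    T (upd l (x, s)) * nphi s = wQ f g l (upd l (x, s)) * monoT p s.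
  by rewrite T_line wQ_upd; ring.
have iQT : itg lam (fun s => wQ f g l (upd l (x, s)) * monoT p s).
  by have := (itg_g1 (itg_meas iqT)).1 iqT; under eq_fun do rewrite E2.
rewrite [in RHS]Rint_g1//; under [in RHS]eq_Rintegral do rewrite E2.
have [cx|cx] := eqVneq c 0.
  have H := Rint_eq0 lf (fun s => f0 _) cx.
  have E : \forall s \ae g1, f (upd l (x, s)) * cond_ratio (upd l (x, s)) = 0 * f (upd l (x, s)).
    by apply: ae_S H => s ->; rewrite !mul0r.
  split; first by apply: ae_itg E => //; exact: itgZ.
  transitivity (\int[g1]_s (0 * f (upd l (x, s)))).
    by apply: ae_eq_Rint => //; exact: itg_meas (itgZ 0 lf).
  rewrite RintZ// mul0r Rint_ae0 ?oppr0//.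
    exact: itg_meas iQT.
  apply: ae_S2 (ae_g1_lam H) (ae_g1_lam z0) => s fs /(_ fs) gs.
  by rewrite wQ_upd fs gs mulr0 subr0 !mul0r.
have cp : 0 < c by rewrite lt_neqAle eq_sym cx c0.
have p1 : \int[lam]_s p s = 1 by rewrite RintZ// cE mulVf.
pose q (s : R) := c^-1 * wQ f g l (upd l (x, s)).
have iq : itg lam q by exact: itgZ.
have q0 : \int[lam]_s q s = 0 by rewrite RintZ// Q0 mulr0.
have pq : \forall s \ae lam, p s = prim q s.
  apply: ae_S PQ => s Hs; rewrite /p Hs /prim -RintZ; last exact: itg_le_half.
  by apply: eq_Rintegral => t _; rewrite /q mulrCA.
have pq0 : \forall s \ae lam, p s = 0 -> q s = 0.
  apply: ae_S (ae_g1_lam z0) => s Hs /eqP.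
  rewrite /p /q wP_upd !mulf_eq0 invr_eq0 (negbTE cx) (gt_eqF (nphi_gt0 s)) orbF /= => /eqP fs.
  by rewrite wQ_upd Hs// fs mulr0 subr0 mul0r mulr0.
have iqT' : itg lam (fun s => q s * monoT p s).
  have := itgZ c^-1 iQT; congr (itg _ _); apply/funext => s; rewrite /q; ring.
have [i1 E1] := Rint_transport ip p0 p1 iq q0 pq pq0 iqT'.
have E3 s : f (upd l (x, s)) * cond_ratio (upd l (x, s)) * nphi s =
    c * (p s * (p s / nphi (monoT p s))).
  rewrite /cond_ratio avg_upd -/c T_line updE eqxx /p wP_upd; field.
  by rewrite cx gt_eqF ?nphi_gt0.
have ifr : itg g1 (fun s => f (upd l (x, s)) * cond_ratio (upd l (x, s))).
  by apply/itg_g1 => //; under eq_fun do rewrite E3; exact: itgZ.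
split => //; rewrite Rint_g1//; under eq_Rintegral do rewrite E3.
rewrite RintZ// E1 mulrN -RintZ//; congr (- _); apply: eq_Rintegral => s _.
by rewrite /q; field.
Qed.

End line.
End cond_map.

Section global.
Context (R : realType) (n : nat).
Local Notation V := 'rV[R]_n.
Local Notation lam := (@lebesgue_measure R).
Local Notation g1 := (@normal_prob R 0 1).
Local Notation MR := (measurableTypeR R).
Variable gam : probability V R.
Hypothesis gamP : is_std_gaussian gam.

Lemma avg_mul_itg (l : 'I_n) (h k : V -> R) : itg gam h -> (forall x, 0 <= h x) ->
  measurable_fun setT k -> indep l k -> itg gam (fun x => avg l h x * k x) ->
  itg gam (fun x => h x * k x).
Proof.
move=> ih h0 mk lk iak.
apply: (itg_upd_lines gamP (i := l) _ (itg_norm iak)).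
- by apply: measurable_funM => //; exact: itg_meas ih.
- apply: ae_S (itg_upd_line gamP l ih) => x ix.
  by under eq_fun do rewrite lk mulrC; exact: itgZ.
apply: ae_S (itg_upd_line gamP l ih) => x ix.
under eq_Rintegral do rewrite normrM lk ger0_norm// mulrC.
rewrite RintZ// normrM mulrC ler_wpM2r// /avg.
by rewrite ger0_norm//; apply: Rint_ge0.
Qed.

Section moments.
Variables (m : nat) (f : V -> R) (g : V -> V).
Hypothesis H : good gam m f g.
Variables (i : 'I_n) (T : V -> R).
Hypotheses (im : (i < m)%N) (mT : measurable_fun setT T).
Hypothesis iT : itg gam (fun x => f x * T x ^+ 2).

Let f0 := good_ge0 H.

Lemma itg_gradM : itg gam (fun x => g x ord0 i * T x).
Proof.
apply: (itg_le_ae _ (itgD (good_fisher H im) iT)).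
  by apply: measurable_funM => //; exact: itg_meas (good_itgg H im).
apply: ae_S (good_zero H im) => x z.
have [fx|fx] := eqVneq (f x) 0; first by rewrite z// fx invr0 !(mul0r, mulr0) normr0 addr0.
have fx0 : 0 < f x by rewrite lt_neqAle eq_sym fx f0.
rewrite ler_norml; apply/andP; split; rewrite -subr_ge0.
  rewrite (_ : _ - _ = (g x ord0 i + f x * T x) ^+ 2 / (2 * f x) + (g x ord0 i ^+ 2 / f x + f x * T x ^+ 2) / 2).
    by rewrite addr_ge0// mulr_ge0 ?invr_ge0 ?sqr_ge0 ?mulr_ge0 ?addr_ge0// mulr_ge0 ?sqr_ge0 ?invr_ge0.
  by field.
rewrite (_ : _ - _ = (g x ord0 i - f x * T x) ^+ 2 / (2 * f x) + (g x ord0 i ^+ 2 / f x + f x * T x ^+ 2) / 2).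
  by rewrite addr_ge0// mulr_ge0 ?invr_ge0 ?sqr_ge0 ?mulr_ge0 ?addr_ge0// mulr_ge0 ?sqr_ge0 ?invr_ge0.
by field.
Qed.

(** From [|x_i T| <= x_i^2 + T^2]; the companion [itg_gradM] uses [|g_i T| <= g_i^2 / f + f T^2],
    with [good_zero] covering the points where [f = 0]. *)
Lemma itg_coordM : itg gam (fun x : V => x ord0 i * T x * f x).
Proof.
apply: (itg_le _ (itgD (good_itgx2 H im) iT)).
  apply: measurable_funM; last exact: itg_meas (good_itg H).
  by apply: measurable_funM => //; exact: measurable_coord.
move=> x; rewrite normrM [X in _ * X]ger0_norm// [f x * _]mulrC -mulrDl ler_wpM2r//.
rewrite ler_norml; apply/andP; split; nra.
Qed.

End moments.

Section step.
Variables (l : 'I_n) (f : V -> R) (g : V -> V).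
Hypothesis H : good gam l.+1 f g.
Local Notation T := (cond_map l f).
Local Notation c := (avg l f).
Local Notation rho := (cond_ratio l f).

Let f0 := good_ge0 H.
Let itf := good_itg H.
Let mf := itg_meas itf.
Let mT : measurable_fun setT T := measurable_cond_map l mf.
Let ll : (l < l.+1)%N := ltnSn l.
Let mcoord := @measurable_coord R n l.
Let mc : measurable_fun setT c := measurable_avg l mf.

Lemma itg_cond_map (k : R -> R) : itg g1 k -> itg gam (fun x => f x * k (T x)).
Proof.
move=> ik; have mk := itg_meas ik.
apply: (itg_upd_lines gamP (i := l) _ (itgZ (\int[g1]_s `|k s|) (itg_avg gamP l itf))).
- by apply: measurable_funM => //; exact: measurableT_comp mk mT.
- by apply: ae_S (itg_upd_line gamP l itf) => x ix; exact: (cond_map_push mf f0 ix ik).1.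
apply: ae_S (itg_upd_line gamP l itf) => x ix.
have [_ E] := cond_map_push mf f0 ix (itg_norm ik).
under eq_Rintegral do rewrite normrM ger0_norm//.
by rewrite E mulrC.
Qed.

(** Under [f dgam], [T] is standard Gaussian and independent of the coordinates other than [l],
    which enter through the weight [w]. This is how the product law of the Knothe map builds up. *)
Lemma Rint_cond_map (w : V -> R) (k : R -> R) : measurable_fun setT w ->
  (forall x, `|w x| <= 1) -> indep l w -> itg g1 k ->
  \int[gam]_x (w x * (f x * k (T x))) = \int[gam]_x (w x * c x) * \int[g1]_s k s.
Proof.
move=> mw w1 lw ik; have ifk := itg_cond_map ik.
have iw : itg gam (fun x => w x * (f x * k (T x))) by exact: itg_bdd w1.
have iwc : itg gam (fun x => w x * c x) by apply: itg_bdd w1 => //; exact: itg_avg.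
rewrite (Rint_upd gamP l iw) mulrC -RintZ//.
apply: ae_eq_Rint.
- exact: itg_meas (itg_upd_Rint gamP l iw).
- exact: itg_meas (itgZ _ iwc).
apply: ae_S (itg_upd_line gamP l itf) => x ix.
have [i2 E] := cond_map_push mf f0 ix ik.
under eq_Rintegral do rewrite lw.
by rewrite RintZ// E; ring.
Qed.

Lemma cond_map_sqr : itg gam (fun x => f x * T x ^+ 2) /\ \int[gam]_x (f x * T x ^+ 2) = 1.
Proof.
have ik := @itg_g1_sqr R.
split; first exact: itg_cond_map ik.
have m1 : measurable_fun setT (fun _ : V => 1 : R) by exact: measurable_cst.
have b1 (x : V) : `|1 : R| <= 1 by rewrite normr1.
have l1 : indep l (fun _ : V => 1 : R) by [].
have := Rint_cond_map m1 b1 l1 ik.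
rewrite Rint_g1_sqr mulr1.
under eq_Rintegral do rewrite mul1r.
under [in X in _ = X -> _]eq_Rintegral do rewrite mul1r.
by move=> ->; rewrite Rint_avg// (good_int H).
Qed.

Let iT := cond_map_sqr.1.

Lemma cond_ratio_int : itg gam (fun x => f x * rho x) /\
  \int[gam]_x (f x * rho x) =
  \int[gam]_x (x ord0 l * T x * f x) - \int[gam]_x (g x ord0 l * T x).
Proof.
have igT := itg_gradM H ll mT iT.
have ixT := itg_coordM H ll mT iT.
have iD : itg gam (fun x : V => (g x ord0 l - x ord0 l * f x) * T x).
  have := itgB igT ixT; congr (itg _ _); apply/funext => x; ring.
have mgl := itg_meas (good_itgg H ll).
have mr : measurable_fun setT (fun y => f y * rho y).
  by apply: measurable_funM => //; exact: measurable_cond_ratio.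
have rho0 y : 0 <= f y * rho y.
  rewrite mulr_ge0// mulr_ge0 ?invr_ge0 ?mulr_ge0 ?nphi_ge0//.
  by apply: Rint_ge0.
have W := weak_line gamP itf (fun al be => good_line H ll (al := al) (be := be))
  (good_itgg H ll) (good_itgx H ll).
have key : \forall x \ae gam, itg g1 (fun s => f (upd l (x, s)) * rho (upd l (x, s))) /\
    \int[g1]_s (f (upd l (x, s)) * rho (upd l (x, s))) =
    - \int[g1]_s ((g (upd l (x, s)) ord0 l - upd l (x, s) ord0 l * f (upd l (x, s))) * T (upd l (x, s))).
  apply: ae_S3 W (itg_upd_line gamP l itf)
    (ae_S2 (fun x h1 h2 => conj h1 h2) (itg_upd_line gamP l iD) (ae_upd gamP l (good_zero H ll))).
  by move=> x [h1 h2 h3 h4] h5 [h6 h7]; apply: cond_transport.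
have iN := itgN (itg_upd_Rint gamP l iD).
(* As [f * rho] is nonnegative, the line identity of [key] also gives its norm on the line, so
   integrability and value come together. *)
have ir : itg gam (fun x => f x * rho x).
  apply: (itg_upd_lines gamP (i := l) mr iN); first by apply: ae_S key => x [].
  apply: ae_S key => x [_ <-].
  by under eq_Rintegral do rewrite ger0_norm//.
split => //.
rewrite (Rint_upd gamP l ir).
transitivity (\int[gam]_x (- \int[g1]_s ((g (upd l (x, s)) ord0 l - upd l (x, s) ord0 l * f (upd l (x, s))) * T (upd l (x, s))))).
  apply: ae_eq_Rint; [exact: itg_meas (itg_upd_Rint gamP l ir)|exact: itg_meas iN|].
  by apply: ae_S key => x [].
rewrite RintN; last exact: (itg_upd_Rint gamP l iD).
rewrite -(Rint_upd gamP l iD).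
rewrite -[RHS]opprB -RintB//.
suff E x : (g x ord0 l - x ord0 l * f x) * T x = g x ord0 l * T x - x ord0 l * T x * f x.
  by under eq_Rintegral do rewrite E.
ring.
Qed.

(** By definition of [rho] and of the Gaussian density, [ln (rho x) = ln (f x) - ln (c x) - x_l^2 /
    2 + T^2 / 2]; the bound is [ln y <= y - 1] at [y = rho x]. *)
Lemma cond_log : \forall x \ae gam, 0 < f x -> 0 < c x /\
  ln (f x) <= ln (c x) + (rho x - 1 + x ord0 l ^+ 2 / 2 - T x ^+ 2 / 2).
Proof.
have c0 x : 0 <= c x by apply: Rint_ge0.
have pos : \forall x \ae gam, (f x <= 0) || (0 < c x).
  apply: (ae_upd_inv gamP (i := l)).
    by apply: measurable_or; [exact: measurable_fun_ler|exact: measurable_fun_ltr].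
  apply: ae_S (itg_upd_line gamP l itf) => x ix.
  have [cx|cx] := eqVneq (c x) 0.
    by apply: ae_S (Rint_eq0 ix (fun=> f0 _) cx) => s ->; rewrite lexx.
  by apply: ae_W => s; rewrite avg_upd lt_neqAle eq_sym cx c0 orbT.
apply: ae_S pos => x /orP[fx fx'|cx fx]; first by move: fx'; rewrite ltNge fx.
split => //.
have p0 : 0 < normal_peak 1 :> R by rewrite normal_peak_gt0// oner_neq0.
have r0 : 0 < rho x by rewrite /cond_ratio divr_gt0 ?mulr_gt0 ?nphi_gt0.
have : ln (rho x) <= rho x - 1 by have := @le_ln1Dx R (rho x - 1); rewrite [1 + _]addrC subrK; apply; lra.
rewrite {1}/cond_ratio ln_div ?posrE ?mulr_gt0 ?nphi_gt0// !lnM ?posrE ?nphi_gt0//.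
rewrite !nphiE !lnM ?posrE ?expR_gt0// !expRK; lra.
Qed.

End step.
End global.

(** * The Knothe map *)

Lemma bigop_ltS (R : Type) (idx : R) (op : Monoid.com_law idx) (n : nat) (l : 'I_n) (F : 'I_n -> R) :
  \big[op/idx]_(i < n | (i < l.+1)%N) F i = op (F l) (\big[op/idx]_(i < n | (i < l)%N) F i).
Proof.
rewrite (bigD1 l)//=; congr (op _ _); apply: eq_bigl => i.
by rewrite ltnS [RHS]ltn_neqAle andbC.
Qed.

Section knothe.
Context (R : realType) (n : nat).
Local Notation V := 'rV[R]_n.
Local Notation g1 := (@normal_prob R 0 1).
Local Notation MR := (measurableTypeR R).
Variable gam : probability V R.
Hypothesis gamP : is_std_gaussian gam.

(** The coordinates of [x] are overwritten by those of [y] one at a time. *)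
Lemma indep_const (f : V -> R) : (forall j, indep j f) -> forall x y, f x = f y.
Proof.
move=> H x y; pose z s := foldr (fun j z => upd j (z, y ord0 j)) x s : V.
have zE s j : z s ord0 j = if j \in s then y ord0 j else x ord0 j.
  elim: s => [//|k s IH]; rewrite /z /= -/(z s) updE inE.
  by case: eqVneq => [->|].
have fz s : f (z s) = f x by elim: s => [//|k s IH]; rewrite /z /= -/(z s) H.
rewrite -(fz (enum 'I_n)); suff -> : z (enum 'I_n) = y by [].
by apply/rowP => j; rewrite zE mem_enum.
Qed.

(* h dominates ln f and, unlike ln f, has an integral computed by parts. *)
Record knothe (m : nat) (f : V -> R) (g : V -> V) (T : 'I_n -> V -> R) (h : V -> R) : Prop :=
 Knothe {
  knothe_measT : forall i, measurable_fun setT (T i);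
  knothe_meas : measurable_fun setT h;
  knothe_indepT : forall i j : 'I_n, (m <= j)%N -> indep j (T i);
  knothe_indep : forall j : 'I_n, (m <= j)%N -> indep j h;
  knothe_push : forall A : 'I_n -> set R, (forall i, measurable (A i)) ->
    \int[gam]_x ((\prod_(i < n | (i < m)%N) \1_(A i) (T i x)) * f x) =
    \prod_(i < n | (i < m)%N) fine (g1 (A i));
  knothe_sqr : forall i : 'I_n, (i < m)%N -> itg gam (fun x => f x * T i x ^+ 2) /\
    \int[gam]_x (f x * T i x ^+ 2) = 1;
  knothe_ln : \forall x \ae gam, 0 < f x -> ln (f x) <= h x;
  knothe_itg : itg gam (fun x => f x * h x);
  knothe_int : \int[gam]_x (f x * h x) = \sum_(i < n | (i < m)%N)
    (\int[gam]_x (x ord0 i * T i x * f x) - \int[gam]_x (g x ord0 i * T i x) +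
     (\int[gam]_x (x ord0 i ^+ 2 * f x)) / 2 - 3 / 2) }.

Lemma knothe0 f g : good gam 0 f g -> knothe 0 f g (fun=> cst 0) (cst 0).
Proof.
move=> H; have fc x : f x = 1.
  rewrite -(good_int H); transitivity (\int[gam]_y (f x * 1)).
    rewrite RintZ; last exact: finite_measure_integrable_cst.
    rewrite /Rintegral integral_cst// mul1e.
    exact: (esym (etrans (congr1 (fun u => f x * fine u) (probability_setT gam)) (mulr1 _))).
  by apply: eq_Rintegral => y _; rewrite mulr1; apply: indep_const => j; exact: good_indep H _ _.
have if0 : itg gam (fun x => f x * cst 0 x).
  by have := itgZ 0 (good_itg H); congr (itg _ _); apply/funext => x; rewrite mul0r mulr0.
split => //.
- move=> A mA; rewrite [RHS]big_pred0// -[RHS](good_int H).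
  by apply: eq_Rintegral => x _; rewrite big_pred0// mul1r.
- by apply: ae_W => x _; rewrite fc ln1.
- rewrite big_pred0//; apply: Rint_ae0; first exact: itg_meas if0.
  by apply: ae_W => x; rewrite mulr0.
Qed.

Let Rint_ind (A : set R) : measurable A -> itg g1 (\1_A : R -> R) /\
  \int[g1]_s \1_A s = fine (g1 A).
Proof.
move=> mA; have mA' : measurable (A : set MR) by [].
split; last by rewrite /Rintegral integral_indic ?setIT.
apply: itg_ge0P.
- by apply: measurable_indic.
- by move=> x; rewrite indicE.
rewrite integral_indic ?setIT//; apply/esym/fineK.
exact: fin_num_measure.
Qed.

(** [cond_log] extends the bound for the marginal by one coordinate. The earlier components ignore
    coordinate [l], so by [avg_mul] their moments against [f] and against its average are the
    same. *)
Lemma knotheS (l : 'I_n) f g T h : good gam l.+1 f g ->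
  knothe l (avg l f) (avgv l g) T h ->
  knothe l.+1 f g (fun i => if i == l then cond_map l f else T i)
    (fun x => h x + (cond_ratio l f x - 1 + x ord0 l ^+ 2 / 2 - cond_map l f x ^+ 2 / 2)).
Proof.
move=> H K; have f0 := good_ge0 H; have itf := good_itg H; have mf := itg_meas itf.
have mS : measurable_fun setT (cond_map l f) by exact: measurable_cond_map.
have mT := knothe_measT K; have mh := knothe_meas K.
have mcoord := @measurable_coord R n l.
have lT i : indep l (T i) by exact: knothe_indepT K _ _ _.
have lh : indep l h by exact: knothe_indep K _ _.
have ne (i : 'I_n) : (i < l)%N -> (i == l) = false.
  by move=> il; apply/eqP => E; rewrite E ltnn in il.
have lj (j : 'I_n) : (l < j)%N -> j != l.
  by move=> ij; apply/eqP => E; rewrite E ltnn in ij.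
have [iS2 S2] := cond_map_sqr gamP H.
have [ir rE] := cond_ratio_int gamP H.
have mrho : measurable_fun setT (cond_ratio l f) by exact: measurable_cond_ratio.
have iT2 (i : 'I_n) : (i < l)%N -> itg gam (fun x => f x * T i x ^+ 2) /\
    \int[gam]_x (f x * T i x ^+ 2) = 1.
  move=> il; have [i1 e1] := knothe_sqr K il.
  have mT2 : measurable_fun setT (fun x => T i x ^+ 2) by exact: measurable_funX.
  have lT2 : indep l (fun x => T i x ^+ 2) by move=> x s; rewrite lT.
  have i2 := avg_mul_itg gamP itf f0 mT2 lT2 i1.
  by split => //; rewrite -e1; have [_ ->] := avg_mul gamP itf i2 mT2 lT2.
have ih := avg_mul_itg gamP itf f0 mh lh (knothe_itg K).
have ix2 := good_itgx2 H (ltnSn l).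
have iE : itg gam (fun x : V => f x * cond_ratio l f x - f x + 2^-1 * (x ord0 l ^+ 2 * f x)
     - 2^-1 * (f x * cond_map l f x ^+ 2)).
  apply: itgB; last exact: itgZ.
  by apply: itgD; [exact: itgB|exact: itgZ].
have EE x : f x * (h x + (cond_ratio l f x - 1 + x ord0 l ^+ 2 / 2 - cond_map l f x ^+ 2 / 2)) =
   f x * h x + (f x * cond_ratio l f x - f x + 2^-1 * (x ord0 l ^+ 2 * f x)
     - 2^-1 * (f x * cond_map l f x ^+ 2)) by field.
split.
- by move=> i; case: ifP.
- apply: measurable_funD => //; apply: measurable_funB; last first.
    by apply: measurable_funM => //; exact: measurable_funX.
  apply: measurable_funD; first exact: measurable_funB.
  by apply: measurable_funM => //; exact: measurable_funX.
- move=> i j ij; case: ifP => _.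
    by apply: indep_cond_map; [exact: lj|exact: good_indep H _ ij].
  exact: knothe_indepT K _ _ (ltnW ij).
- move=> j ij x s.
  have fj := good_indep H ij.
  have lj' : l != j by rewrite eq_sym; exact: lj.
  have Tj := indep_cond_map (lj _ ij) fj.
  rewrite (knothe_indep K (ltnW ij)) /cond_ratio fj Tj (avg_indep l fj).
  by rewrite updE (negbTE lj').
- move=> A mA; rewrite [RHS]bigop_ltS.
  pose w x := \prod_(i < n | (i < l)%N) \1_(A i) (T i x) : R.
  have mw : measurable_fun setT w.
    apply: measurable_prodR => i; apply: measurableT_comp => //.
  have w1 x : `|w x| <= 1.
    rewrite ger0_norm; last by apply: prodr_ge0 => i _; rewrite indicE.
    by apply: prodr_ile1 => i _; rewrite indicE; case: (_ \in _); rewrite ?lexx ?ler01.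
  have lw : indep l w by move=> x s; apply: eq_bigr => i _; rewrite lT.
  have [i1 E1] := Rint_ind (mA l).
  have := Rint_cond_map gamP H mw w1 lw i1.
  rewrite E1 (knothe_push K mA) mulrC => E; apply: etrans E.
  apply: eq_Rintegral => x _; rewrite bigop_ltS eqxx /=.
  rewrite (_ : \prod_(i < n | _) _ = w x); first by ring.
  by apply: eq_bigr => i il; rewrite ne.
- move=> i; rewrite ltnS leq_eqVlt => /orP[/eqP/val_inj ->|il]; first by rewrite eqxx.
  by rewrite ne//; exact: iT2.
- have lf0 := knothe_ln K.
  have {}lf0 : \forall x \ae gam, (avg l f x <= 0) || (ln (avg l f x) <= h x).
    by apply: ae_S lf0 => x; case: leP => //= _; exact.
  apply: ae_S2 lf0 (cond_log gamP H) => x h1 h2 fx; have [cx h3] := h2 fx.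
  apply: le_trans h3 _; rewrite lerD2r.
  by case/orP: h1 => //; rewrite leNgt cx.
- by under eq_fun do rewrite EE; exact: itgD.
- under eq_Rintegral do rewrite EE.
  rewrite RintD// [RHS]bigop_ltS eqxx addrC; congr (_ + _).
    rewrite RintB; [|by apply: itgD; [exact: itgB|exact: itgZ]|exact: itgZ].
    rewrite RintD; [|exact: itgB|exact: itgZ].
    by rewrite RintB// !RintZ// rE (good_int H) S2; field.
  rewrite -(avg_mul gamP itf ih mh lh).2 (knothe_int K).
  apply: eq_bigr => i il; rewrite ne//.
  have iil : (i < l.+1)%N by exact: ltnW.
  have il' : i != l by rewrite ne.
  have ig := itg_gradM H iil (mT i) (iT2 _ il).1.
  have ix := itg_coordM H iil (mT i) (iT2 _ il).1.
  have ixx := good_itgx2 H iil.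
  have mci := @measurable_coord R n i.
  have lci := @indep_coord R n _ _ il'.
  have e1 : \int[gam]_x (avgv l g x ord0 i * T i x) = \int[gam]_x (g x ord0 i * T i x).
    have [_ <-] := avg_mul gamP (good_itgg H iil) ig (mT i) (lT i).
    by under eq_Rintegral do rewrite mxE.
  have e2 : \int[gam]_x (x ord0 i * T i x * avg l f x) = \int[gam]_x (x ord0 i * T i x * f x).
    under eq_Rintegral do rewrite mulrC; under [RHS]eq_Rintegral do rewrite mulrC.
    apply: (avg_mul gamP itf _ _ _).2.
    - by move: ix; congr (itg _ _); apply/funext => x; rewrite mulrC.
    - exact: measurable_funM.
    - by move=> x s; rewrite lT lci.
  have e3 : \int[gam]_x (x ord0 i ^+ 2 * avg l f x) = \int[gam]_x (x ord0 i ^+ 2 * f x).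
    under eq_Rintegral do rewrite mulrC; under [RHS]eq_Rintegral do rewrite mulrC.
    apply: (avg_mul gamP itf _ _ _).2.
    - by move: ixx; congr (itg _ _); apply/funext => x; rewrite mulrC.
    - exact: measurable_funX.
    - by move=> x s; rewrite lci.
  by rewrite e1 e2 e3.
Qed.

Lemma knothe_exists m f g : (m <= n)%N -> good gam m f g -> exists T h, knothe m f g T h.
Proof.
elim: m f g => [|m IH] f g mn H; first by do 2 eexists; exact: knothe0 H.
pose l : 'I_n := Ordinal mn.
have [T [h K]] := IH _ _ (ltnW mn) (@good_avg R n gam gamP l f g H).
by do 2 eexists; exact: (knotheS (l := l) H K).
Qed.

End knothe.

(** * Lower bound on the deficit *)

Section deficit.
Context (R : realType) (n : nat).
Local Notation V := 'rV[R]_n.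
Local Notation lam := (@lebesgue_measure R).
Local Notation g1 := (@normal_prob R 0 1).
Variables (gam mu : probability V R) (f : V -> R) (g : V -> V).
Hypothesis gamP : is_std_gaussian gam.
Hypothesis fP : is_density gam mu f.

Let mf : measurable_fun setT f. Proof. by case: fP. Qed.
Let f0 x : 0 <= f x. Proof. by case: fP => _ []. Qed.
Let muE A : measurable A -> mu A = (\int[gam]_(x in A) (f x)%:E)%E.
Proof. by case: fP => _ [_]; exact. Qed.

Lemma itg_mu (k : V -> R) : measurable_fun setT k -> itg mu k <-> itg gam (fun x => k x * f x).
Proof.
move=> mk.
have := @itg_density _ V R mu gam f.
by apply=> //; exact: muE.
Qed.

Lemma Rint_mu (k : V -> R) : itg mu k -> \int[mu]_x k x = \int[gam]_x (k x * f x).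
Proof.
move=> ik.
have := @Rint_density _ V R mu gam f.
by apply=> //; exact: muE.
Qed.

Lemma density_itg : itg gam f /\ \int[gam]_x f x = 1.
Proof.
have E : (\int[gam]_x (f x)%:E = 1%:E)%E.
  by rewrite -(muE measurableT) probability_setT.
split; first exact: itg_ge0P E.
by rewrite /Rintegral E.
Qed.

Lemma ae_mu (P : V -> Prop) : (\forall x \ae gam, 0 < f x -> P x) -> \forall x \ae mu, P x.
Proof.
move=> [N [mN N0 sub]].
have mz : measurable [set x : V | f x <= 0].
  by rewrite -[X in measurable X]setTI; exact: measurable_fun_ler.
exists (N `|` [set x | f x <= 0]); split; first exact: measurableU.
  have H1 : mu N = 0%E.
    rewrite muE//; apply: null_set_integral => //.
    by apply/measurable_EFinP; exact: measurable_funTS.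
  have H2 : mu [set x : V | f x <= 0] = 0%E.
    rewrite muE//; apply: integral0_eq => x /= fx.
    by congr (_%:E); apply/eqP; rewrite eq_le fx f0.
  apply/eqP; rewrite -measure_le0; apply: le_trans (measureU2 _ mN mz) _.
  by rewrite [X in (X + _)%E]H1 [X in (_ + X)%E]H2 adde0.
move=> x /= Px; have [fx|fx] := leP (f x) 0; [by right|left; apply: sub => /= H].
by apply: Px; exact: H.
Qed.

Hypothesis m2f : (\int[mu]_x (sqnorm x)%:E < +oo)%E.

Let mcoord i := @measurable_coord R n i.

Let sqn0 (x : V) : 0 <= sqnorm x.
Proof. by apply: sumr_ge0 => i _; rewrite -expr2 sqr_ge0. Qed.

Let sqn_le i (x : V) : x ord0 i ^+ 2 <= sqnorm x.
Proof.
rewrite /sqnorm /dotv (bigD1 i)//= expr2 lerDl.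
by apply: sumr_ge0 => j _; rewrite -expr2 sqr_ge0.
Qed.

Lemma itg_mu_sqr i : itg mu (fun x : V => x ord0 i ^+ 2).
Proof.
have mx : measurable_fun setT (fun x : V => x ord0 i ^+ 2) by exact: measurable_funX.
apply: itgP => //; apply: le_lt_trans m2f.
apply: ge0_le_integral => //.
- by apply/measurable_EFinP; exact: measurableT_comp.
- apply/measurable_EFinP; rewrite /sqnorm /dotv.
  by apply: measurable_sum => j; exact: measurable_funM.
- by move=> x _; rewrite lee_fin ger0_norm ?sqr_ge0.
Qed.

Hypothesis wg : weak_grad gam f g.
Hypothesis fi : (fisher_info mu f g < +oo)%E.

Let mg i : measurable_fun setT (fun x => g x ord0 i).
Proof. by case: wg => _ [/(_ i)[]]. Qed.

Let mvi i : measurable_fun setT (fun x => (g x ord0 i / f x) ^+ 2).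
Proof. by apply: measurable_funX; apply: measurable_funM => //; exact: measurable_invr. Qed.

Let sqn_scale x : sqnorm ((f x)^-1 *: g x) = \sum_i (g x ord0 i / f x) ^+ 2.
Proof. by apply: eq_bigr => i _; rewrite !mxE; ring. Qed.

Lemma itg_mu_grad i : itg mu (fun x => (g x ord0 i / f x) ^+ 2).
Proof.
apply: itgP => //; apply: le_lt_trans fi.
apply: ge0_le_integral => //.
- by apply/measurable_EFinP; exact: measurableT_comp.
- apply/measurable_EFinP; rewrite (funext sqn_scale).
  by apply: measurable_sum.
- move=> x _; rewrite lee_fin ger0_norm ?sqr_ge0// sqn_scale (bigD1 i)//= lerDl.
  by apply: sumr_ge0 => j _; rewrite sqr_ge0.
Qed.

Let gradE i x : (g x ord0 i / f x) ^+ 2 * f x = g x ord0 i ^+ 2 / f x.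
Proof.
have [->|fx] := eqVneq (f x) 0; first by rewrite invr0 !mulr0.
by field.
Qed.

Lemma fisherE : fisher_info mu f g = (\sum_i \int[gam]_x (g x ord0 i ^+ 2 / f x))%:E.
Proof.
rewrite /fisher_info.
under eq_integral do rewrite sqn_scale.
have -> : (\int[mu]_x (\sum_i (g x ord0 i / f x) ^+ 2)%:E =
   \int[mu]_x \sum_i ((g x ord0 i / f x) ^+ 2)%:E)%E.
  by apply: eq_integral => x _; rewrite sumEFin.
rewrite ge0_integral_sum//; last 2 first.
- by move=> i; apply/measurable_EFinP.
- by move=> i x _; rewrite lee_fin sqr_ge0.
rewrite -sumEFin; apply: eq_bigr => i _.
rewrite -EFin_Rint; last exact: itg_mu_grad.
rewrite Rint_mu; last exact: itg_mu_grad.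
by congr (_%:E); apply: eq_Rintegral => x _; rewrite gradE.
Qed.

Lemma good_density : good gam n f g.
Proof.
have [itf int1] := density_itg.
have ifi i : itg gam (fun x => g x ord0 i ^+ 2 / f x).
  have := (itg_mu (mvi i)).1 (itg_mu_grad i).
  by congr (itg _ _); apply/funext => x; rewrite gradE.
have z i : \forall x \ae gam, f x = 0 -> g x ord0 i = 0 by exact: weak_zero_set.
split => //.
- by move=> j; rewrite leqNgt ltn_ord.
(* [|g_i| <= g_i^2 / f + f] where [f > 0], and [weak_zero_set] covers the rest. *)
- move=> i _; apply: (itg_le_ae _ (itgD (ifi i) itf)) => //.
  apply: ae_S (z i) => x zx; have [fx|fx] := eqVneq (f x) 0.
    by rewrite zx// fx normr0 invr0 mulr0 addr0.
  have fx0 : 0 < f x by rewrite lt_neqAle eq_sym fx f0.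
  rewrite -(ler_pM2r fx0) mulrDl divfK// -[X in _ * X <= _]ger0_norm// -normrM.
  by rewrite ler_norml; apply/andP; split; nra.
- by move=> i _; apply/itg_mu; [exact: measurable_funX|exact: itg_mu_sqr].
- by move=> i _ al be albe; exact: lineint_eq0.
Qed.

(* Integration by parts against the coordinate itself: on each line the layer
   integral of [wQ] is its primitive [wP]. *)
Lemma Rint_gradX i : itg gam (fun x : V => g x ord0 i * x ord0 i) /\
  \int[gam]_x (g x ord0 i * x ord0 i) = \int[gam]_x (x ord0 i ^+ 2 * f x) - 1.
Proof.
have H := good_density; have [itf int1] := density_itg.
have ii := ltn_ord i; have ix2 := good_itgx2 H ii.
have igx : itg gam (fun x : V => g x ord0 i * x ord0 i).
  apply: (itg_gradM H ii (mcoord i)).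
  by under eq_fun do rewrite mulrC.
split => //.
have iD : itg gam (fun x : V => (g x ord0 i - x ord0 i * f x) * x ord0 i).
  by have := itgB igx ix2; congr (itg _ _); apply/funext => x; ring.
have W := weak_line gamP itf (fun al be => good_line H ii (al := al) (be := be))
  (good_itgg H ii) (good_itgx H ii).
have key : \forall x \ae gam, \int[g1]_s f (upd i (x, s)) =
    - \int[g1]_s ((g (upd i (x, s)) ord0 i - upd i (x, s) ord0 i * f (upd i (x, s))) * upd i (x, s) ord0 i).
  apply: ae_S3 W (itg_upd_line gamP i itf) (itg_upd_line gamP i iD).
  move=> x [iP iQ PQ Q0] lf lD.
  have E s : (g (upd i (x, s)) ord0 i - upd i (x, s) ord0 i * f (upd i (x, s))) *
      upd i (x, s) ord0 i * nphi s = wQ f g i (upd i (x, s)) * s.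
    by rewrite wQ_upd updE eqxx; ring.
  have iQs : itg lam (fun s => wQ f g i (upd i (x, s)) * s).
    by have := (itg_g1 (itg_meas lD)).1 lD; under eq_fun do rewrite E.
  have [|iL EL] := Rint_layer (tau := id) iQ _ Q0 iQs; first by [].
  rewrite !Rint_g1//; under [in RHS]eq_Rintegral do rewrite E.
  rewrite -EL; under eq_Rintegral do rewrite -wP_upd.
  by apply: ae_eq_Rint PQ; [exact: itg_meas iP|exact: itg_meas iL].
have E : \int[gam]_x f x = - \int[gam]_x ((g x ord0 i - x ord0 i * f x) * x ord0 i).
  rewrite (Rint_upd gamP i itf) (Rint_upd gamP i iD) -RintN; last exact: (itg_upd_Rint gamP i iD).
  apply: ae_eq_Rint key; first exact: itg_meas (itg_upd_Rint gamP i itf).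
  exact: itg_meas (itgN (itg_upd_Rint gamP i iD)).
have E2 x : (g x ord0 i - x ord0 i * f x) * x ord0 i = g x ord0 i * x ord0 i - x ord0 i ^+ 2 * f x.
  by ring.
move: E; under [in RHS]eq_Rintegral do rewrite E2.
rewrite RintB// int1; lra.
Qed.

End deficit.

(** Stated for extended integrals because all that is known about [ln f] under [mu] is the upper
    bound [h]; its integral may not be finite in advance. *)
Lemma le_integral_ae d (T : measurableType d) (R : realType) (m : {measure set T -> \bar R})
    (h k : T -> R) : measurable_fun setT h -> measurable_fun setT k ->
  (\forall x \ae m, h x <= k x) ->
  (\int[m]_x (h x)%:E <= \int[m]_x (k x)%:E)%E.
Proof.
move=> mh mk hk.
have mEh : measurable_fun setT (EFin \o h) by exact/measurable_EFinP.
have mEk : measurable_fun setT (EFin \o k) by exact/measurable_EFinP.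
rewrite [leLHS]integralE [leRHS]integralE; apply: leeB.
  apply: ae_ge0_le_integral => //; [exact: measurable_funepos|exact: measurable_funepos|].
  apply: ae_S hk => x hkx _; rewrite !funeposE ge_max !le_max lexx orbT andbT.
  by rewrite lee_fin hkx.
apply: ae_ge0_le_integral => //; [exact: measurable_funeneg|exact: measurable_funeneg|].
apply: ae_S hk => x hkx _; rewrite !funenegE ge_max !le_max lexx orbT andbT.
by rewrite leeN2 lee_fin hkx.
Qed.

Section deficit.
Context (R : realType) (n : nat).
Local Notation V := 'rV[R]_n.
Variables (gam mu : probability V R) (f : V -> R) (g : V -> V).
Hypothesis gamP : is_std_gaussian gam.
Hypothesis fP : is_density gam mu f.
Hypothesis m2f : (\int[mu]_x (sqnorm x)%:E < +oo)%E.
Hypothesis wg : weak_grad gam f g.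
Hypothesis fi : (fisher_info mu f g < +oo)%E.
Variables (T : 'I_n -> V -> R) (h : V -> R).
Hypothesis K : knothe gam n f g T h.

Let H : good gam n f g := good_density gamP fP m2f wg fi.
Let f0 := good_ge0 H.
Let itf := good_itg H.
Let mf := itg_meas itf.
Let mT := knothe_measT K.

Let I i := \int[gam]_x (g x ord0 i ^+ 2 / f x).
Let G i := \int[gam]_x (g x ord0 i * T i x).
Let M i := \int[gam]_x (x ord0 i * T i x * f x).
Let m2 i := \int[gam]_x (x ord0 i ^+ 2 * f x).

(** Expands the mean of [(v_i + T_i - (1 + la) X_i)^2 >= 0] with [E[v_i X_i] = m2 i - 1] and
    [E[T_i^2] = 1]. The free parameter [la] carries the Cauchy-Schwarz step without a division by
    the second moment. *)
Let D_ge (la : R) i :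
  2 * la * (M i - 1) - la ^+ 2 * m2 i <= I i - 2 * M i + 2 * G i - m2 i + 3.
Proof.
have ii := ltn_ord i.
have [iT2 T2] := knothe_sqr K ii.
have igT := itg_gradM H ii (mT i) iT2.
have ixT := itg_coordM H ii (mT i) iT2.
have [igx gx] := Rint_gradX gamP fP m2f wg fi i.
have ix2 := good_itgx2 H ii.
have iI := good_fisher H ii.
have iS1 : itg gam (fun x : V => g x ord0 i ^+ 2 / f x + f x * T i x ^+ 2 +
   (1 + la) ^+ 2 * (x ord0 i ^+ 2 * f x)).
  by apply: itgD; [exact: itgD|exact: itgZ].
have iS2 : itg gam (fun x : V => 2 * (g x ord0 i * T i x) - 2 * (1 + la) * (g x ord0 i * x ord0 i)
   - 2 * (1 + la) * (x ord0 i * T i x * f x)).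
  by apply: itgB; [apply: itgB; exact: itgZ|exact: itgZ].
have : 0 <= \int[gam]_x (g x ord0 i ^+ 2 / f x + f x * T i x ^+ 2 +
   (1 + la) ^+ 2 * (x ord0 i ^+ 2 * f x) +
   (2 * (g x ord0 i * T i x) - 2 * (1 + la) * (g x ord0 i * x ord0 i)
   - 2 * (1 + la) * (x ord0 i * T i x * f x))).
  apply: Rint_ge0_ae; first exact: itgD.
  apply: ae_S (good_zero H ii) => x z.
  have [fx|fx] := eqVneq (f x) 0; first by rewrite z// fx !(expr0n, mul0r, mulr0, subr0, addr0).
  have fx0 : 0 < f x by rewrite lt_neqAle eq_sym fx f0.
  rewrite (_ : _ + _ = (g x ord0 i / f x + T i x - (1 + la) * x ord0 i) ^+ 2 * f x).
    by rewrite mulr_ge0 ?sqr_ge0.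
  by field.
rewrite RintD// RintD; [|exact: itgD|exact: itgZ].
rewrite RintD// RintZ// T2 RintB; [|apply: itgB; exact: itgZ|exact: itgZ].
rewrite RintB; [|exact: itgZ|exact: itgZ].
rewrite !RintZ// gx -/(I i) -/(M i) -/(G i) -/(m2 i).
move=> HH; rewrite -subr_ge0; apply: le_trans HH _.
by rewrite le_eqVlt; apply/orP; left; apply/eqP; ring.
Qed.

(** Half the sum of [D_ge], once [ln f] is replaced by its majorant [h]. With [M] and [m2] the two
    sums and [m2 > 0], the best [la] gives [(M - n)^2 / (2 m2)]. *)
Lemma deficit_ge (la : R) :
  ((la * ((\sum_i \int[gam]_x (x ord0 i * T i x * f x)) - n%:R) -
    la ^+ 2 / 2 * \sum_i \int[gam]_x (x ord0 i ^+ 2 * f x))%:E <= lsi_deficit mu f g)%E.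
Proof.
have mh := knothe_meas K.
have ifh := knothe_itg K.
have imh : itg mu h.
  by apply/(itg_mu fP mh); have := ifh; congr (itg _ _); apply/funext => x; rewrite mulrC.
have Eh : (\int[mu]_x (h x)%:E = (\int[gam]_x (f x * h x))%:E)%E.
  rewrite -EFin_Rint// (Rint_mu fP imh); congr (_%:E).
  by apply: eq_Rintegral => x _; rewrite mulrC.
have mln : measurable_fun setT (fun x => ln (f x)) by exact: measurableT_comp.
have lnh := le_integral_ae mln mh (ae_mu fP (knothe_ln K)).
apply: (@le_trans _ _ ((2^-1)%:E * fisher_info mu f g - \int[mu]_x (h x)%:E)%E); last exact: leeB.
rewrite (fisherE fP wg fi) Eh -EFinM -EFinB lee_fin (knothe_int K).
have -> : \sum_(i < n | (i < n)%N) (\int[gam]_x (x ord0 i * T i x * f x) -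
    \int[gam]_x (g x ord0 i * T i x) + (\int[gam]_x (x ord0 i ^+ 2 * f x)) / 2 - 3 / 2) =
    \sum_(i < n) (M i - G i + m2 i / 2 - 3 / 2) by apply: eq_bigl => i; rewrite ltn_ord.
rewrite -[n%:R](_ : \sum_(i < n) 1 = _); last by rewrite sumr_const card_ord.
rewrite -sumrB !mulr_sumr -!sumrB; apply: ler_sum => i _.
have := D_ge la i; rewrite -/(I i) -/(M i) -/(m2 i); lra.
Qed.

End deficit.

(** * Couplings and decompositions *)

Section gauss_mean.
Context (R : realType).
Local Notation lam := (@lebesgue_measure R).
Local Notation g1 := (@normal_prob R 0 1).

Lemma itg_g1_id : itg g1 (fun s => s).
Proof.
have i1 : itg g1 (fun=> 1 : R) by exact: finite_measure_integrable_cst.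
apply: (itg_le _ (itgD (@itg_g1_sqr R) i1)); first exact: measurable_id.
by move=> s; rewrite ler_norml; apply/andP; split; nra.
Qed.

(* As for [Rint_g1_sqr], now translating the density. *)
Lemma Rint_g1_id : \int[g1]_s s = 0.
Proof.
have i1 := itg_g1_id.
have i2 : itg lam (fun s => s * nphi s) by apply/itg_g1 => //; exact: measurable_id.
rewrite Rint_g1//; set m := \int[lam]_s _.
have key t : t * m <= t ^+ 2 / 2.
  have ipdf : itg lam (normal_pdf t 1) by exact: integrable_normal_pdf.
  have Epdf : \int[lam]_s normal_pdf t 1 s = 1 by rewrite /Rintegral integral_normal_pdf.
  have : \int[lam]_s ((1 - t ^+ 2 / 2) * nphi s + t * (s * nphi s)) <= \int[lam]_s normal_pdf t 1 s.
    apply: le_Rint => //.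
      by apply: itgD; [apply: itgZ; exact: itg_nphi|exact: itgZ].
    move=> s; rewrite nphiE normal_pdfE ?oner_neq0// /normal_fun expr1n.
    have -> : - (s - t) ^+ 2 / (1 *+ 2) = - s ^+ 2 / 2 + (t * s - t ^+ 2 / 2) :> R by field.
    rewrite expRD.
    rewrite (_ : _ + _ = normal_peak 1 * (expR (- s ^+ 2 / 2) * (1 + (t * s - t ^+ 2 / 2)))); last by ring.
    apply: ler_wpM2l; first exact: normal_peak_ge0.
    by apply: ler_wpM2l; [exact: expR_ge0|exact: expR_ge1Dx].
  rewrite RintD; [|apply: itgZ; exact: itg_nphi|exact: itgZ].
  rewrite !RintZ//; last exact: itg_nphi.
  by rewrite Rint_nphi Epdf -/m; lra.
have := key m; have := key (- m); nra.
Qed.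

End gauss_mean.

Section couplings.
Context (R : realType) (n : nat).
Local Notation V := 'rV[R]_n.

Lemma measurable_sqnorm : measurable_fun setT (@sqnorm R n).
Proof.
rewrite /sqnorm /dotv; apply: measurable_sum => i.
by apply: measurable_funM; exact: measurable_coord.
Qed.

Lemma sqnorm_ge0 (x : V) : 0 <= sqnorm x.
Proof. by apply: sumr_ge0 => i _; rewrite -expr2 sqr_ge0. Qed.

Lemma measurable_sub d (O : measurableType d) (Y Z : O -> V) : measurable_fun setT Y ->
  measurable_fun setT Z -> measurable_fun setT (fun w => Y w - Z w).
Proof.
move=> mY mZ; apply: measurable_rVP => i; under eq_fun do rewrite !mxE.
apply: measurable_funB.
  exact: measurableT_comp (@measurable_coord R n i) mY.
exact: measurableT_comp (@measurable_coord R n i) mZ.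
Qed.

Lemma W2sq_le d (O : measurableType d) (P : probability O R) (Y Z : O -> V) (nu : set V -> \bar R) :
  measurable_fun setT Y -> measurable_fun setT Z ->
  (forall A, measurable A -> P (Z @^-1` A) = nu A) ->
  (W2sq (fun A => P (Y @^-1` A)) nu <= \int[P]_w (sqnorm (Y w - Z w))%:E)%E.
Proof.
move=> mY mZ Znu.
have mYZ : measurable_fun setT (fun w => (Y w, Z w)) by exact/measurable_fun_pairP.
pose F : {mfun O >-> (V * V)%type} := HB.pack_for {mfun O >-> (V * V)%type} (fun w => (Y w, Z w))
  (isMeasurableFun.Build _ _ _ _ _ mYZ).
apply: ereal_inf_lbound; exists (distribution P F).
  split => A mA.
    rewrite /distribution /pushforward; congr (P _).
    by apply/seteqP; split => w /=; [case|].
  rewrite -Znu// /distribution /pushforward; congr (P _).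
  by apply/seteqP; split => w /=; [case|].
rewrite /distribution ge0_integral_pushforward//.
- by apply/measurable_EFinP; apply: (measurableT_comp measurable_sqnorm); exact: measurable_sub.
- by move=> z; rewrite lee_fin sqnorm_ge0.
Qed.

End couplings.

Section mixture.
Context d (T : measurableType d) (R : realType).
Variables (P1 P2 : {measure set T -> \bar R}) (a b : {nonneg R}).

Definition mixture := measure_add (mscale a P1) (mscale b P2).

HB.instance Definition _ := Measure.on mixture.

Lemma mixtureE A : mixture A = (a%:num%:E * P1 A + b%:num%:E * P2 A)%E.
Proof. by rewrite /mixture measure_addE. Qed.

Lemma ge0_integral_mixture (k : T -> R) : measurable_fun setT k -> (forall x, 0 <= k x) ->
  (\int[mixture]_x (k x)%:E = a%:num%:E * \int[P1]_x (k x)%:E + b%:num%:E * \int[P2]_x (k x)%:E)%E.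
Proof.
move=> mk k0; have mEk : measurable_fun setT (EFin \o k) by exact/measurable_EFinP.
have k0' x : (0 <= (k x)%:E)%E by rewrite lee_fin.
by rewrite ge0_integral_measure_add// !ge0_integral_mscale.
Qed.

Lemma itg_mixture (k : T -> R) : itg P1 k -> itg P2 k -> itg mixture k.
Proof.
move=> i1 i2; have mk := itg_meas i1; apply: itgP => //.
rewrite ge0_integral_mixture//; last exact: measurableT_comp.
by rewrite -!EFin_Rint ?ltry//; exact: itg_norm.
Qed.

Lemma Rint_mixture (k : T -> R) : itg P1 k -> itg P2 k ->
  \int[mixture]_x k x = a%:num * \int[P1]_x k x + b%:num * \int[P2]_x k x.
Proof.
move=> i1 i2.
have pos (h : T -> R) : itg P1 h -> itg P2 h -> (forall x, 0 <= h x) ->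
    \int[mixture]_x h x = a%:num * \int[P1]_x h x + b%:num * \int[P2]_x h x.
  move=> h1 h2 h0; have := ge0_integral_mixture (itg_meas h1) h0.
  rewrite -!EFin_Rint//; last exact: itg_mixture.
  by case.
have n1 := itg_norm i1; have n2 := itg_norm i2.
have s1 := itgD i1 n1; have s2 := itgD i2 n2.
have E x : k x = (k x + `|k x|) - `|k x| by ring.
have s0 x : 0 <= k x + `|k x| by have := ler_norm (- k x); rewrite normrN; lra.
have EE (m : {measure set T -> \bar R}) : itg m k ->
    \int[m]_x k x = \int[m]_x (k x + `|k x|) - \int[m]_x `|k x|.
  move=> im; have nm := itg_norm im; rewrite -RintB//; last exact: itgD.
  by apply: eq_Rintegral => x _; rewrite -E.
rewrite (EE P1)// (EE P2)// EE; last exact: itg_mixture.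
by rewrite !pos//; ring.
Qed.

End mixture.

Section prob_mixture.
Context d (T : measurableType d) (R : realType).
Variables (P1 P2 : probability T R) (a b : {nonneg R}).
(* The proof of a + b = 1 is an argument so that the probability structure can be inferred. *)
Definition pmixture (_ : a%:num + b%:num = 1) := mixture P1 P2 a b.
Variable ab : a%:num + b%:num = 1.
HB.instance Definition _ := Measure.on (pmixture ab).
Let pmixtureT : pmixture ab setT = 1%E.
Proof.
rewrite /pmixture mixtureE.
rewrite [X in (_ * X + _)%E](probability_setT P1) [X in (_ + _ * X)%E](probability_setT P2).
by rewrite !mule1 -EFinD ab.
Qed.
HB.instance Definition _ := Measure_isProbability.Build _ _ _ (pmixture ab) pmixtureT.
End prob_mixture.

Lemma Rint_sum d (T : measurableType d) (R : realType) (m : {measure set T -> \bar R})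
    (I : finType) (h : I -> T -> R) : (forall i, itg m (h i)) ->
  itg m (fun x => \sum_i h i x) /\ \int[m]_x (\sum_i h i x) = \sum_i \int[m]_x h i x.
Proof.
move=> ih; elim: (index_enum I) => [|j s [IH1 IH2]].
  rewrite big_nil; under eq_fun do rewrite big_nil.
  split; first exact: integrable0.
  by rewrite /Rintegral integral0.
rewrite big_cons; under eq_fun do rewrite big_cons.
split; first exact: itgD.
by rewrite RintD// IH2.
Qed.

Definition has_decomposition (R : realType) (n : nat) (gam mu : probability 'rV[R]_n R)
    (f : 'rV[R]_n -> R) (g : 'rV[R]_n -> 'rV[R]_n) : Prop :=
  exists (d : measure_display) (T : measurableType d) (P : probability T R)
         (Y W : T -> 'rV[R]_n),
    [/\ measurable_fun setT Y, measurable_fun setT W,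
        (\int[P]_w (sqnorm (Y w))%:E < +oo)%E &
        (\int[P]_w (sqnorm (W w))%:E < +oo)%E] /\
    (forall A, measurable A ->
       P ((fun w => Y w + W w) @^-1` A) = mu A) /\
    (\int[P]_w (dotv (Y w) (W w))%:E = 0)%E /\
    (lsi_deficit mu f g >=
       (2^-1)%:E * W2sq (fun A => P (Y @^-1` A)) gam)%E.

Section main.
Context (R : realType) (n : nat).
Local Notation V := 'rV[R]_n.
Local Notation g1 := (@normal_prob R 0 1).
Variables (gam mu : probability V R) (f : V -> R) (g : V -> V).
Hypothesis gamP : is_std_gaussian gam.
Hypothesis fP : is_density gam mu f.
Hypothesis m2f : (\int[mu]_x (sqnorm x)%:E < +oo)%E.
Hypothesis wg : weak_grad gam f g.
Hypothesis fi : (fisher_info mu f g < +oo)%E.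

Let H : good gam n f g := good_density gamP fP m2f wg fi.
Let f0 := good_ge0 H.
Let itf := good_itg H.
Let mf := itg_meas itf.

(* X - Y is the second summand; (Y, Z) is the coupling that bounds W_2. *)
Lemma decomposition_of_coupling d (O : measurableType d) (P : probability O R)
    (X Y Z : O -> V) (r : R) :
  measurable_fun setT X -> measurable_fun setT Y -> measurable_fun setT Z ->
  (forall A, measurable A -> P (X @^-1` A) = mu A) ->
  (forall A, measurable A -> P (Z @^-1` A) = gam A) ->
  (forall i, itg P (fun w => X w ord0 i ^+ 2)) ->
  (forall i, itg P (fun w => Y w ord0 i ^+ 2)) ->
  \int[P]_w (\sum_i Y w ord0 i * (X w ord0 i - Y w ord0 i)) = 0 ->
  (\int[P]_w (sqnorm (Y w - Z w))%:E = r%:E)%E ->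
  ((r / 2)%:E <= lsi_deficit mu f g)%E ->
  has_decomposition gam mu f g.
Proof.
move=> mX mY mZ lX lZ iX iY YW EZ rD.
have mc (F : O -> V) i : measurable_fun setT F -> measurable_fun setT (fun w => F w ord0 i).
  by move=> mF; exact: measurableT_comp (@measurable_coord R n i) mF.
have fin (F : O -> V) : (forall i, itg P (fun w => F w ord0 i ^+ 2)) ->
    (\int[P]_w (sqnorm (F w))%:E < +oo)%E.
  move=> iF; have [i1 _] := Rint_sum iF.
  rewrite (_ : (\int[P]_w _)%E = (\int[P]_w (\sum_i F w ord0 i ^+ 2)%:E)%E).
    by rewrite -EFin_Rint// ltry.
  by apply: eq_integral => w _; congr (_%:E); apply: eq_bigr => i _; rewrite expr2.
have iW i : itg P (fun w => (X w - Y w) ord0 i ^+ 2).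
  apply: (itg_le _ (itgD (itgZ 2 (iX i)) (itgZ 2 (iY i)))).
    by apply: measurable_funX; apply: mc; exact: measurable_sub.
  move=> w; rewrite !mxE ger0_norm ?sqr_ge0// -subr_ge0.
  by rewrite (_ : _ - _ = (X w ord0 i + Y w ord0 i) ^+ 2) ?sqr_ge0//; ring.
have iYW i : itg P (fun w => Y w ord0 i * (X w ord0 i - Y w ord0 i)).
  apply: (itg_le _ (itgD (iX i) (itgZ 2 (iY i)))).
    by apply: measurable_funM; [exact: mc|apply: measurable_funB; exact: mc].
  by move=> w; rewrite ler_norml; apply/andP; split; nra.
exists d, O, P, Y, (fun w => X w - Y w); split; last split; last split.
- by split; [|exact: measurable_sub|exact: fin|exact: fin].
- move=> A mA; rewrite -lX//; congr (P _); apply/seteqP.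
  by split => w /=; rewrite addrC subrK.
- have [i1 _] := Rint_sum iYW.
  rewrite -[0%E]/(0%:E) -YW EFin_Rint//; apply: eq_integral => w _.
  by congr (_%:E); apply: eq_bigr => i _; rewrite !mxE.
- apply: le_trans rD; rewrite mulrC EFinM lee_wpmul2l ?lee_fin//.
  by rewrite -EZ; exact: W2sq_le.
Qed.

Variables (T : 'I_n -> V -> R) (h : V -> R).
Hypothesis K : knothe gam n f g T h.
Let mT := knothe_measT K.

Definition rowT (x : V) : V := \row_i T i x.

Lemma measurable_rowT : measurable_fun setT rowT.
Proof. by apply: measurable_rVP => i; under eq_fun do rewrite mxE; exact: mT. Qed.

Lemma rowT_law A : measurable A -> mu (rowT @^-1` A) = gam A.
Proof.
move=> mA; rewrite -[LHS]/(pushforward mu rowT A).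
pose F : {mfun V >-> V} := HB.pack_for {mfun V >-> V} rowT
  (isMeasurableFun.Build _ _ _ _ _ measurable_rowT).
have U := @rV_measure_unique R n (distribution mu F) gam.
apply: U => //; last by move=> k; rewrite (le_lt_trans (probability_le1 _ _)) ?ltry//; exact: measurable_box.
move=> a b.
pose B i : set R := `]a i, b i[%classic.
have mB i : measurable (B i) by exact: measurable_itv.
have mbox : measurable (rowT @^-1` box a b).
  rewrite -[X in measurable X]setTI; apply: measurable_rowT => //; exact: measurable_box.
rewrite [RHS](_ : _ = (\prod_(i < n) g1 (B i))%E); last by rewrite boxE; exact: (gamP mB).
transitivity (mu (rowT @^-1` box a b)); first by [].
have [_ [_ muE]] := fP; rewrite muE//.
have := Rint_dmeas itf f0 mbox; rewrite /dmeas => ->.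
have -> : (\prod_(i < n) g1 (B i))%E = (\prod_(i < n) fine (g1 (B i)))%:E.
  rewrite -prodEFin; apply: eq_bigr => i _; rewrite fineK//.
  by apply: fin_num_measure; exact: mB.
congr (_%:E).
have := knothe_push K mB.
under [X in _ = X -> _]eq_bigl do rewrite ltn_ord.
move=> <-; apply: eq_Rintegral => x _; congr (_ * _).
under eq_bigl do rewrite ltn_ord.
rewrite indicE; case: (boolP (x \in rowT @^-1` box a b)) => [/set_mem xB|xB].
  rewrite big1// => i _; rewrite indicE mem_set//.
  by have := xB i; rewrite mxE /B /= in_itv.
have [i Hi] : exists i, ~ B i (T i x).
  apply/not_existsP => Hx; move/negP: xB; apply; apply/mem_set => i.
  by have /contrapT := Hx i; rewrite mxE /B /= in_itv.
by rewrite (bigD1 i)//= indicE memNset// mul0r.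
Qed.

End main.

(** * The two cases of the construction *)

Section cases.
Context (R : realType) (n : nat).
Local Notation V := 'rV[R]_n.
Local Notation g1 := (@normal_prob R 0 1).
Variables (gam mu : probability V R) (f : V -> R) (g : V -> V).
Hypothesis gamP : is_std_gaussian gam.
Hypothesis fP : is_density gam mu f.
Hypothesis m2f : (\int[mu]_x (sqnorm x)%:E < +oo)%E.
Hypothesis wg : weak_grad gam f g.
Hypothesis fi : (fisher_info mu f g < +oo)%E.
Variables (T : 'I_n -> V -> R) (h : V -> R).
Hypothesis K : knothe gam n f g T h.

Let H : good gam n f g := good_density gamP fP m2f wg fi.
Let mT := knothe_measT K.
Let mcoord i := @measurable_coord R n i.
Let mrow := measurable_rowT K.
Let Tlaw := rowT_law gamP fP m2f wg fi K.

Let m2 := \sum_i \int[gam]_x (x ord0 i ^+ 2 * f x).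
Let M := \sum_i \int[gam]_x (x ord0 i * T i x * f x).

Let itg_T2 i : itg mu (fun x => T i x ^+ 2) /\ \int[mu]_x T i x ^+ 2 = 1.
Proof.
have [i1 e1] := knothe_sqr K (ltn_ord i).
have i2 : itg mu (fun x => T i x ^+ 2).
  apply/(itg_mu fP); first exact: measurable_funX.
  by have := i1; congr (itg _ _); apply/funext => x; rewrite mulrC.
split => //; rewrite (Rint_mu fP i2) -e1.
by apply: eq_Rintegral => x _; rewrite mulrC.
Qed.

Let itg_xT i : itg mu (fun x : V => x ord0 i * T i x) /\
  \int[mu]_x (x ord0 i * T i x) = \int[gam]_x (x ord0 i * T i x * f x).
Proof.
have [i1 _] := knothe_sqr K (ltn_ord i).
have i2 : itg mu (fun x : V => x ord0 i * T i x).
  apply/(itg_mu fP); first exact: measurable_funM.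
  exact: (itg_coordM H (ltn_ord i) (mT i) i1).
by split => //; rewrite (Rint_mu fP i2).
Qed.

(** The distance and the orthogonality defect are quadratic forms in [(X, T)], so the three numbers
    [m2], [M] and [n] determine their means. *)
Let quad (al be ga : R) (k : V -> R) :
  (forall x, k x = \sum_i (al * x ord0 i ^+ 2 + be * (x ord0 i * T i x) + ga * T i x ^+ 2)) ->
  itg mu k /\ \int[mu]_x k x = al * m2 + be * M + ga * n%:R.
Proof.
move=> kE; rewrite (funext kE).
have ix2 i := itg_mu_sqr m2f i.
have [//|i1 ->] := @Rint_sum _ _ _ mu _
  (fun i (x : V) => al * x ord0 i ^+ 2 + be * (x ord0 i * T i x) + ga * T i x ^+ 2).
  move=> i; have [iT _] := itg_T2 i; have [ixT _] := itg_xT i.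
  by apply: itgD; [apply: itgD|]; exact: itgZ.
split => //.
have -> : n%:R = \sum_(i < n) 1 :> R by rewrite sumr_const card_ord.
rewrite /m2 /M !mulr_sumr -!big_split/=; apply: eq_bigr => i _.
have [iT eT] := itg_T2 i; have [ixT exT] := itg_xT i.
rewrite RintD; [|by apply: itgD; exact: itgZ|exact: itgZ].
rewrite RintD; [|exact: itgZ|exact: itgZ].
by rewrite !RintZ// eT exT (Rint_mu fP (ix2 i)).
Qed.

Let m2_ge0 : 0 <= m2.
Proof.
by apply: sumr_ge0 => i _; apply: Rint_ge0 => x; rewrite mulr_ge0 ?sqr_ge0 ?(good_ge0 H).
Qed.

Let dge := deficit_ge gamP fP m2f wg fi K.

Lemma decomposition_lt : M < n%:R -> has_decomposition gam mu f g.
Proof.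
move=> Mn; have k0 : 0 < n%:R - M by rewrite subr_gt0.
(* In L^2, [a] is the norm of [X/2] and [b] that of [T - X/2]. *)
pose a := Num.sqrt (m2 / 4); pose b := Num.sqrt (m2 / 4 + (n%:R - M)).
have a0 : 0 <= a by rewrite sqrtr_ge0.
have b0 : 0 < b by rewrite sqrtr_gt0 ltr_wpDl// divr_ge0.
have a2 : a ^+ 2 = m2 / 4 by rewrite sqr_sqrtr// divr_ge0.
have b2 : b ^+ 2 = m2 / 4 + (n%:R - M) by rewrite sqr_sqrtr// addr_ge0 ?divr_ge0// ltW.
have ab : a <= b by apply: ler_wsqrtr; rewrite lerDl ltW.
(* These are the coefficients of [Y = X/2 + r (T - X/2)], the radial projection of [T] onto the
   sphere, at distance [b - a] from [T]. *)
pose r := a / b; pose c := (1 - r) / 2.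
have rb : r * b = a by rewrite /r divfK// gt_eqF.
have m2E : m2 = 4 * a ^+ 2 by rewrite a2; field.
have ME : M = n%:R - (b ^+ 2 - a ^+ 2) by rewrite b2 a2; ring.
have rb2 : r ^+ 2 * b ^+ 2 = a ^+ 2 by rewrite -exprMn rb.
pose Y (x : V) : V := \row_i (c * x ord0 i + r * T i x).
have mY : measurable_fun setT Y.
  apply: measurable_rVP => i; under eq_fun do rewrite mxE.
  by apply: measurable_funD; apply: measurable_funM.
have ix2 i := itg_mu_sqr m2f i.
have [iS ES] : itg mu (fun x => sqnorm (Y x - rowT T x)) /\
    \int[mu]_x sqnorm (Y x - rowT T x) = c ^+ 2 * m2 + 2 * c * (r - 1) * M + (r - 1) ^+ 2 * n%:R.
  by apply: quad => x; apply: eq_bigr => i _; rewrite !mxE; ring.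
have [_ E0] : itg mu (fun x => \sum_i Y x ord0 i * (x ord0 i - Y x ord0 i)) /\
    \int[mu]_x (\sum_i Y x ord0 i * (x ord0 i - Y x ord0 i)) =
    c * (1 - c) * m2 + r * (1 - 2 * c) * M + (- r ^+ 2) * n%:R.
  by apply: quad => x; apply: eq_bigr => i _; rewrite !mxE; ring.
apply: (@decomposition_of_coupling _ _ gam mu f g _ V mu id Y (rowT T) ((b - a) ^+ 2)) => //.
- move=> i; have [iT _] := itg_T2 i.
  apply: (itg_le _ (itgD (itgZ (2 * c ^+ 2) (ix2 i)) (itgZ (2 * r ^+ 2) iT))).
    by apply: measurable_funX; exact: measurableT_comp (mcoord i) mY.
  move=> x; rewrite mxE ger0_norm ?sqr_ge0// -subr_ge0.
  by rewrite (_ : _ - _ = (c * x ord0 i - r * T i x) ^+ 2) ?sqr_ge0//; ring.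
- rewrite E0 m2E ME /c.
  transitivity (a ^+ 2 - r ^+ 2 * b ^+ 2); last by rewrite rb2 subrr.
  by field.
- rewrite -EFin_Rint// ES; congr (_%:E); rewrite m2E ME /c.
  transitivity ((b - r * b) ^+ 2); last by rewrite rb.
  by field.
(* At [la = - t] the linear term of [deficit_ge] is exactly [(b - a)^2], and the quadratic one takes
   away at most half of it since [2 t a <= b - a]. Unlike the optimal [la], this choice remains
   finite for [a = 0]. *)
pose t := (b - a) / (b + a).
have ba : 0 < b + a by rewrite ltr_wpDr.
have tba : t * (b + a) = b - a by rewrite /t divfK// gt_eqF.
have t0 : 0 <= t by rewrite mulr_ge0 ?invr_ge0 ?subr_ge0//; exact: ltW ba.
apply: le_trans (dge (- t)); rewrite lee_fin -/M -/m2 ME m2E.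
have E1 : - t * (n%:R - (b ^+ 2 - a ^+ 2) - n%:R) = (b - a) ^+ 2.
  by transitivity (t * (b + a) * (b - a)); [ring|rewrite tba expr2].
have E2 : 0 <= (b - a) ^+ 2 - (2 * (t * a)) ^+ 2.
  have ta0 : 0 <= 2 * (t * a) by apply: mulr_ge0 => //; exact: mulr_ge0 t0 a0.
  rewrite subr_ge0 ler_sqr ?nnegrE// ?subr_ge0//.
  rewrite -tba; have : t * a <= t * b by rewrite ler_wpM2l.
  by lra.
rewrite E1; move: E2; rewrite sqrrN !exprMn; lra.
Qed.

(** Read off from [T], whose law under [mu] is [gam]. *)
Let muT2 i : itg gam (fun x : V => x ord0 i ^+ 2) /\ \int[gam]_x x ord0 i ^+ 2 = 1.
Proof.
have [iT eT] := itg_T2 i.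
have mx2 : measurable_fun setT (fun x : V => x ord0 i ^+ 2) by exact: measurable_funX.
have E x : rowT T x ord0 i ^+ 2 = T i x ^+ 2 by rewrite mxE.
have i1 : itg gam (fun x : V => x ord0 i ^+ 2).
  by apply/(itg_push mrow Tlaw mx2); rewrite /comp; under eq_fun do rewrite E.
split => //; rewrite -(Rint_push mrow Tlaw i1) -eT.
by apply: eq_Rintegral => x _; rewrite E.
Qed.

Let gam_mean i : itg gam (fun x : V => x ord0 i) /\ \int[gam]_x x ord0 i = 0.
Proof.
have [i2 _] := muT2 i.
have i1 : itg gam (fun=> 1 : R) by exact: finite_measure_integrable_cst.
have ix : itg gam (fun x : V => x ord0 i).
  apply: (itg_le _ (itgD i2 i1)); first exact: mcoord.
  by move=> x; rewrite ler_norml; apply/andP; split; nra.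
split => //; rewrite (Rint_upd gamP i ix).
have E (x : V) : \int[g1]_s upd i (x, s) ord0 i = 0.
  by under eq_Rintegral do rewrite updE eqxx; exact: Rint_g1_id.
under eq_Rintegral do rewrite E.
by rewrite /Rintegral integral0.
Qed.

Lemma decomposition_ge : n%:R <= M -> has_decomposition gam mu f g.
Proof.
move=> nM.
(* [th] weights the law of [(X, T)] in the mixture. The independent part contributes nothing to
   [E[X.Y]] because [gam] is centred, so the mixture has [E[X.Y] = th * M]. If [M = 0], then [n = 0]
   and any weight will do. *)
have [th [th0 th1 thM]] : exists th, [/\ 0 <= th, th <= 1 & th * M = n%:R].
  have [M0|M0] := eqVneq M 0.
    have n0 : n%:R = 0 :> R by apply/eqP; rewrite eq_le ler0n andbT -M0.
    by exists 0; rewrite mul0r n0.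
  have Mp : 0 < M by rewrite lt_neqAle eq_sym M0 (le_trans _ nM).
  by exists (n%:R / M); rewrite divfK// divr_ge0 ?ler0n ?(ltW Mp)// ler_pdivrMr// mul1r.
have uth : 0 <= 1 - th by rewrite subr_ge0.
pose a := NngNum th0; pose b := NngNum uth.
have ab : a%:num + b%:num = 1 by rewrite /= addrC subrK.
have mpair : measurable_fun setT (fun x : V => (x, rowT T x)).
  by apply/measurable_fun_pairP; split; [exact: measurable_id|exact: mrow].
pose F : {mfun V >-> (V * V)%type} := HB.pack_for {mfun V >-> (V * V)%type} (fun x => (x, rowT T x))
  (isMeasurableFun.Build _ _ _ _ _ mpair).
pose P1 : probability (V * V)%type R := distribution mu F.
pose P2 : probability (V * V)%type R := (mu \x gam)%E.
pose P : probability (V * V)%type R := pmixture P1 P2 ab.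
have PE A : P A = (th%:E * P1 A + (1 - th)%:E * P2 A)%E by exact: mixtureE.
have split1 x : (th%:E * x + (1 - th)%:E * x = x :> \bar R)%E.
  by rewrite -ge0_muleDl ?lee_fin// -EFinD addrC subrK mul1e.
have P2X A : measurable A -> P2 (fst @^-1` A) = mu A.
  move=> mA; rewrite (_ : fst @^-1` A = A `*` setT); last first.
    by apply/seteqP; split => z /=; [split|case].
  transitivity (mu A * gam setT)%E; first exact: product_measure1E.
  by rewrite [X in (_ * X)%E](probability_setT gam) mule1.
have P2Y A : measurable A -> P2 (snd @^-1` A) = gam A.
  move=> mA; rewrite (_ : snd @^-1` A = setT `*` A); last first.
    by apply/seteqP; split => z /=; [split|case].
  transitivity (mu setT * gam A)%E; first exact: product_measure1E.
  by rewrite [X in (X * _)%E](probability_setT mu) mul1e.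
have lX A : measurable A -> P (fst @^-1` A) = mu A.
  by move=> mA; rewrite PE P2X// -[RHS]split1.
have lY A : measurable A -> P (snd @^-1` A) = gam A.
  by move=> mA; rewrite PE P2Y// -[RHS]split1 -{2}Tlaw.
have mX : measurable_fun setT (fst : V * V -> V) by exact: measurable_fst.
have mZ : measurable_fun setT (snd : V * V -> V) by exact: measurable_snd.
have ix2 i := itg_mu_sqr m2f i.
have mx2 i : measurable_fun setT (fun x : V => x ord0 i ^+ 2) by exact: measurable_funX.
have iX i : itg P (fun z : V * V => z.1 ord0 i ^+ 2) by exact: (itg_push mX lX (mx2 i)).1.
have iY i : itg P (fun z : V * V => z.2 ord0 i ^+ 2).
  by apply: (itg_push mZ lY (mx2 i)).1; have [] := muT2 i.
have iX2 i : itg P2 (fun z : V * V => z.1 ord0 i ^+ 2) by exact: (itg_push mX P2X (mx2 i)).1.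
have iY2 i : itg P2 (fun z : V * V => z.2 ord0 i ^+ 2).
  by apply: (itg_push mZ P2Y (mx2 i)).1; have [] := muT2 i.
have mXY i : measurable_fun setT (fun z : V * V => z.1 ord0 i * z.2 ord0 i).
  apply: measurable_funM; first exact: measurableT_comp (mcoord i) mX.
  exact: measurableT_comp (mcoord i) mZ.
have FE A : measurable A -> mu (F @^-1` A) = P1 A by [].
have XY1 i : itg P1 (fun z : V * V => z.1 ord0 i * z.2 ord0 i) /\
    \int[P1]_z (z.1 ord0 i * z.2 ord0 i) = \int[gam]_x (x ord0 i * T i x * f x).
  have [i1 e1] := itg_xT i.
  have E x : (F x).1 ord0 i * (F x).2 ord0 i = x ord0 i * T i x by rewrite /= mxE.
  have i2 : itg P1 (fun z : V * V => z.1 ord0 i * z.2 ord0 i).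
    by apply/(itg_push mpair FE (mXY i)); rewrite /comp; under eq_fun do rewrite E.
  split => //; rewrite -(Rint_push mpair FE i2) -e1.
  by apply: eq_Rintegral => x _; rewrite E.
have XY2 i : itg P2 (fun z : V * V => z.1 ord0 i * z.2 ord0 i) /\
    \int[P2]_z (z.1 ord0 i * z.2 ord0 i) = 0.
  have i1 : itg P2 (fun z : V * V => z.1 ord0 i * z.2 ord0 i).
    apply: (itg_le _ (itgD (iX2 i) (iY2 i))) => // z.
    by rewrite ler_norml; apply/andP; split; nra.
  split => //; have [ig eg] := gam_mean i.
  transitivity (\int[mu]_x \int[gam]_y (x ord0 i * y ord0 i)).
    exact: (Rint_prod i1).
  have E (x : V) : \int[gam]_y (x ord0 i * y ord0 i) = 0 by rewrite RintZ// eg mulr0.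
  under eq_Rintegral do rewrite E.
  by rewrite /Rintegral integral0.
have XY i : itg P (fun z : V * V => z.1 ord0 i * z.2 ord0 i) /\
    \int[P]_z (z.1 ord0 i * z.2 ord0 i) = th * \int[gam]_x (x ord0 i * T i x * f x).
  have [i1 e1] := XY1 i; have [i2 e2] := XY2 i.
  split; first exact: itg_mixture i1 i2.
  have := Rint_mixture a b i1 i2; rewrite e1 e2 mulr0 addr0; exact.
have eY i : \int[P]_z (z.2 ord0 i ^+ 2) = 1.
  by have [iy ey] := muT2 i; rewrite -ey -(Rint_push mZ lY iy).
(* The second component serves both as [Y] and as the Gaussian variable, so the cost is 0 and what
   remains is the nonnegativity of the deficit, that is [dge] at 0. *)
apply: (@decomposition_of_coupling _ _ gam mu f g _ (V * V)%type P fst snd snd 0) => //.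
- have iS i : itg P (fun z : V * V => z.2 ord0 i * (z.1 ord0 i - z.2 ord0 i)).
    by have := itgB (XY i).1 (iY i); congr (itg _ _); apply/funext => z; ring.
  have [_ ->] := Rint_sum iS.
  have E i : \int[P]_z (z.2 ord0 i * (z.1 ord0 i - z.2 ord0 i)) =
      th * \int[gam]_x (x ord0 i * T i x * f x) - 1.
    rewrite -(XY i).2 -(eY i) -RintB//; last exact: (XY i).1.
    by apply: eq_Rintegral => z _; ring.
  under eq_bigr do rewrite E.
  by rewrite sumrB -mulr_sumr -/M thM sumr_const card_ord subrr.
- by apply: integral0_eq => z _; rewrite subrr /sqnorm /dotv big1// => i _; rewrite mxE mul0r.
- by apply: le_trans (dge 0); rewrite lee_fin; lra.
Qed.

End cases.

Theorem theorem5 (R : realType) (n : nat)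
    (gam : probability 'rV[R]_n R) (mu : probability 'rV[R]_n R)
    (f : 'rV[R]_n -> R) (g : 'rV[R]_n -> 'rV[R]_n) :
  is_std_gaussian gam ->
  is_density gam mu f ->
  (\int[mu]_x (sqnorm x)%:E < +oo)%E ->
  weak_grad gam f g ->
  (fisher_info mu f g < +oo)%E ->
  exists (d : measure_display) (T : measurableType d) (P : probability T R)
         (Y W : T -> 'rV[R]_n),
    [/\ measurable_fun setT Y, measurable_fun setT W,
        (\int[P]_w (sqnorm (Y w))%:E < +oo)%E &
        (\int[P]_w (sqnorm (W w))%:E < +oo)%E] /\
    (forall A, measurable A ->
       P ((fun w => Y w + W w) @^-1` A) = mu A) /\
    (\int[P]_w (dotv (Y w) (W w))%:E = 0)%E /\
    (lsi_deficit mu f g >=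
       (2^-1)%:E * W2sq (fun A => P (Y @^-1` A)) gam)%E.
Proof.
move=> gamP fP m2f wg fi.
have [T [h K]] := knothe_exists gamP (leqnn n) (good_density gamP fP m2f wg fi).
have [nM|Mn] := leP n%:R (\sum_i \int[gam]_x (x ord0 i * T i x * f x)).
  exact: (decomposition_ge gamP fP m2f wg fi K nM).
exact: (decomposition_lt gamP fP m2f wg fi K Mn).
Qed.
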